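(* $\mathbf{FPC}=\mathbf{FP}$: a function $f:\mathbb Z^m\to\mathbb Z$ (for any $m\ge 0$) is computed by some well-typed CorePolyC program if and only if it is computable by a deterministic Turing machine in time polynomial in the total binary length of its input.
   Context: CorePolyC. Types are $\mathtt{iint},\mathtt{int},\mathtt{bool}$; $\mathsf{Int}=\{\mathtt{iint},\mathtt{int}\}$, ordered by $\mathtt{iint}\preccurlyeq\mathtt{int}$. Values are unbounded integers ($\mathbb Z$) and booleans $\#t,\#f$. Expressions: variables $x$; constants (nonempty decimal digit strings denoting natural numbers; $\mathtt{true}$, $\mathtt{false}$); operator applications $\mathtt{op}(e_1,\dots,e_m)$; parenthesized $(e)$. Operators and semantics: unary $-$ (negation); binary $+,-,/,\%$ (integer addition, subtraction, division, remainder, with division and remainder by $0$ returning $0$); $\mathtt{size}$, with $\mathtt{size}(v)=\lceil\log_2(\mathrm{abs}(v)+1)\rceil$; comparisons $\texttt{>=},\texttt{<=},\texttt{>},\texttt{<},\texttt{==},\texttt{!=}$ on integers returning booleans; boolean $\texttt{!},\texttt{\&\&},\texttt{||}$. There is no multiplication operator. Statements: declaration $t\ x;$; assignment $x=e;$; block $\{s_1\dots s_m\}$; conditional $\mathbf{if}(e)\ s_1\ \mathbf{else}\ s_2$; loop $\mathbf{for}(x<\mathtt{size}(e))\ s$ (loop bounds are always syntactically of the form $\mathtt{size}(e)$). A program is $\mathbf{int\ main}(\mathbf{int}\ x_1,\dots,\mathbf{int}\ x_m)\{s_1\dots s_k\ \mathbf{return}\ e;\}$. Semantics (big-step). A store $\Sigma$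 is a finite partial map from variables to values; $\Sigma[x\mapsto v]$ is the update. $\Sigma\vdash e\Downarrow v$: a variable $x\in\mathrm{dom}\,\Sigma$ evaluates to $\Sigma(x)$, constants to their value, $\mathtt{op}(e_1,\dots,e_m)$ to $\mathtt{op}$ applied to the values of the $e_i$. $\Sigma\vdash s\Downarrow\Sigma'$: $t\ x;$ gives $\Sigma[x\mapsto 0]$ if $t\in\mathsf{Int}$ and $\Sigma[x\mapsto\#f]$ if $t=\mathtt{bool}$; $x=e;$ (with $x\in\mathrm{dom}\,\Sigma$) gives $\Sigma[x\mapsto v]$ where $\Sigma\vdash e\Downarrow v$; a sequence or block executes its statements in order threading the store (a block returns the final store); a conditional evaluates its guard to a boolean and executes the corresponding branch; $\mathbf{for}(x<e)\ s$ evaluates $e$ once to an integer $i$, sets $\Sigma_0=\Sigma$, executes $s$ from $\Sigma_j[x\mapsto j]$ obtaining $\Sigma_{j+1}$ for $j=0,\dots,i-1$, and ends in $\Sigma_i$ (i.e. in $\Sigma$ if $i\le 0$). A program on inputs $v_1,\dots,v_m$ runs its statements from the store $[x_1\mapsto v_1,\dots,x_m\mapsto v_m]$ and outputs the value of its return expression in the resulting store. Type system. A typing environment $\Gamma$ is a finite partial map from variables to types; $\ell\in\{\#t,\#f\}$ is the loop indicator. Expression typing $\Gamma,\ell\vdash e:t$: a variable $x\in\mathrm{dom}\,\Gamma$ has type $\Gamma(x)$; digit literals have type $\mathtt{iint}$, $\mathtt{true},\mathtt{false}$ have type $\mathtt{bool}$; $\texttt{!},\texttt{\&\&},\texttt{||}$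 take $\mathtt{bool}$ arguments to $\mathtt{bool}$; comparisons take arguments with types in $\mathsf{Int}$ to $\mathtt{bool}$; $+,-,/,\%$ take arguments with types in $\mathsf{Int}$ to their supremum under $\preccurlyeq$ ($\mathtt{iint}$ iff all arguments are $\mathtt{iint}$); $\mathtt{size}$ takes only an $\mathtt{iint}$ argument, giving $\mathtt{iint}$; parentheses preserve types. Statement typing $\Gamma,\ell\vdash s:\Gamma'$: $t\ x;$ is typable iff $x\notin\mathrm{dom}\,\Gamma$ and not($\ell=\#t$ and $t=\mathtt{iint}$), giving $\Gamma[x\mapsto t]$; $x=e;$ is typable iff $x\in\mathrm{dom}\,\Gamma$, not($\ell=\#t$ and $\Gamma(x)=\mathtt{iint}$), and $\Gamma,\ell\vdash e:t$ with $t,\Gamma(x)$ both in $\mathsf{Int}$ or both $\mathtt{bool}$, giving $\Gamma$; a sequence $s_1\dots s_m$ threads $\Gamma_0=\Gamma$, $\Gamma_{i-1},\ell\vdash s_i:\Gamma_i$, giving $\Gamma_m$; a block $\{\tilde s\}$ is typable if its sequence is, giving $\Gamma$; a conditional needs a guard of type $\mathtt{bool}$ and both branches typable under $\Gamma,\ell$, giving $\Gamma$; $\mathbf{for}(x<e)\ s$ needs $\Gamma,\ell\vdash e:\mathtt{iint}$, $x\notin\mathrm{dom}\,\Gamma$, and $\Gamma[x\mapsto\mathtt{iint}],\#t\vdash s:\Gamma'$ for some $\Gamma'$, giving $\Gamma$. A program is well-typed if its statements are typable starting from $[x_1\mapsto\mathtt{int},\dots,x_m\mapsto\mathtt{int}]$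 with $\ell=\#f$, ending in some $\Gamma'$, and its return expression has a type in $\mathsf{Int}$ under $\Gamma',\#f$. Every well-typed program $p$ with $m$ inputs terminates on all inputs with an integer output, so computes a total function $[\![p]\!]:\mathbb Z^m\to\mathbb Z$. $\mathbf{FPC}$ is the set of all such functions $[\![p]\!]$. $\mathbf{FP}$ is the class of total functions $\mathbb Z^m\to\mathbb Z$ ($m\ge 0$) computable by a deterministic Turing machine in time polynomial in the total bit-length of the input (integers encoded in binary). *)

(* Defs.v *)
From mathcomp Require Import all_boot.
From Stdlib Require Import ZArith.
From Stdlib Require List.

Set Implicit Arguments.
Unset Strict Implicit.
Unset Printing Implicit Defensive.

Definition var := nat.

Inductive ty := TIint | TInt | TBool.

Definition isInt (t : ty) : bool :=
  match t with TIint | TInt => true | TBool => false end.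

Definition tsup (t1 t2 : ty) : ty :=
  match t1, t2 with TIint, TIint => TIint | _, _ => TInt end.

Inductive op :=
  | ONeg
  | OAdd | OSub | ODiv | OMod
  | OSize
  | OGe | OLe | OGt | OLt | OEq | ONe
  | ONot | OAnd | OOr.

Inductive expr :=
  | EVar (x : var)
  | ENum (n : nat)
  | ETrue
  | EFalse
  | EOp (o : op) (es : list expr)
  | EParen (e : expr).

Definition bound (e : expr) : expr := EOp OSize [:: e].

Inductive stmt :=
  | SDecl (t : ty) (x : var)
  | SAssign (x : var) (e : expr)
  | SBlock (ss : list stmt)
  | SIf (e : expr) (s1 s2 : stmt)
  | SFor (x : var) (e : expr) (s : stmt).    (* for (x < size(e)) s *)

(* int main(int x1,...,int xm) { s1 ... sk return e; } *)
Record prog := Prog { params : list var; body : list stmt; ret : expr }.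

Inductive val := VInt (z : Z) | VBool (b : bool).

Definition store := var -> option val.

Definition upd {A : Type} (S : var -> option A) (x : var) (v : A) : var -> option A :=
  fun y => if y == x then Some v else S y.

Definition zdiv (a b : Z) : Z := if (b =? 0)%Z then 0%Z else Z.quot a b.
Definition zmod (a b : Z) : Z := if (b =? 0)%Z then 0%Z else Z.rem a b.

Definition zsize (v : Z) : Z := Z.log2_up (Z.abs v + 1).

Definition op_sem (o : op) (vs : list val) : option val :=
  match o, vs with
  | ONeg, [:: VInt a] => Some (VInt (- a))
  | OAdd, [:: VInt a; VInt b] => Some (VInt (a + b))
  | OSub, [:: VInt a; VInt b] => Some (VInt (a - b))
  | ODiv, [:: VInt a; VInt b] => Some (VInt (zdiv a b))
  | OMod, [:: VInt a; VInt b] => Some (VInt (zmod a b))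
  | OSize, [:: VInt a] => Some (VInt (zsize a))
  | OGe, [:: VInt a; VInt b] => Some (VBool (b <=? a)%Z)
  | OLe, [:: VInt a; VInt b] => Some (VBool (a <=? b)%Z)
  | OGt, [:: VInt a; VInt b] => Some (VBool (b <? a)%Z)
  | OLt, [:: VInt a; VInt b] => Some (VBool (a <? b)%Z)
  | OEq, [:: VInt a; VInt b] => Some (VBool (a =? b)%Z)
  | ONe, [:: VInt a; VInt b] => Some (VBool (negb (a =? b)%Z))
  | ONot, [:: VBool a] => Some (VBool (negb a))
  | OAnd, [:: VBool a; VBool b] => Some (VBool (a && b))
  | OOr, [:: VBool a; VBool b] => Some (VBool (a || b))
  | _, _ => None
  end.

Inductive eval (S : store) : expr -> val -> Prop :=
  | EvVar x v : S x = Some v -> eval S (EVar x) v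
  | EvNum n : eval S (ENum n) (VInt (Z.of_nat n))
  | EvTrue : eval S ETrue (VBool true)
  | EvFalse : eval S EFalse (VBool false)
  | EvOp o es vs v :
      List.Forall2 (eval S) es vs -> op_sem o vs = Some v -> eval S (EOp o es) v
  | EvParen e v : eval S e v -> eval S (EParen e) v.

Inductive exec : store -> stmt -> store -> Prop :=
  | ExDeclInt S t x : isInt t -> exec S (SDecl t x) (upd S x (VInt 0))
  | ExDeclBool S x : exec S (SDecl TBool x) (upd S x (VBool false))
  | ExAssign S x e v : S x <> None -> eval S e v -> exec S (SAssign x e) (upd S x v)
  | ExBlock S ss S' : exec_seq S ss S' -> exec S (SBlock ss) S'
  | ExIfT S e s1 s2 S' :
      eval S e (VBool true) -> exec S s1 S' -> exec S (SIf e s1 s2) S'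
  | ExIfF S e s1 s2 S' :
      eval S e (VBool false) -> exec S s2 S' -> exec S (SIf e s1 s2) S'
  | ExFor S x e s i S' :
      eval S (bound e) (VInt i) -> exec_loop S x s 0 i S' -> exec S (SFor x e s) S'
with exec_seq : store -> list stmt -> store -> Prop :=
  | ExNil S : exec_seq S [::] S
  | ExCons S s ss S1 S2 : exec S s S1 -> exec_seq S1 ss S2 -> exec_seq S (s :: ss) S2
with exec_loop : store -> var -> stmt -> Z -> Z -> store -> Prop :=
  | LoopDone S x s j i : (i <= j)%Z -> exec_loop S x s j i S
  | LoopStep S x s j i S1 S' :
      (j < i)%Z -> exec (upd S x (VInt j)) s S1 -> exec_loop S1 x s (j + 1) i S' ->
      exec_loop S x s j i S'.

Definition tenv := var -> option ty.

Definition op_type (o : op) (ts : list ty) : option ty :=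
  match o, ts with
  | ONeg, [:: t] => if isInt t then Some t else None
  | (OAdd | OSub | ODiv | OMod), [:: t1; t2] =>
      if isInt t1 && isInt t2 then Some (tsup t1 t2) else None
  | OSize, [:: TIint] => Some TIint
  | (OGe | OLe | OGt | OLt | OEq | ONe), [:: t1; t2] =>
      if isInt t1 && isInt t2 then Some TBool else None
  | ONot, [:: TBool] => Some TBool
  | (OAnd | OOr), [:: TBool; TBool] => Some TBool
  | _, _ => None
  end.

Inductive typ_e (G : tenv) (l : bool) : expr -> ty -> Prop :=
  | TyVar x t : G x = Some t -> typ_e G l (EVar x) t
  | TyNum n : typ_e G l (ENum n) TIint
  | TyTrue : typ_e G l ETrue TBool
  | TyFalse : typ_e G l EFalse TBool
  | TyOp o es ts t :
      List.Forall2 (typ_e G l) es ts -> op_type o ts = Some t -> typ_e G l (EOp o es) t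
  | TyParen e t : typ_e G l e t -> typ_e G l (EParen e) t.

Definition compat (t t' : ty) : Prop :=
  (isInt t /\ isInt t') \/ (t = TBool /\ t' = TBool).

Inductive typ_s : tenv -> bool -> stmt -> tenv -> Prop :=
  | TyDecl G l t x :
      G x = None -> ~ (l = true /\ t = TIint) -> typ_s G l (SDecl t x) (upd G x t)
  | TyAssign G l x e tx te :
      G x = Some tx -> ~ (l = true /\ tx = TIint) -> typ_e G l e te -> compat te tx ->
      typ_s G l (SAssign x e) G
  | TyBlock G l ss G' : typ_seq G l ss G' -> typ_s G l (SBlock ss) G
  | TyIf G l e s1 s2 G1 G2 :
      typ_e G l e TBool -> typ_s G l s1 G1 -> typ_s G l s2 G2 -> typ_s G l (SIf e s1 s2) G
  | TyFor G l x e s G' :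
      typ_e G l (bound e) TIint -> G x = None -> typ_s (upd G x TIint) true s G' ->
      typ_s G l (SFor x e s) G
with typ_seq : tenv -> bool -> list stmt -> tenv -> Prop :=
  | TyNil G l : typ_seq G l [::] G
  | TyCons G l s ss G1 G2 : typ_s G l s G1 -> typ_seq G1 l ss G2 -> typ_seq G l (s :: ss) G2.

Definition tenv0 (ps : list var) : tenv :=
  fun x => if x \in ps then Some TInt else None.

Definition well_typed (p : prog) : Prop :=
  uniq (params p) /\
  exists (G' : tenv) (t : ty),
    typ_seq (tenv0 (params p)) false (body p) G' /\
    typ_e G' false (ret p) t /\ isInt t.

Definition init_store (ps : list var) (vs : list Z) : store :=
  fun x => if x \in ps then Some (VInt (nth 0%Z vs (index x ps))) else None.

Definition prog_computes (p : prog) (m : nat) (f : m.-tuple Z -> Z) : Prop :=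
  size (params p) = m /\
  forall xs : m.-tuple Z, exists S' : store,
    exec_seq (init_store (params p) xs) (body p) S' /\ eval S' (ret p) (VInt (f xs)).

Definition FPC (m : nat) (f : m.-tuple Z -> Z) : Prop :=
  exists p : prog, well_typed p /\ prog_computes p f.

Inductive sym := S0 | S1 | SMinus | SSep.

Inductive move := MLeft | MRight | MStay.

Record TM := {
  state : finType;
  tsym : finType;
  blank : tsym;
  embed : sym -> tsym;
  embed_inj : forall a b, embed a = embed b -> a = b;
  embed_blank : forall a, embed a <> blank;
  start : state;
  halting : state -> bool;
  delta : state -> tsym -> state * tsym * move
}.

Record config (M : TM) := Config {
  cstate : state M; ctape : Z -> tsym M; chead : Z }.

Definition move_off (mv : move) : Z :=
  match mv with MLeft => (-1)%Z | MRight => 1%Z | MStay => 0%Z end.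

Definition step (M : TM) (c : config M) : config M :=
  if halting (cstate c) then c else
  let '(q', g', mv) := delta (cstate c) (ctape c (chead c)) in
  Config q' (fun i => if (i =? chead c)%Z then g' else ctape c i)
         (chead c + move_off mv)%Z.

(* binary notation, most significant bit first, no leading zeros *)
Fixpoint bits_pos (p : positive) : list sym :=
  match p with
  | xH => [:: S1]
  | xO q => rcons (bits_pos q) S0
  | xI q => rcons (bits_pos q) S1
  end.

Definition enc_Z (z : Z) : list sym :=
  match z with
  | Z0 => [:: S0]
  | Zpos p => bits_pos p
  | Zneg p => SMinus :: bits_pos p
  end.

Fixpoint enc_input (xs : list Z) : list sym :=
  match xs with
  | [::] => [::]
  | [:: z] => enc_Z z
  | z :: zs => enc_Z z ++ SSep :: enc_input zs
  end.

Definition init_config (M : TM) (w : list sym) : config M :=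
  Config (start M)
    (fun i => if ((0 <=? i) && (i <? Z.of_nat (size w)))%Z
              then embed M (nth S0 w (Z.to_nat i)) else blank M)
    0%Z.

Definition tape_holds (M : TM) (c : config M) (w : list sym) : Prop :=
  (forall i, i < size w -> ctape c (chead c + Z.of_nat i)%Z = embed M (nth S0 w i)) /\
  ctape c (chead c + Z.of_nat (size w))%Z = blank M.

Definition runs_within (M : TM) (xs : list Z) (t : nat) (y : Z) : Prop :=
  let c := ssrnat.iter t (@step M) (init_config M (enc_input xs)) in
  halting (cstate c) /\ tape_holds c (enc_Z y).

Definition FP (m : nat) (f : m.-tuple Z -> Z) : Prop :=
  exists (M : TM) (c k : nat),
    forall xs : m.-tuple Z,
      exists t : nat,
        t <= c * (size (enc_input xs)).+1 ^ k /\ runs_within M xs t (f xs).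

(* Main.v *)
From Stdlib Require Import ZArith FunctionalExtensionality.
From Stdlib Require List.
From mathcomp Require Import all_boot zify.
Require Import Defs.

(* Programs to machines: a program is compiled to a register program over Z
   with addition, subtraction, halving and positivity tests.  Registers live on
   the parallel tracks of one tape as two's complement integers, least
   significant bit first, and every instruction is one sweep to the right and
   back which also adds one sign-extension column, so there is always room for
   the result.  The number of instructions is polynomial because variables of
   type iint are frozen inside loops: the iteration counts of a loop nest are
   bounded by the bit length of iint values on entry, hence the bit lengths of
   all variables grow by an amount that is polynomial in that bit length, and
   loops in sequence compose polynomials.

   Machines to programs: the two halves of the tape are the base-b digits of
   two integers with the head cell least significant, and blank is digit 0.
   One step needs only division and remainder by b and multiplication by b,
   which is repeated addition; k nested loops over size(y) iterate it
   size(y)^k times. *)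

Set Implicit Arguments.
Unset Strict Implicit.
Unset Printing Implicit Defensive.

(** * Polynomially bounded functions *)

(** Two features of the language carry the upper bound. Every operator adds at most one bit to its
    arguments, whereas multiplication would let a loop square a variable and double its length each
    time. And an [iint] cannot be assigned inside a loop: a loop over [size(v)] that doubles [v] in
    each iteration doubles the length of [v], so nesting it in another loop would give exponential
    length. Outside loops an [int] may be assigned to an [iint], and only so can a bound depend on
    the inputs. The simulating program sets [y = R + R + 2^c], where [R] codes the input tape. The
    size of [y] is at least [c] and exceeds the length n of the input word, so [k+1] nested loops
    make at least [c * (n+1)^k] steps. The width of the tape is its initial width plus the number of
    instructions executed, so a polynomial bound on that number also bounds the time of the machine.
    The first direction consumes a given big-step derivation; the second has to build one, and does
    so through a functional semantics of typed statements. *)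

Inductive poly : (nat -> nat) -> Prop :=
  | poly_const k : poly (fun=> k)
  | poly_id : poly (fun n => n)
  | poly_add f g : poly f -> poly g -> poly (fun n => f n + g n)
  | poly_mul f g : poly f -> poly g -> poly (fun n => f n * g n).

Lemma poly_comp f g : poly f -> poly g -> poly (fun n => f (g n)).
Proof.
move=> pf pg; elim: pf => [k||f1 f2 _ ? _ ?|f1 f2 _ ? _ ?].
- exact: poly_const.
- exact: pg.
- exact: poly_add.
- exact: poly_mul.
Qed.

Lemma poly_homo f m n : poly f -> m <= n -> f m <= f n.
Proof.
move=> + mn; elim=> // f1 f2 _ h1 _ h2; first exact: leq_add.
exact: leq_mul.
Qed.

(** The base [n.+1] is positive, so exponents can be raised to the common value [k1 + k2] for sums
    as well as for products. *)
Lemma poly_le_expn f : poly f -> exists c k, forall n, f n <= c * n.+1 ^ k.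
Proof.
elim=> [a||f1 f2 _ [c1 [k1 h1]] _ [c2 [k2 h2]]|f1 f2 _ [c1 [k1 h1]] _ [c2 [k2 h2]]].
- by exists a, 0 => n; rewrite expn0 muln1.
- by exists 1, 1 => n; rewrite expn1 mul1n.
- exists (c1 + c2), (k1 + k2) => n; rewrite mulnDl; apply: leq_add.
    by apply: leq_trans (h1 n) _; rewrite leq_mul2l leq_pexp2l ?leq_addr ?orbT.
  by apply: leq_trans (h2 n) _; rewrite leq_mul2l leq_pexp2l ?leq_addl ?orbT.
- exists (c1 * c2), (k1 + k2) => n; rewrite expnD mulnACA.
  exact: leq_mul.
Qed.

Ltac polyt := repeat first
  [ assumption | exact: poly_id | exact: poly_const
  | apply: poly_add | apply: poly_mul ].

(** * Tapes *)

Definition twrite (T : Type) (t : Z -> T) (h : Z) (g : T) : Z -> T :=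
  fun i => if (i =? h)%Z then g else t i.

(** A zipper at an absolute head position: [L] lists the cells before [h], nearest first, and [R]
    starts with cell [h] itself. *)
Definition ztape (T : Type) (b : T) (h : Z) (L R : seq T) : Z -> T :=
  fun z => if (z <? h)%Z then nth b L (Z.to_nat (h - 1 - z))
           else nth b R (Z.to_nat (z - h)).

Section Ztape.
Variables (T : Type) (b : T).
Implicit Types (h : Z) (L R : seq T) (g c : T).

Lemma ztape_read h L c R : ztape b h L (c :: R) h = c.
Proof. by rewrite /ztape Z.ltb_irrefl Z.sub_diag. Qed.

Lemma ztape_stay h L c R g :
  twrite (ztape b h L (c :: R)) h g = ztape b h L (g :: R).
Proof.
apply: functional_extensionality => z; rewrite /twrite /ztape.
case: Z.eqb_spec => [->|ne]; first by rewrite Z.ltb_irrefl Z.sub_diag.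
case: Z.ltb_spec => // hz.
by have -> : Z.to_nat (z - h) = (Z.to_nat (z - h)).-1.+1 by lia.
Qed.

Lemma ztape_shift h L g R : ztape b h L (g :: R) = ztape b (h + 1) (g :: L) R.
Proof.
apply: functional_extensionality => z; rewrite /ztape.
case: (Z.ltb_spec z h) => h1; case: (Z.ltb_spec z (h + 1)) => h2; try lia.
- by have -> : Z.to_nat (h + 1 - 1 - z) = (Z.to_nat (h - 1 - z)).+1 by lia.
- have -> : z = h by lia.
  by rewrite Z.sub_diag; have -> : Z.to_nat (h + 1 - 1 - h) = 0 by lia.
- by have -> : Z.to_nat (z - h) = (Z.to_nat (z - (h + 1))).+1 by lia.
Qed.

Lemma ztape_right h L c R g :
  twrite (ztape b h L (c :: R)) h g = ztape b (h + 1) (g :: L) R.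
Proof. by rewrite ztape_stay ztape_shift. Qed.

Lemma ztape_left h a L c R g :
  twrite (ztape b h (a :: L) (c :: R)) h g = ztape b (h - 1) L (a :: g :: R).
Proof. by rewrite ztape_stay [RHS]ztape_shift Z.sub_add. Qed.

Lemma nth_blank n : nth b [:: b] n = b.
Proof. by case: n => [|[]]. Qed.

(** Lists describe a tape only up to trailing blanks; this exposes the blank under the head when the
    list has run out. *)
Lemma ztape_nilr h L : ztape b h L [::] = ztape b h L [:: b].
Proof.
by apply: functional_extensionality => z; rewrite /ztape nth_nil nth_blank.
Qed.

Lemma ztape_nill h R : ztape b h [::] R = ztape b h [:: b] R.
Proof.
by apply: functional_extensionality => z; rewrite /ztape nth_nil nth_blank.
Qed.

End Ztape.

(** * Register programs *)

Definition env := nat -> Z.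

Definition eset (A : Type) (r : nat -> A) (x : nat) (v : A) : nat -> A :=
  fun y => if y == x then v else r y.

Inductive bop := BAdd | BSub | BMov | BOne.

Inductive rcmd :=
  | RBit (o : bop) (d a b : nat)
  | RHalf (d a : nat)
  | RSeq (c1 c2 : rcmd)
  | RIf (r : nat) (c1 c2 : rcmd)
  | RWhile (r : nat) (c : rcmd).

Definition bop_sem (o : bop) (x y : Z) : Z :=
  match o with BAdd => x + y | BSub => x - y | BMov => x | BOne => 1 end%Z.

(* The third argument counts executed instructions and tests; a test asks
   whether a register is positive. *)
Inductive rx : rcmd -> env -> nat -> env -> Prop :=
  | RxBit o d a b r :
      rx (RBit o d a b) r 1 (eset r d (bop_sem o (r a) (r b)))
  | RxHalf d a r : rx (RHalf d a) r 1 (eset r d (r a / 2)%Z)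
  | RxSeq c1 c2 r n1 r1 n2 r2 :
      rx c1 r n1 r1 -> rx c2 r1 n2 r2 -> rx (RSeq c1 c2) r (n1 + n2) r2
  | RxIf x c1 c2 r n r1 :
      rx (if (0 <? r x)%Z then c1 else c2) r n r1 -> rx (RIf x c1 c2) r n.+1 r1
  | RxWhileF x c r : (0 <? r x)%Z = false -> rx (RWhile x c) r 1 r
  | RxWhileT x c r n1 r1 n2 r2 :
      (0 <? r x)%Z -> rx c r n1 r1 -> rx (RWhile x c) r1 n2 r2 ->
      rx (RWhile x c) r (n1 + n2).+1 r2.

Fixpoint rbound (c : rcmd) : nat :=
  match c with
  | RBit _ d a b => maxn d (maxn a b)
  | RHalf d a => maxn d a
  | RSeq c1 c2 => maxn (rbound c1) (rbound c2)
  | RIf r c1 c2 => maxn r (maxn (rbound c1) (rbound c2))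
  | RWhile r c => maxn r (rbound c)
  end.

(** Total correctness with a time bound. The postcondition of a first command may itself be a [runs]
    statement, which is how sequences are handled. *)
Definition runs (c : rcmd) (r : env) (T : nat) (Q : env -> Prop) : Prop :=
  exists n r', [/\ rx c r n r', n <= T & Q r'].

Lemma runs_weaken c r T T' (Q Q' : env -> Prop) :
  runs c r T Q -> T <= T' -> (forall r', Q r' -> Q' r') -> runs c r T' Q'.
Proof.
move=> [n [r' [h1 h2 h3]]] hT hQ; exists n, r'; split=> //; last exact: hQ.
exact: leq_trans hT.
Qed.

Lemma runs_bit o d a b r (Q : env -> Prop) :
  Q (eset r d (bop_sem o (r a) (r b))) -> runs (RBit o d a b) r 1 Q.
Proof. by move=> h; do 2 eexists; split; [exact: RxBit | |]. Qed.

Lemma runs_half d a r (Q : env -> Prop) :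
  Q (eset r d (r a / 2)%Z) -> runs (RHalf d a) r 1 Q.
Proof. by move=> h; do 2 eexists; split; [exact: RxHalf | |]. Qed.

Lemma runs_seq c1 c2 r T1 T2 (Q : env -> Prop) :
  runs c1 r T1 (fun r1 => runs c2 r1 T2 Q) -> runs (RSeq c1 c2) r (T1 + T2) Q.
Proof.
move=> [n1 [r1 [h1 l1 [n2 [r2 [h2 l2 hQ]]]]]].
exists (n1 + n2), r2; split=> //; first exact: RxSeq h1 h2.
exact: leq_add.
Qed.

Lemma runs_if x c1 c2 r T1 T2 (Q : env -> Prop) :
  ((0 < r x)%Z -> runs c1 r T1 Q) -> ((r x <= 0)%Z -> runs c2 r T2 Q) ->
  runs (RIf x c1 c2) r (maxn T1 T2).+1 Q.
Proof.
move=> h1 h2; case E: (0 <? r x)%Z.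
  have [|n [r1 [h l hQ]]] := h1; first lia.
  by exists n.+1, r1; split=> //; [apply: RxIf; rewrite E | lia].
have [|n [r1 [h l hQ]]] := h2; first lia.
by exists n.+1, r1; split=> //; [apply: RxIf; rewrite E | lia].
Qed.

(** The index [k] of the invariant bounds the remaining iterations. Each costs its body and one
    test; the final successor is the failing test. *)
Lemma runs_while x c T (I : nat -> env -> Prop) (Q : env -> Prop) k r :
  (forall k r, I k r -> (0 < r x)%Z ->
     exists2 k', k = k'.+1 & runs c r T (I k')) ->
  (forall k r, I k r -> (r x <= 0)%Z -> Q r) ->
  I k r -> runs (RWhile x c) r (k * T.+1).+1 Q.
Proof.
move=> hS h0; elim: k r => [|k IH] r Ir; case E: (0 <? r x)%Z.
- by have [|k' //] := hS _ _ Ir; lia.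
- by exists 1, r; split=> //; [exact: RxWhileF | apply: h0 Ir _; lia].
- have [|k' [<-]] := hS _ _ Ir; first lia.
  move=> [n1 [r1 [hx1 l1 I1]]]; have [n2 [r2 [hx2 l2 hQ]]] := IH _ I1.
  exists (n1 + n2).+1, r2; split=> //; last by rewrite mulSn; lia.
  exact: RxWhileT hx1 hx2.
- by exists 1, r; split=> //; [exact: RxWhileF | apply: h0 Ir _; lia].
Qed.

Lemma eset_eq A (r : nat -> A) x v : eset r x v x = v.
Proof. by rewrite /eset eqxx. Qed.

(** * Composing machines *)

(** A machine leaves through one of two exits [inr b], so that tests and commands have the same
    type. The leaving transition still writes and moves. *)
Record mach (G : finType) := Mach {
  mstate : finType;
  ment : mstate;
  mdelta : mstate -> G -> (mstate + bool) * G * move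
}.

Definition tconf (G : Type) := ((Z -> G) * Z)%type.

Definition tact (G : Type) (c : tconf G) (g : G) (mv : move) : tconf G :=
  (twrite c.1 c.2 g, c.2 + move_off mv)%Z.

Inductive reach (G : finType) (S : Type) (d : S -> G -> (S + bool) * G * move) :
    S -> tconf G -> nat -> bool -> tconf G -> Prop :=
  | ReachExit s c b g mv :
      d s (c.1 c.2) = (inr b, g, mv) -> reach d s c 1 b (tact c g mv)
  | ReachStep s c s' g mv n b c' :
      d s (c.1 c.2) = (inl s', g, mv) -> reach d s' (tact c g mv) n b c' ->
      reach d s c n.+1 b c'.

Section Compose.
Variable G : finType.
Implicit Types m a : mach G.

Definition mif_delta m a (b : mach G) (s : mstate m + (mstate a + mstate b)) (g : G) :
    (mstate m + (mstate a + mstate b) + bool) * G * move :=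
  match s with
  | inl s => let: (o, g', mv) := mdelta s g in
      (match o with
       | inl s' => inl (inl s')
       | inr true => inl (inr (inl (ment a)))
       | inr false => inl (inr (inr (ment b)))
       end, g', mv)
  | inr (inl s) => let: (o, g', mv) := mdelta s g in
      (match o with inl s' => inl (inr (inl s')) | inr r => inr r end, g', mv)
  | inr (inr s) => let: (o, g', mv) := mdelta s g in
      (match o with inl s' => inl (inr (inr s')) | inr r => inr r end, g', mv)
  end.

(** With equal branches the exit of [m] is ignored, and this becomes sequencing. *)
Definition mif m a (b : mach G) : mach G :=
  @Mach G (mstate m + (mstate a + mstate b))%type (inl (ment m))
    (@mif_delta m a b).

Definition mloop_delta m a (s : mstate m + mstate a) (g : G) :
    (mstate m + mstate a + bool) * G * move :=
  match s with
  | inl s => let: (o, g', mv) := mdelta s g in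
      (match o with
       | inl s' => inl (inl s')
       | inr true => inl (inr (ment a))
       | inr false => inr false
       end, g', mv)
  | inr s => let: (o, g', mv) := mdelta s g in
      (match o with inl s' => inl (inr s') | inr _ => inl (inl (ment m)) end,
       g', mv)
  end.

Definition mloop m a : mach G :=
  @Mach G (mstate m + mstate a)%type (inl (ment m)) (@mloop_delta m a).

Definition mreach m := reach (@mdelta G m) (ment m).

(** The run of a component is replayed inside the larger machine; its exit becomes an ordinary jump
    to [s2], so the times add up without an extra step. *)
Lemma reach_lift (S S' : Type) (d : S -> G -> (S + bool) * G * move)
    (d' : S' -> G -> (S' + bool) * G * move) (inj : S -> S') s c n b c' k r c'' :
  (forall s g s1 g1 mv, d s g = (inl s1, g1, mv) ->
     d' (inj s) g = (inl (inj s1), g1, mv)) ->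
  reach d s c n b c' ->
  (forall s g g1 mv, d s g = (inr b, g1, mv) ->
     exists2 s2, d' (inj s) g = (inl s2, g1, mv) & reach d' s2 c' k r c'') ->
  reach d' (inj s) c (n + k) r c''.
Proof.
move=> h1 hr; elim: hr => {s c n b c'} [s c b g mv e|s c s' g mv n b c' e _ IH] h2.
  by have [s2 e2 hr] := h2 _ _ _ _ e; rewrite add1n; apply: ReachStep e2 hr.
by rewrite addSn; apply: ReachStep (h1 _ _ _ _ _ e) (IH _).
Qed.

Lemma reach_lift_exit (S S' : Type) (d : S -> G -> (S + bool) * G * move)
    (d' : S' -> G -> (S' + bool) * G * move) (inj : S -> S') s c n b c' b' :
  (forall s g s1 g1 mv, d s g = (inl s1, g1, mv) ->
     d' (inj s) g = (inl (inj s1), g1, mv)) ->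
  (forall s g g1 mv, d s g = (inr b, g1, mv) -> d' (inj s) g = (inr b', g1, mv)) ->
  reach d s c n b c' -> reach d' (inj s) c n b' c'.
Proof.
move=> h1 h2 hr; elim: hr h2 => {s c n b c'} [s c b g mv e|s c s' g mv n b c' e _ IH] h2.
  exact: ReachExit (h2 _ _ _ _ e).
exact: ReachStep (h1 _ _ _ _ _ e) (IH h2).
Qed.

Lemma mreach_if m a (b : mach G) c n r c' n' r' c'' :
  mreach m c n r c' -> mreach (if r then a else b) c' n' r' c'' ->
  mreach (mif m a b) c (n + n') r' c''.
Proof.
move=> h1 h2; apply: reach_lift h1 _ => /= [s g s1 g1 mv -> //|s g g1 mv -> /=].
case: r h2 => h2; eexists; try reflexivity.
  by apply: (reach_lift_exit (inj := inr \o inl)) h2 => /= >  ->.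
by apply: (reach_lift_exit (inj := inr \o inr)) h2 => /= > ->.
Qed.

Lemma mreach_loop_end m a c n c' :
  mreach m c n false c' -> mreach (mloop m a) c n false c'.
Proof. by apply: reach_lift_exit => /= > ->. Qed.

Lemma mreach_loop m a c n c1 n1 r1 c2 n2 r c3 :
  mreach m c n true c1 -> mreach a c1 n1 r1 c2 -> mreach (mloop m a) c2 n2 r c3 ->
  mreach (mloop m a) c (n + (n1 + n2)) r c3.
Proof.
move=> h1 h2 h3; apply: reach_lift h1 _ => /= [> -> //|s g g1 mv -> /=].
eexists; first reflexivity.
apply: (reach_lift (inj := inr)) h2 _ => /= [> -> //|? ? ? ? -> /=].
by eexists; first reflexivity.
Qed.

End Compose.

(** * Sweeps *)

Section Sweep.
Variables (A C : finType) (c0 : C).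
Variables (q0 : bool) (f : bool -> C -> bool * C) (h : C -> C -> C).
Variable out : bool -> C -> bool.
Implicit Types (u : seq C) (l p : C).

(** [None] is the blank, [inl] carries input and output symbols, [inr] a column of track bits. *)
Definition gam : finType := option (A + C)%type.

Definition colg (c : C) : gam := Some (inr c).

(* The rightward pass runs the Mealy machine [f] and appends one column,
   computed from a copy of the last original column: this is sign extension
   when the tracks hold two's complement integers.  The leftward pass applies
   [h] to each column and its right neighbour. *)
Definition sweep_delta (s : (bool * C) + (C * bool)) (g : gam) :
    ((bool * C) + (C * bool) + bool) * gam * move :=
  match s, g with
  | inl (q, l), Some (inr c) =>
      (inl (inl ((f q c).1, c)), colg (f q c).2, MRight)
  | inl (q, l), None =>
      let c := (f q l).2 in
      (inl (inr (c, out (f q l).1 l)), colg (h c c), MLeft)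
  | inr (p, b), Some (inr c) => (inl (inr (c, b)), colg (h p c), MLeft)
  | inr (p, b), None => (inr b, None, MRight)
  | _, _ => (inr false, g, MStay)
  end.

Definition sweep : mach gam :=
  @Mach gam ((bool * C) + (C * bool))%type (inl (q0, c0)) sweep_delta.

Fixpoint fw (q : bool) l u : seq C :=
  if u is c :: u' then (f q c).2 :: fw (f q c).1 c u' else [:: (f q l).2].

Fixpoint fwout (q : bool) l u : bool :=
  if u is c :: u' then fwout (f q c).1 c u' else out (f q l).1 l.

Fixpoint fwo (q : bool) u : seq C :=
  if u is c :: u' then (f q c).2 :: fwo (f q c).1 u' else [::].

Fixpoint fwq (q : bool) l u : bool * C :=
  if u is c :: u' then fwq (f q c).1 c u' else (q, l).

(** The right neighbour enters with its value from before the pass, since the state remembers what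
    was read. The last column is its own neighbour, as befits a sign column. *)
Fixpoint bk u : seq C :=
  if u is c :: u' then h (head c u') c :: bk u' else [::].

Lemma size_fw q l u : size (fw q l u) = (size u).+1.
Proof. by elim: u q l => //= c u IH q l; rewrite IH. Qed.

Lemma size_fwo q u : size (fwo q u) = size u.
Proof. by elim: u q => //= c u IH q; rewrite IH. Qed.

Lemma size_bk u : size (bk u) = size u.
Proof. by elim: u => //= c u ->. Qed.

Definition tcols (z : Z) (L R : seq C) : tconf gam :=
  (ztape None z (map colg L) (map colg R), z).

(** [head None] and [behead] treat the columns still to be visited and the blank in front of them
    uniformly. *)
Lemma reach_back z p L u b :
  reach sweep_delta (inr (p, b))
    (ztape None (z + Z.of_nat (size L) - 1)%Z (behead (map colg L))
       (head None (map colg L) :: map colg (bk (p :: u))),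
     (z + Z.of_nat (size L) - 1)%Z)
    (size L).+1 b (tcols z [::] (bk (catrev L (p :: u)))).
Proof.
elim: L p u => [|c L IH] p u.
  have -> : tcols z [::] (bk (catrev [::] (p :: u))) =
    tact (ztape None (z + 0 - 1)%Z [::] (None :: map colg (bk (p :: u))),
          (z + 0 - 1)%Z) None MRight.
    rewrite /tact /tcols /= ztape_right -ztape_nill.
    by have -> : (z + 0 - 1 + 1 = z)%Z by lia.
  by apply: ReachExit; rewrite /= ztape_read.
apply: (@ReachStep _ _ _ _ _ (inr (c, b)) (colg (h p c)) MLeft).
  by rewrite /= ztape_read.
have -> : tact (ztape None (z + Z.of_nat (size (c :: L)) - 1)%Z (behead (map colg (c :: L)))
       (head None (map colg (c :: L)) :: map colg (bk (p :: u))),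
     (z + Z.of_nat (size (c :: L)) - 1)%Z) (colg (h p c)) MLeft =
   (ztape None (z + Z.of_nat (size L) - 1)%Z (behead (map colg L))
       (head None (map colg L) :: map colg (bk (c :: p :: u))),
     (z + Z.of_nat (size L) - 1)%Z).
  rewrite /tact.
  have -> : (z + Z.of_nat (size (c :: L)) - 1 = z + Z.of_nat (size L))%Z by rewrite /=; lia.
  congr (_, _).
  rewrite /=.
  case: L {IH} => [|a L] /=; last by rewrite ztape_left.
  by rewrite ztape_nill ztape_left.
exact: IH.
Qed.

Lemma reach_fwd q l L u n b cf :
  reach sweep_delta (inl (fwq q l u)) (tcols (Z.of_nat (size L + size u)) (catrev (fwo q u) L) [::]) n b cf ->
  reach sweep_delta (inl (q, l)) (tcols (Z.of_nat (size L)) L u) (size u + n) b cf.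
Proof.
elim: u q l L => [|c u IH] q l L /=; first by rewrite addn0.
move=> hr; rewrite addSn; apply: (@ReachStep _ _ _ _ _ (inl ((f q c).1, c)) (colg (f q c).2) MRight).
  by rewrite /= ztape_read.
have -> : tact (tcols (Z.of_nat (size L)) L (c :: u)) (colg (f q c).2) MRight =
          tcols (Z.of_nat (size ((f q c).2 :: L))) ((f q c).2 :: L) u.
  rewrite /tact /tcols /= ztape_right.
  by have -> : (Z.of_nat (size L) + 1 = Z.of_nat (size L).+1)%Z by lia.
apply: IH; by have -> : size ((f q c).2 :: L) + size u = size L + (size u).+1 by rewrite /= ; lia.
Qed.

(** One step per column to the right, one on the blank where the new column appears, one per old
    column back, and one on the blank in front. *)
Lemma mreach_sweep u :
  mreach sweep (tcols 0 [::] u) (2 * size u).+2 (fwout q0 c0 u)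
    (tcols 0 [::] (bk (fw q0 c0 u))).
Proof.
have -> : (2 * size u).+2 = size u + (size u).+2 by lia.
apply: (@reach_fwd _ _ [::]); rewrite add0n.
set ql := fwq _ _ _; set o := fwo _ _.
have so : size o = size u by rewrite /o size_fwo.
have [eo eb] : fw q0 c0 u = rcons o (f ql.1 ql.2).2 /\ fwout q0 c0 u = out (f ql.1 ql.2).1 ql.2.
  rewrite /ql /o; elim: (u) q0 c0 => //= c u' IH q l.
  by have [-> ->] := IH (f q c).1 c.
rewrite eo eb; move: ql {eo eb} => [q l] /=; set c := (f q l).2; set b := out _ _.
apply: (@ReachStep _ _ _ _ _ (inr (c, b)) (colg (h c c)) MLeft).
  by rewrite /tcols /= ztape_nilr ztape_read.
have -> : tact (tcols (Z.of_nat (size u)) (catrev o [::]) [::]) (colg (h c c)) MLeft =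
  (ztape None (0 + Z.of_nat (size (rev o)) - 1)%Z (behead (map colg (rev o)))
       (head None (map colg (rev o)) :: map colg (bk [:: c])),
     (0 + Z.of_nat (size (rev o)) - 1)%Z).
  rewrite size_rev so /tact /tcols /=; congr (_, _).
  rewrite ztape_nilr catrevE cats0 -so -(size_rev o).
  case: (rev o) => [|a L] /=; first by rewrite ztape_nill ztape_left.
  by rewrite ztape_left.
have -> : (size u).+1 = (size (rev o)).+1 by rewrite size_rev so.
have -> : rcons o c = catrev (rev o) [:: c] by rewrite catrevE revK cats1.
exact: reach_back.
Qed.

End Sweep.

#[local] Arguments Z.mul : simpl never.
#[local] Arguments Z.add : simpl never.
#[local] Arguments Z.sub : simpl never.

(** * Executing register programs on a tape *)

Section Columns.
Variable K : nat.

Definition column := {ffun 'I_K.+1 -> bool}.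

Definition column0 : column := [ffun=> false].

Implicit Types (u : seq column) (c l : column) (i r : 'I_K.+1) (q : bool).

(* Two's complement value of track [i], least significant bit first; [l] is
   the column in front of [u], hence finally the sign column. *)
Fixpoint tval i l u : Z :=
  if u is c :: u' then (Z.b2z (c i) + 2 * tval i c u')%Z else (- Z.b2z (l i))%Z.

(** [BSub] adds the complement of [y] with initial carry 1. For [BOne] the carry is a flag marking
    the first column. *)
Definition bit_fun (o : bop) q (x y : bool) : bool * bool :=
  match o with
  | BAdd => (x && y || q && (x || y), q (+) x (+) y)
  | BSub => (x && ~~ y || q && (x || ~~ y), q (+) x (+) ~~ y)
  | BMov => (q, x)
  | BOne => (false, q)
  end.

Definition bit_init (o : bop) : bool :=
  match o with BSub | BOne => true | _ => false end.

Definition cset (c : column) r (x : bool) : column :=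
  [ffun j => if j == r then x else c j].

Definition bit_step (o : bop) (d a b : 'I_K.+1) q (c : column) : bool * column :=
  ((bit_fun o q (c a) (c b)).1, cset c d (bit_fun o q (c a) (c b)).2).

Definition half_step (d a : 'I_K.+1) (p c : column) : column := cset c d (p a).

Notation csweep := (@sweep (bool * bool)%type column column0).

Definition mbit o d a b :=
  csweep (bit_init o) (bit_step o d a b) (fun _ c => c) (fun _ _ => false).

Definition mhalf d a :=
  csweep false pair (half_step d a) (fun _ _ => false).

(** An integer is positive when some bit is set and the sign bit is not; the Mealy state collects
    the first condition. *)
Definition mtest r :=
  csweep false (fun q c => (q || c r, c)) (fun _ c => c) (fun q c => q && ~~ c r).

Lemma bk_id u : bk (fun _ c => c) u = u.
Proof. by elim: u => //= c u ->. Qed.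

Lemma tval_fw_id i (f : bool -> column -> bool * column) q l u :
  (forall q c, (f q c).2 i = c i) -> tval i l (fw f q l u) = tval i l u.
Proof.
move=> hf; elim: u q l => [|c u IH] q l /=; first by rewrite hf; case: (l i).
by rewrite hf; congr (_ + 2 * _)%Z; rewrite -(IH (f q c).1 c); case: u {IH}.
Qed.

(** Value produced by the rest of a sweep entered with carry [q]; the complement of [y] contributes
    [- y - 1]. *)
Definition carry_sem (o : bop) (x y : Z) (q : bool) : Z :=
  (match o with
  | BAdd => x + y + Z.b2z q
  | BSub => x - y - 1 + Z.b2z q
  | BMov => x
  | BOne => Z.b2z q
  end)%Z.

(** The carry has to come out of column [l]. When [u] is empty, [l] is the sign column, and if the
    two bits added there agree, the carry is forced to be that bit. Hence one extra column is enough
    to avoid overflow. *)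
Lemma tval_bit_step o d a b q1 l0 l u :
  tval d l0 (fw (bit_step o d a b) (bit_step o d a b q1 l).1 l u) =
  carry_sem o (tval a l u) (tval b l u) (bit_step o d a b q1 l).1.
Proof.
elim: u q1 l l0 => [|c u IH] q1 l l0; last first.
  rewrite [fw _ _ _ _]/= [tval d _ _]/= IH /= ffunE eqxx.
  set q := (bit_fun o q1 _ _).1; clearbody q.
  by case: o {IH} => /=; case: q; case: (c a); case: (c b) => /=; lia.
by rewrite /= ffunE eqxx; case: o => /=; case: q1; case: (l a); case: (l b).
Qed.

Lemma tval_bit o d a b l u : 0 < size u ->
  tval d l (fw (bit_step o d a b) (bit_init o) column0 u) =
  bop_sem o (tval a column0 u) (tval b column0 u).
Proof.
case: u => // c u _; rewrite [fw _ _ _ _]/= [tval d _ _]/= tval_bit_step /= ffunE eqxx.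
by case: o => /=; case: (c a); case: (c b) => /=; lia.
Qed.

Lemma tval_half_other i d a l u : i != d -> tval i l (bk (half_step d a) u) = tval i l u.
Proof.
move=> ne; elim: u l => //= c u IH l; rewrite ffunE (negPf ne).
by congr (_ + 2 * _)%Z; rewrite -IH; case: u {IH} => //=; rewrite ffunE (negPf ne).
Qed.

(** Shifting a track by one column drops its lowest bit, which is floor division by 2 for negative
    numbers as well. *)
Lemma tval_half d a l c u :
  tval d l (bk (half_step d a) (c :: u)) = tval a c u.
Proof.
elim: u c l => [|c' u IH] c l; first by rewrite /= ffunE eqxx; case: (c a).
by rewrite [bk _ _]/= [LHS]/= ffunE eqxx [in RHS]/= -(IH c' c').
Qed.

(** [q || l r] tells whether a set bit has been met so far, [l] included; [mreach_test] takes
    [q = false] and the zero column. *)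
Lemma tval_test r q l u :
  fwout (fun q c => (q || c r, c)) (fun q c => q && ~~ c r) (q || l r) l u =
  ((q || l r) || (0 <? tval r l u)%Z) && (0 <=? tval r l u)%Z.
Proof.
elim: u q l => [|c u IH] q l /=; first by case: q; case: (l r).
rewrite IH; case: q; case: (l r); case: (c r) => //=; set v := tval _ _ _.
all: case: (Z.leb_spec 0 v); case: (Z.ltb_spec 0 v) => /= *; lia.
Qed.

Fixpoint compile (c : rcmd) : mach (gam (bool * bool)%type column) :=
  match c with
  | RBit o d a b => mbit o (inord d) (inord a) (inord b)
  | RHalf d a => mhalf (inord d) (inord a)
  | RSeq c1 c2 => mif (compile c1) (compile c2) (compile c2)
  | RIf r c1 c2 => mif (mtest (inord r)) (compile c1) (compile c2)
  | RWhile r c => mloop (mtest (inord r)) (compile c)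
  end.

(** With no column at all, the single column written by [BOne] would represent -1. *)
Definition rep u (rho : env) : Prop :=
  0 < size u /\ forall i, tval i column0 u = rho i.

Notation tcols0 := (@tcols (bool * bool)%type column 0 [::]).

Lemma mreach_bit o d a b u rho :
  maxn d (maxn a b) <= K -> rep u rho ->
  exists u', [/\ rep u' (eset rho d (bop_sem o (rho a) (rho b))),
    size u' = (size u).+1 &
    mreach (mbit o (inord d) (inord a) (inord b)) (tcols0 u) (2 * size u).+2
      false (tcols0 u')].
Proof.
move=> hK [u0 hu]; set D : 'I_K.+1 := inord d; set A : 'I_K.+1 := inord a.
set B : 'I_K.+1 := inord b.
exists (fw (bit_step o D A B) (bit_init o) column0 u).
split; rewrite ?size_fw //; last first.
  have := mreach_sweep (bool * bool)%type column0 (bit_init o) (bit_step o D A B)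
    (fun _ c => c) (fun _ _ => false) u.
  rewrite bk_id; suff -> : fwout (bit_step o D A B) (fun _ _ => false)
    (bit_init o) column0 u = false by [].
  by elim: (u) (bit_init o) column0 => //=.
split=> [|i]; first by rewrite size_fw.
rewrite /eset; case: eqP => [e|ne].
  have -> : i = D by apply: val_inj; rewrite /= e inordK //; lia.
  by rewrite tval_bit // !hu !inordK //; lia.
rewrite tval_fw_id ?hu // => q c; rewrite ffunE; case: eqP => // e.
by case: ne; rewrite e inordK //; lia.
Qed.

Lemma mreach_half d a u rho :
  maxn d a <= K -> rep u rho ->
  exists u', [/\ rep u' (eset rho d (rho a / 2)%Z), size u' = (size u).+1 &
    mreach (mhalf (inord d) (inord a)) (tcols0 u) (2 * size u).+2
      false (tcols0 u')].
Proof.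
move=> hK [u0 hu]; set D : 'I_K.+1 := inord d; set A : 'I_K.+1 := inord a.
have eid i : tval i column0 (fw pair false column0 u) = rho i.
  by rewrite tval_fw_id.
exists (bk (half_step D A) (fw pair false column0 u)).
split; rewrite ?size_bk ?size_fw //; last first.
  have := mreach_sweep (bool * bool)%type column0 false pair
    (half_step D A) (fun _ _ => false) u.
  suff -> : fwout pair (fun _ _ => false) false column0 u = false by [].
  by elim: (u) false column0 => //=.
split=> [|i]; first by rewrite size_bk size_fw.
rewrite /eset; case: eqP => [e|ne].
  have -> : i = D by apply: val_inj; rewrite /= e inordK //; lia.
  have := eid A; rewrite [X in (rho X / 2)%Z](_ : a = A); last by rewrite inordK //; lia.
  case: (fw _ _ _ _) (size_fw pair false column0 u) => // c v _ <-.
  rewrite tval_half [tval A _ _]/=.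
  by apply: (Z.div_unique _ _ _ (Z.b2z (c A))) => /=; case: (c A) => /=; lia.
rewrite tval_half_other ?eid //; apply/eqP => e.
by case: ne; rewrite e inordK //; lia.
Qed.

Lemma mreach_test (r : nat) u rho :
  r <= K -> rep u rho ->
  exists u', [/\ rep u' rho, size u' = (size u).+1 &
    mreach (mtest (inord r)) (tcols0 u) (2 * size u).+2
      (0 <? rho r)%Z (tcols0 u')].
Proof.
move=> hK [u0 hu]; set R : 'I_K.+1 := inord r.
exists (fw (fun q c => (q || c R, c)) false column0 u).
split; rewrite ?size_fw //; last first.
  have := mreach_sweep (bool * bool)%type column0 false (fun q c => (q || c R, c))
    (fun _ c => c) (fun q c => q && ~~ c R) u.
  rewrite bk_id; have := tval_test R false column0 u.
  rewrite ffunE /= => ->; rewrite hu inordK //.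
  by congr mreach; case: Z.ltb_spec => // *; case: Z.leb_spec => //; lia.
split=> [|i]; first by rewrite size_fw.
by rewrite tval_fw_id.
Qed.

(** Every sweep widens the tape by one column, so each of the [n] sweeps works on at most
    [size u + n] columns. *)
Lemma mreach_compile (c : rcmd) rho n rho' u :
  rx c rho n rho' -> rbound c <= K -> rep u rho ->
  exists u' t b, [/\ mreach (compile c) (tcols0 u) t b (tcols0 u'),
    rep u' rho', size u' = size u + n & t <= n * (2 * (size u + n)).+2].
Proof.
move=> h; elim: h u => {c rho n rho'}.
- move=> o d a b r u hK hu; have [u' [h1 h2 h3]] := mreach_bit o hK hu.
  by exists u', (2 * size u).+2, false; split=> //; lia.
- move=> d a r u hK hu; have [u' [h1 h2 h3]] := mreach_half hK hu.
  by exists u', (2 * size u).+2, false; split=> //; lia.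
- move=> c1 c2 r n1 r1 n2 r2 _ IH1 _ IH2 u /= hK hu.
  have [|u1 [t1 [b1 [m1 e1 s1 l1]]]] := IH1 _ _ hu; first lia.
  have [|u2 [t2 [b2 [m2 e2 s2 l2]]]] := IH2 _ _ e1; first lia.
  exists u2, (t1 + t2), b2; split=> //; last by nia.
    by apply: mreach_if m1 _; case: b1.
  by rewrite s2 s1 addnA.
- move=> x c1 c2 r n r1 _ IH u /= hK hu.
  have [|u1 [e1 s1 m1]] := @mreach_test x _ _ _ hu; first lia.
  have [|u2 [t2 [b2 [m2 e2 s2 l2]]]] := IH _ _ e1; first by case: ifP; lia.
  exists u2, ((2 * size u).+2 + t2), b2; split=> //; last by nia.
    by rewrite (fun_if compile) in m2; exact: mreach_if m1 m2.
  by rewrite s2 s1; lia.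
- move=> x c r hx u /= hK hu.
  have [|u1 [e1 s1 m1]] := @mreach_test x _ _ _ hu; first lia.
  exists u1, (2 * size u).+2, false; split=> //; try lia.
  by apply: mreach_loop_end; rewrite hx in m1.
- move=> x c r n1 r1 n2 r2 hx _ IH1 _ IH2 u /= hK hu.
  have [|u0 [e0 s0 m0]] := @mreach_test x _ _ _ hu; first lia.
  have [|u1 [t1 [b1 [m1 e1 s1 l1]]]] := IH1 _ _ e0; first lia.
  have [|u2 [t2 [b2 [m2 e2 s2 l2]]]] := IH2 _ _ e1; first by rewrite /=; lia.
  exists u2, ((2 * size u).+2 + (t1 + t2)), b2; split=> //; try lia; first by rewrite hx in m0; apply: mreach_loop m0 m1 m2.
Qed.

End Columns.

(** * Re-encoding a word in one pass to the right and one back *)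

Section TwoPass.
Variables (G : finType) (b : G) (f h : G -> G) (e : G).
Implicit Types (L w : seq G).

Definition twopass_delta (s : bool) (g : G) : (bool + bool) * G * move :=
  match s, g == b with
  | true, false => (inl true, f g, MRight)
  | true, true => (inl false, e, MLeft)
  | false, false => (inl false, h g, MLeft)
  | false, true => (inr false, b, MRight)
  end.

(** Serves both conversions: on input [f] turns symbols into columns and [e] adds a zero sign
    column, on output [h] turns columns into symbols. *)
Definition twopass : mach G := @Mach G bool true twopass_delta.

Lemma twopass_back z L R :
  all (predC1 b) L ->
  reach twopass_delta false
    (ztape b (z + Z.of_nat (size L) - 1)%Z (behead L) (head b L :: R),
     (z + Z.of_nat (size L) - 1)%Z)
    (size L).+1 false (ztape b z [::] (catrev (map h L) R), z).
Proof.
elim: L R => [|c L IH] R /=.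
  have -> : (ztape b z [::] R, z) =
     tact (ztape b (z + 0 - 1)%Z [::] (b :: R), (z + 0 - 1)%Z) b MRight.
    by rewrite /tact /= ztape_right -ztape_nill Z.add_0_r Z.sub_add.
  by move=> _; apply: ReachExit; rewrite /= ztape_read /twopass_delta eqxx.
case/andP=> cb allL; apply: (@ReachStep _ _ _ _ _ false (h c) MLeft).
  by rewrite /= ztape_read /twopass_delta (negPf cb).
have -> : (z + Z.of_nat (size L).+1 - 1 = z + Z.of_nat (size L))%Z by lia.
have -> : tact (ztape b (z + Z.of_nat (size L))%Z L (c :: R), (z + Z.of_nat (size L))%Z)
     (h c) MLeft = (ztape b (z + Z.of_nat (size L) - 1)%Z (behead L) (head b L :: h c :: R),
      (z + Z.of_nat (size L) - 1)%Z).
  rewrite /tact /=; congr (_, _); case: (L) => [|a L'].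
    by rewrite ztape_nill ztape_left.
  by rewrite ztape_left.
exact: IH.
Qed.

Lemma twopass_fwd L w n cf :
  all (predC1 b) w ->
  reach twopass_delta true
    (ztape b (Z.of_nat (size L + size w)) (catrev (map f w) L) [::],
     Z.of_nat (size L + size w)) n false cf ->
  reach twopass_delta true
    (ztape b (Z.of_nat (size L)) L w, Z.of_nat (size L)) (size w + n) false cf.
Proof.
elim: w L => [|c w IH] L /=; first by rewrite addn0.
case/andP=> cb allw hr; rewrite addSn.
apply: (@ReachStep _ _ _ _ _ true (f c) MRight).
  by rewrite /= ztape_read /twopass_delta (negPf cb).
have -> : tact (ztape b (Z.of_nat (size L)) L (c :: w), Z.of_nat (size L)) (f c) MRight =
   (ztape b (Z.of_nat (size (f c :: L))) (f c :: L) w, Z.of_nat (size (f c :: L))).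
  rewrite /tact /= ztape_right.
  by have -> : (Z.of_nat (size L) + 1 = Z.of_nat (size L).+1)%Z by lia.
apply: IH => //.
by have -> : size (f c :: L) + size w = size L + (size w).+1 by rewrite /=; lia.
Qed.

Lemma mreach_twopass w :
  all (predC1 b) w -> all (predC1 b) (map f w) ->
  mreach twopass (ztape b 0 [::] w, 0%Z) (2 * size w).+2 false
    (ztape b 0 [::] (map h (map f w) ++ [:: e]), 0%Z).
Proof.
move=> hw hfw; have -> : (2 * size w).+2 = size w + (size w).+2 by lia.
apply: (@twopass_fwd [::]) => //; rewrite add0n catrevE cats0.
apply: (@ReachStep _ _ _ _ _ false e MLeft).
  by rewrite /= ztape_nilr ztape_read /twopass_delta eqxx.
set o := rev (map f w).
have so : size o = size w by rewrite size_rev size_map.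
have -> : tact (ztape b (Z.of_nat (size w)) o [::], Z.of_nat (size w)) e MLeft =
  (ztape b (0 + Z.of_nat (size o) - 1)%Z (behead o) (head b o :: [:: e]),
     (0 + Z.of_nat (size o) - 1)%Z).
  rewrite so /tact /= ztape_nilr Z.add_0_l; congr (_, _).
  rewrite -so; case: (o) => [|a L] /=; first by rewrite ztape_nill ztape_left.
  by rewrite ztape_left.
have -> : map h (map f w) ++ [:: e] = catrev (map h o) [:: e].
  by rewrite catrevE map_rev revK.
by rewrite -so; apply: twopass_back; rewrite all_rev.
Qed.

End TwoPass.

Lemma mreach_seq (G : finType) (m a : mach G) c n r c' n' r' c'' :
  mreach m c n r c' -> mreach a c' n' r' c'' ->
  mreach (mif m a a) c (n + n') r' c''.
Proof. by move=> h1 h2; apply: mreach_if h1 _; case: r. Qed.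

(** * Words as register contents, and the complete Turing machine *)

Definition sym_bits (s : sym) : bool * bool :=
  match s with
  | S0 => (false, false) | S1 => (true, false)
  | SMinus => (false, true) | SSep => (true, true)
  end.

(* A word of symbols is read as binary numbers, one per code bit [g], first
   symbol least significant. *)
Fixpoint wval (g : sym -> bool) (w : seq sym) : Z :=
  if w is s :: w' then (Z.b2z (g s) + 2 * wval g w')%Z else 0%Z.

Lemma wval_ge0 g w : (0 <= wval g w)%Z.
Proof. by elim: w => //= s w IH; case: (g s) => /=; lia. Qed.

(** This is [2 ^ size w - 1]. As [S0] is coded by two zero bits, the other two numbers do not
    determine the length of the word. *)
Definition wlen : seq sym -> Z := wval (fun=> true).
Definition wlow : seq sym -> Z := wval (fun s => (sym_bits s).1).
Definition whigh : seq sym -> Z := wval (fun s => (sym_bits s).2).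

Definition env_of_word (V : nat) (w : seq sym) : env := fun r =>
  if r == V then wlow w else if r == V.+1 then whigh w
  else if r == V.+2 then wlen w else 0%Z.

Definition env_holds (V : nat) (w : seq sym) (rho : env) : Prop :=
  [/\ rho V = wlow w, rho V.+1 = whigh w & rho V.+2 = wlen w].

Section ToTM.
Variables (V : nat) (c : rcmd).

Let K := maxn (rbound c) V.+2.
Let G := gam (bool * bool)%type (column K).
Let R0 : 'I_K.+1 := inord V.
Let R1 : 'I_K.+1 := inord V.+1.
Let R2 : 'I_K.+1 := inord V.+2.

Definition col_of_bits (s : bool * bool) : column K :=
  [ffun i => if i == R0 then s.1 else if i == R1 then s.2 else i == R2].

Definition read_in (g : G) : G :=
  if g is Some (inl s) then Some (inr (col_of_bits s)) else g.

(** Columns beyond the length mark become blank, which gives the terminating blank demanded by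
    [tape_holds]. *)
Definition write_out (g : G) : G :=
  if g is Some (inr x) then if x R2 then Some (inl (x R0, x R1)) else None else g.

Definition full_mach : mach G :=
  let fin := twopass (None : G) id write_out None in
  let run := mif (compile K c) fin fin in
  mif (twopass None read_in id (Some (inr (column0 K)))) run run.

Definition tm_embed (s : sym) : G := Some (inl (sym_bits s)).

Lemma tm_embed_inj s s' : tm_embed s = tm_embed s' -> s = s'.
Proof. by case: s; case: s'. Qed.

Lemma tm_embed_blank s : tm_embed s <> None.
Proof. by []. Qed.

Definition tm_delta (s : mstate full_mach + bool) (g : G) :
    (mstate full_mach + bool) * G * move :=
  if s is inl s then mdelta s g else (s, g, MStay).

Definition tm : TM :=
  @Build_TM (mstate full_mach + bool)%type G None tm_embed tm_embed_inj
    tm_embed_blank (inl (ment full_mach)) (fun s => if s is inr _ then true else false)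
    tm_delta.

Lemma tm_reach s cf n b cf' :
  reach (@mdelta _ full_mach) s cf n b cf' ->
  ssrnat.iter n (@step tm) (@Config tm (inl s) cf.1 cf.2) =
  @Config tm (inr b) cf'.1 cf'.2.
Proof.
elim=> {s cf n b cf'} [s [t z] b g mv /= e|s [t z] s' g mv n b cf' /= e _ IH].
  by rewrite /step /= e.
by rewrite -iterS iterSr {2}/step /= e.
Qed.

Lemma init_config_ztape w :
  init_config tm w =
  @Config tm (inl (ment full_mach)) (ztape (None : G) 0 [::] (map tm_embed w)) 0.
Proof.
rewrite /init_config; congr (@Config tm _ _ _); apply: functional_extensionality => z.
rewrite /ztape; case: (Z.ltb_spec z 0) => hz.
  by rewrite nth_nil; case: Z.leb_spec => // ?; lia.
case: Z.leb_spec => /= h0; last lia; rewrite Z.sub_0_r.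
case: Z.ltb_spec => h; last by rewrite nth_default // size_map; lia.
by rewrite (nth_map S0) //; lia.
Qed.

(** The appended zero column is the sign, so the tracks hold nonnegative numbers. *)
Lemma tval_wval i g l w :
  (forall s, col_of_bits (sym_bits s) i = g s) ->
  tval i l (rcons (map (col_of_bits \o sym_bits) w) (column0 K)) = wval g w.
Proof.
move=> hg; elim: w l => [|s w IH] l /=; first by rewrite ffunE.
by rewrite IH hg.
Qed.

(** Binary digits are unique: the parities agree and the halves are compared in turn. Beyond [w] all
    digits are 0. *)
Lemma tval_eq_wval i g (l : column K) u w :
  tval i l u = wval g w ->
  forall k, k < size u -> nth (column0 K) u k i = (k < size w) && g (nth S0 w k).
Proof.
elim: u l w => [|x u IH] l w // e [|k] hk.
  case: w e => [|s w] /=; case: (x i) => //=; try lia; case: (g s) => //=; lia.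
case: w e => [|s w] /= e; first by rewrite (IH x [::]) //=; case: (x i) e => /=; lia.
by rewrite (IH x w) //; case: (x i) e; case: (g s) => /=; lia.
Qed.

(** [2 ^ size w - 1] does not fit in fewer than [size w] columns. *)
Lemma tval_wlen i (l : column K) u w : tval i l u = wlen w -> size w <= size u.
Proof.
elim: u l w => [|x u IH] l [|s w] //=.
  by have := @wval_ge0 (fun=> true) w; rewrite /wlen /=; case: (l i) => /=; lia.
by rewrite /wlen /= => e; apply: (IH x); move: e; rewrite /wlen; case: (x i) => /=; lia.
Qed.

Lemma tm_runs w n rho' w' :
  rx c (env_of_word V w) n rho' -> env_holds V w' rho' ->
  exists2 t, t <= 2 * size w + 2 + (n * (2 * (size w + 1 + n)).+2 + (2 * (size w + 1 + n)).+2) &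
    let cf := ssrnat.iter t (@step tm) (init_config tm w) in
    halting (cstate cf) /\ tape_holds cf w'.
Proof.
move=> hx [e0 e1 e2]; set u := rcons (map (col_of_bits \o sym_bits) w) (column0 K).
have szu : size u = size w + 1 by rewrite size_rcons size_map addn1.
have h1 : mreach (twopass None read_in id (Some (inr (column0 K))))
  (ztape (None : G) 0 [::] (map tm_embed w), 0%Z) (2 * size w + 2) false
  (tcols (bool * bool)%type 0 [::] u).
  have -> : tcols (bool * bool)%type 0 [::] u = (ztape (None : G) 0 [::]
      (map id (map read_in (map tm_embed w)) ++ [:: Some (inr (column0 K))]), 0%Z).
    by rewrite /tcols /u map_rcons -cats1 map_id -!map_comp.
  have -> : 2 * size w + 2 = (2 * size (map tm_embed w)).+2 by rewrite size_map addn2.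
  by apply: mreach_twopass; elim: (w).
have hK : V.+2 <= K by rewrite leq_maxr.
have hu : rep u (env_of_word V w).
  split=> [|i]; first by rewrite szu addn1.
  have hR (r : nat) : r <= V.+2 -> (i == inord r) = (i == r :> nat).
    move=> hr; apply/eqP/eqP => [->|<-]; first by rewrite /= inordK //; lia.
    by rewrite inord_val.
  rewrite /env_of_word -(hR V); last lia.
  rewrite -(hR V.+1); last lia.
  rewrite -(hR V.+2); last lia.
  case: ifP => h0; first by apply: tval_wval => s; rewrite ffunE h0.
  case: ifP => h1'; first by apply: tval_wval => s; rewrite ffunE h0 h1'.
  case: ifP => h2; first by apply: tval_wval => s; rewrite ffunE h0 h1' h2.
  rewrite (@tval_wval _ (fun=> false)); last by move=> s; rewrite ffunE h0 h1' h2.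
  by elim: (w) => //= _ w0 ->.
have [u' [t [b [m1 [u0 r1] s1 l1]]]] := mreach_compile hx (leq_maxl _ _) hu.
have h3 : mreach (twopass (None : G) id write_out None) (tcols (bool * bool)%type 0 [::] u')
   (2 * size u').+2 false
   (ztape (None : G) 0 [::] (map write_out (map (@colg _ _) u') ++ [:: None]), 0%Z).
  have := @mreach_twopass G None id write_out None (map (@colg _ _) u').
  by rewrite size_map map_id; apply; elim: (u').
have := tm_reach (mreach_seq h1 (mreach_seq m1 h3)).
rewrite -init_config_ztape => hit.
exists (2 * size w + 2 + (t + (2 * size u').+2)); first by rewrite s1 szu in l1 *; lia.
rewrite /= hit; split=> //.
have eR r : r <= V.+2 -> tval (inord r) (column0 K) u' = rho' r.
  by move=> hr; rewrite r1 inordK //; lia.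
have [l0 l1' l2] : [/\ V <= V.+2, V.+1 <= V.+2 & V.+2 <= V.+2] by split; lia.
have {}e0 := tval_eq_wval (etrans (eR V l0) e0).
have {}e1 := tval_eq_wval (etrans (eR V.+1 l1') e1).
have sw := tval_wlen (etrans (eR V.+2 l2) e2).
have {}e2 := tval_eq_wval (etrans (eR V.+2 l2) e2).
have hn k : nth None (map write_out (map (@colg _ _) u') ++ [:: None]) k =
    if k < size w' then tm_embed (nth S0 w' k) else None :> G.
  have hs : size (map write_out (map (@colg (bool * bool)%type _) u')) = size u'.
    by rewrite !size_map.
  rewrite nth_cat hs; case: ltnP => hk; last first.
    rewrite nth_blank; case: ltnP => // hk'.
    by have := leq_trans hk' sw; rewrite ltnNge hk.
  rewrite -map_comp (nth_map (column0 K)) //= /write_out e0 // e1 // e2 //.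
  by case: ltnP => //= _; case: (nth S0 w' k).
split=> [k hk|] /=; rewrite /ztape.
  by case: Z.ltb_spec => [|_]; [lia|rewrite Z.sub_0_r Z.add_0_l Nat2Z.id hn hk].
by case: Z.ltb_spec => [|_]; [lia|rewrite Z.sub_0_r Z.add_0_l Nat2Z.id hn ltnn].
Qed.

End ToTM.

#[local] Arguments Z.pow : simpl never.
#[local] Arguments Z.of_nat : simpl never.

(** * Arithmetic by register programs *)

Ltac ered := rewrite /eset; repeat match goal with
  | |- context [@eq_op _ ?a ?b] =>
      first [ rewrite (_ : (a == b) = true); [|lia]
            | rewrite (_ : (a == b) = false); [|lia] ]
  end.

Definition rzero d := RBit BSub d d d.
Definition rone d := RBit BOne d d d.
Definition rskip := RBit BMov 0 0 0.
Definition rneg d := RSeq (rzero d.+1) (RBit BSub d d.+1 d).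

Lemma eset_id A (r : nat -> A) x : eset r x (r x) = r.
Proof. by apply: functional_extensionality => y; rewrite /eset; case: eqP => // ->. Qed.

Lemma runs_skip r (Q : env -> Prop) : Q r -> runs rskip r 1 Q.
Proof. by move=> h; apply: runs_bit; rewrite /= eset_id. Qed.

(** Stack discipline of expression code: the result goes to register [d], everything below survives,
    everything above is scratch. *)
Definition post d (v : Z) (r r' : env) : Prop :=
  r' d = v /\ forall x, x < d -> r' x = r x.

Fixpoint radds d n := if n is n'.+1 then RSeq (RBit BAdd d d d.+1) (radds d n') else rskip.

(** Time linear in the value of a literal is harmless, as literals are fixed with the program. *)
Definition rconst d n := RSeq (rzero d) (RSeq (rone d.+1) (radds d n)).

Lemma runs_const d n r : runs (rconst d n) r (n + 3) (post d (Z.of_nat n) r).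
Proof.
rewrite (_ : n + 3 = 1 + (1 + n.+1)); last lia.
do 2 (apply: runs_seq; apply: runs_bit).
rewrite /= Z.sub_diag; set r0 := eset _ d.+1 _.
have : [/\ r0 d = 0%Z, r0 d.+1 = 1%Z & forall x, x < d -> r0 x = r x].
  by rewrite /r0; split=> [||x hx]; ered.
rewrite -[Z.of_nat n]Z.add_0_l; elim: n 0%Z (r0) => [|n IH] z r1 [h1 h2 h3] /=.
  by apply: runs_skip; split=> //; lia.
rewrite -[n.+2]add1n; apply: runs_seq; apply: runs_bit.
have := IH (z + 1)%Z (eset r1 d (r1 d + r1 d.+1)%Z).
have -> : (z + 1 + Z.of_nat n = z + Z.of_nat n.+1)%Z by lia.
apply; split=> [||x hx]; ered; try lia; exact: h3.
Qed.

Definition rabs d := RIf d rskip (rneg d).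

Definition rsize d :=
  RSeq (rabs d) (RSeq (RBit BMov d.+1 d d) (RSeq (rzero d) (RSeq (rone d.+2)
    (RWhile d.+1 (RSeq (RHalf d.+1 d.+1) (RBit BAdd d d d.+2)))))).

Lemma runs_abs d r :
  runs (rabs d) r 3 (post d (Z.abs (r d)) r).
Proof.
rewrite (_ : 3 = (maxn 1 (1 + 1)).+1) //; apply: runs_if => h.
  by apply: runs_skip; split=> //; lia.
apply: runs_seq; do 2 apply: runs_bit.
split=> [|x hx]; ered => /=; last by [].
lia.
Qed.

(** [zsize] is the length in binary, so [rsize] can compute it by counting halvings. *)
Lemma zsize_half v : (0 < v)%Z -> zsize v = (1 + zsize (v / 2))%Z.
Proof.
move=> v0; rewrite /zsize.
have h2 : (0 <= v / 2)%Z by apply: Z.div_pos; lia.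
rewrite !Z.abs_eq; try lia.
case: (Z.eq_dec v 1) => [->//|v1].
have h3 : (1 <= v / 2)%Z by apply: Z.div_le_lower_bound; lia.
rewrite !Z.log2_up_eqn; try lia; rewrite !Z.add_1_r !Z.pred_succ.
rewrite -[(v / 2)%Z]/(v / 2 ^ 1)%Z -Z.shiftr_div_pow2 // Z.log2_shiftr //.
have := Z.log2_pos v; lia.
Qed.

Lemma zsize_ge0 v : (0 <= zsize v)%Z.
Proof. exact: Z.log2_up_nonneg. Qed.

Lemma runs_size d r k : (Z.abs (r d) < 2 ^ Z.of_nat k)%Z ->
  runs (rsize d) r (3 * k + 10) (post d (zsize (r d)) r).
Proof.
move=> hk.
apply: (@runs_weaken _ _ (3 + (1 + (1 + (1 + (k * 3).+1)))) _ (post d (zsize (r d)) r)) => //; last lia.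
apply: runs_seq; apply: (runs_weaken (runs_abs d r)) => // r1 [e1 f1].
do 3 (apply: runs_seq; apply: runs_bit); set r2 := eset _ d.+2 _.
pose I k (r' : env) := [/\ (0 <= r' d.+1 < 2 ^ Z.of_nat k)%Z,
  (r' d + zsize (r' d.+1) = zsize (r d))%Z, r' d.+2 = 1%Z & forall x, x < d -> r' x = r x].
have I2 : I k r2.
  rewrite /I /r2; split=> [|||x hx]; ered => /=; rewrite ?e1; try lia; last exact: f1.
  by rewrite Z.sub_diag /zsize Z.abs_idemp.
apply: (@runs_while _ _ 2 I) I2 => {hk} [{}k r' [h1 h2 h3 h4] hp|{}k r' [h1 h2 h3 h4] hp].
  case: k h1 => [|k] h1; first by rewrite Z.pow_0_r in h1; lia.
  exists k => //; rewrite -[2]/(1 + 1); apply: runs_seq; apply: runs_half; apply: runs_bit.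
  rewrite /I /=; split=> [|||x hx]; ered => //; last exact: h4.
    rewrite Nat2Z.inj_succ Z.pow_succ_r in h1; try lia.
    by split; [apply: Z.div_pos | apply: Z.div_lt_upper_bound]; lia.
  by rewrite h3 -h2 (@zsize_half (r' d.+1)) //; lia.
split=> //; rewrite -h2 (_ : r' d.+1 = 0%Z); last lia.
by rewrite (_ : zsize 0 = 0%Z) // Z.add_0_r.
Qed.

(** Tests ask for positivity; adding the 1 kept in [d+7] makes the test mean that the remainder is
    at least the scaled divisor. *)
Definition rdm_test d := RSeq (RBit BSub (d + 8) (d + 3) (d + 4))
  (RBit BAdd (d + 8) (d + 8) (d + 7)).

(* Binary long division of |r d| by |r (d+1)|: register [d+4] holds the divisor
   scaled by a power of 2 whose exponent is in [d+6]; the quotient is built in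
   [d+5] and the remainder in [d+3]. *)
Definition rdm d :=
  RSeq (rzero (d + 2))
  (RSeq (RIf d (RBit BMov (d + 3) d d) (RBit BSub (d + 3) (d + 2) d))
  (RSeq (RIf (d + 1) (RBit BMov (d + 4) (d + 1) d) (RBit BSub (d + 4) (d + 2) (d + 1)))
  (RSeq (rzero (d + 5)) (RSeq (rzero (d + 6)) (RSeq (rone (d + 7))
  (RIf (d + 4)
    (RSeq (rdm_test d)
    (RSeq (RWhile (d + 8) (RSeq (RBit BAdd (d + 4) (d + 4) (d + 4))
             (RSeq (RBit BAdd (d + 6) (d + 6) (d + 7)) (rdm_test d))))
          (RWhile (d + 6) (RSeq (RHalf (d + 4) (d + 4))
             (RSeq (RBit BAdd (d + 5) (d + 5) (d + 5))
             (RSeq (RBit BSub (d + 6) (d + 6) (d + 7))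
             (RSeq (rdm_test d)
               (RIf (d + 8) (RSeq (RBit BSub (d + 3) (d + 3) (d + 4))
                                  (RBit BAdd (d + 5) (d + 5) (d + 7)))
                            rskip))))))))
    (rzero (d + 3)))))))).

Lemma runs_dm d r k : (Z.abs (r d) < 2 ^ Z.of_nat k)%Z ->
  let A := Z.abs (r d) in let B := Z.abs (r d.+1) in
  runs (rdm d) r (16 * k + 30) (fun r' =>
    [/\ forall x, x < d + 2 -> r' x = r x, r' (d + 2) = 0%Z,
        r' (d + 5) = (if (B =? 0)%Z then 0 else A / B)%Z &
        r' (d + 3) = (if (B =? 0)%Z then 0 else A mod B)%Z]).
Proof.
move=> hk A B.
pose F (r' : env) := (forall x, x < d + 2 -> r' x = r x) /\ r' (d + 2) = 0%Z.
pose I0 (r' : env) := [/\ F r', r' (d + 3) = A, r' (d + 4) = B, r' (d + 5) = 0%Z &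
  r' (d + 6) = 0%Z /\ r' (d + 7) = 1%Z].
apply: (@runs_weaken _ _ (1 + (2 + (2 + (1 + (1 + (1 + (maxn (2 + ((k * 5).+1 + (k * 9).+1)) 1).+1)))))) _ (fun r' => [/\ F r',
        r' (d + 5) = (if (B =? 0)%Z then 0 else A / B)%Z &
        r' (d + 3) = (if (B =? 0)%Z then 0 else A mod B)%Z])); [|lia|by move=> r' [[]]].
apply: runs_seq; apply: runs_bit; set r1 := eset _ _ _.
have F1 : F r1 by rewrite /F /r1; split=> [x hx|]; ered => //=; lia.
have e1 : r1 d = r d by apply: F1.1; lia.
have e1' : r1 (d + 1) = r d.+1 by rewrite -(addn1 d); apply: F1.1; lia.
clearbody r1.
apply: runs_seq; apply: (@runs_weaken _ _ (maxn 1 1).+1 _ (fun r' => F r' /\ r' (d + 3) = A)) => //.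
  case: F1 => F1 F2; apply: runs_if => h; apply: runs_bit; repeat split; try (move=> x hx);
    ered => //=; try (by apply: F1); try (by rewrite /A; lia).
move=> r2 [F2 eA]; have e2' : r2 (d + 1) = r d.+1 by rewrite -(addn1 d); apply: F2.1; lia.
apply: runs_seq; apply: (@runs_weaken _ _ (maxn 1 1).+1 _ (fun r' => [/\ F r', r' (d + 3) = A & r' (d + 4) = B])) => //.
  by case: F2 => F21 F22; apply: runs_if => h; apply: runs_bit; repeat split; try (move=> x hx);
    ered => //=; try (by apply: F21); try (by rewrite /B; lia).
move=> r3 [F3 eA3 eB3].
do 3 (apply: runs_seq; apply: runs_bit); set r4 := eset _ (d + 7) _.
have : I0 r4.
  by case: F3 => F31 F32; rewrite /r4; repeat split; try (move=> x hx); ered => //=; try (by apply: F31); try lia.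
move: r4 => {r1 r2 r3 F1 e1 e1' F2 eA e2' F3 eA3 eB3} r4 [F4 eA eB eq [ec eo]].
have A0 : (0 <= A)%Z by rewrite /A; lia.
have hB0 : (0 <= B)%Z by rewrite /B; lia.
apply: runs_if => hB; last first.
  apply: runs_bit; have -> : (B =? 0)%Z by lia.
  by case: F4 => F41 F42; repeat split; try (move=> x hx); ered => //=; try (by apply: F41); try lia.
have -> : (B =? 0)%Z = false by lia.
rewrite eB in hB.
(* [j] counts the doublings done and [k'] those still possible: the last inequality makes the test
   fail once [k' = 0]. *)
pose I1 k' (r' : env) := [/\ F r', r' (d + 3)%N = A, r' (d + 5)%N = 0%Z, r' (d + 7)%N = 1%Z &
  exists j, [/\ j + k' = k, r' (d + 6)%N = Z.of_nat j, (r' (d + 4)%N = B * 2 ^ Z.of_nat j)%Z,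
    (r' (d + 8)%N = A - r' (d + 4)%N + 1)%Z & (A < r' (d + 4)%N * 2 ^ Z.of_nat k')%Z]].
apply: runs_seq; apply: (@runs_weaken _ _ (1 + 1) _ (I1 k)) => //.
  apply: runs_seq; do 2 apply: runs_bit.
  case: F4 => F41 F42; repeat split; try (move=> x hx); ered => //=; try (by apply: F41); try lia.
  exists 0; split; ered => /=; rewrite ?add0n ?eB ?eA ?eo //; try lia.
  by move: hk; rewrite -/A; nia.
move=> r5 H5; apply: runs_seq.
(* Division with remainder by the divisor scaled by [2 ^ j]; at [j = 0] the equation and the range
   determine quotient and remainder. *)
pose I2 j (r' : env) := [/\ F r', r' (d + 7)%N = 1%Z, r' (d + 6)%N = Z.of_nat j,
  (r' (d + 4)%N = B * 2 ^ Z.of_nat j)%Z & (A = r' (d + 5)%N * r' (d + 4)%N + r' (d + 3)%N)%Z /\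
  (0 <= r' (d + 3)%N < r' (d + 4)%N)%Z].
apply: (@runs_weaken _ _ (k * 5).+1 _ (fun r' => exists2 j, j <= k & I2 j r')) => //.
  apply: (@runs_while _ _ 4 I1) H5.
- move=> k' r' [[f1 f2] a1 a2 a3 [j [b1 b2 b3 b4 b5]]] hp.
  case: k' b1 b5 => [|k'] b1 b5; first by rewrite Z.pow_0_r in b5; lia.
  exists k' => //; apply: (@runs_weaken _ _ (1 + (1 + (1 + 1))) _ (I1 k')) => //.
  do 3 (apply: runs_seq; apply: runs_bit).
  apply: runs_bit; repeat split; try (move=> x hx); ered => //=; rewrite ?a2; try (by apply: f1); try lia.
  rewrite Nat2Z.inj_succ Z.pow_succ_r in b5; last lia.
  have hpj : (2 ^ Z.of_nat j.+1 = 2 * 2 ^ Z.of_nat j)%Z.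
    by rewrite Nat2Z.inj_succ Z.pow_succ_r; lia.
  by exists j.+1; split; ered => /=; rewrite ?hpj; lia.
- move=> k' r' [f a1 a2 a3 [j [b1 b2 b3 b4 b5]]] hp.
  exists j; first lia.
  by split=> //; rewrite a2 a1; lia.
move=> r6 [j hj H6].
apply: (@runs_weaken _ _ (j * 9).+1 _ (fun r' => I2 0 r')); last first.
- move=> r' [f a1 a2 a3 [a4 a5]]; rewrite Z.pow_0_r Z.mul_1_r in a3.
  rewrite a3 in a4 a5; split=> //.
    by apply: (Z.div_unique_pos _ _ _ (r' (d + 3)%N)); lia.
  by apply: (Z.mod_unique_pos _ _ (r' (d + 5)%N)); lia.
- lia.
apply: (@runs_while _ _ 8 I2) H6.
  move=> m r' [[f1 f2] a1 a2 a3 [a4 a5]] hp.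
  case: m a2 a3 => [|m] a2 a3; first lia.
  exists m => //.
  rewrite Nat2Z.inj_succ Z.pow_succ_r in a3; last lia.
  have e4 : (r' (d + 4)%N / 2 = B * 2 ^ Z.of_nat m)%Z.
    by symmetry; apply: (Z.div_unique_pos _ _ _ 0); lia.
  apply: (@runs_weaken _ _ (1 + (1 + (1 + ((1 + 1) + (maxn (1 + 1) 1).+1)))) _ (I2 m)) => //.
  apply: runs_seq; apply: runs_half; do 2 (apply: runs_seq; apply: runs_bit).
  apply: runs_seq; apply: runs_seq; do 2 apply: runs_bit.
  set t := (B * 2 ^ Z.of_nat m)%Z in e4 *.
  have ht : r' (d + 4)%N = (2 * t)%Z by rewrite a3 /t; lia.
  apply: runs_if; ered => /=; rewrite e4 a1 => h.
    apply: runs_seq; do 2 apply: runs_bit.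
    repeat split; try (move=> x hx); ered => //=; rewrite ?a2 ?e4; try (by apply: f1); try lia.

  apply: runs_skip.
  repeat split; try (move=> x hx); ered => //=; rewrite ?a2 ?e4; try (by apply: f1); try lia.

move=> m r' [f a1 a2 a3 a4] hp; have e0 : m = 0 by lia.
by rewrite e0 in a2 a3.
Qed.

(** * Compiling expressions *)

Definition enc (v : val) : Z := match v with VInt z => z | VBool b => Z.b2z b end.

Definition rop (o : op) (d : nat) : rcmd :=
  let sub := RBit BSub d d d.+1 in
  let bus := RBit BSub d d.+1 d in
  match o with
  | ONeg => rneg d
  | OAdd => RBit BAdd d d d.+1
  | OSub => sub
  | ODiv => RSeq (rdm d)
      (RIf d (RIf d.+1 (RBit BMov d (d + 5) d) (RBit BSub d (d + 2) (d + 5)))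
             (RIf d.+1 (RBit BSub d (d + 2) (d + 5)) (RBit BMov d (d + 5) d)))
  | OMod => RSeq (rdm d)
      (RIf d (RBit BMov d (d + 3) d) (RBit BSub d (d + 2) (d + 3)))
  | OSize => rsize d
  | OGe => RSeq bus (RIf d (rzero d) (rone d))
  | OLe => RSeq sub (RIf d (rzero d) (rone d))
  | OGt => RSeq sub (RIf d (rone d) (rzero d))
  | OLt => RSeq bus (RIf d (rone d) (rzero d))
  | OEq => RSeq sub (RIf d (rzero d)
      (RSeq (rneg d) (RIf d (rzero d) (rone d))))
  | ONe => RSeq sub (RIf d (rone d)
      (RSeq (rneg d) (RIf d (rone d) (rzero d))))
  | ONot => RIf d (rzero d) (rone d)
  | OAnd => RIf d (RBit BMov d d.+1 d) rskip
  | OOr => RIf d rskip (RBit BMov d d.+1 d)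
  end.

Definition args_at d (vs : seq val) (r : env) : Prop :=
  match vs with
  | [:: a] => r d = enc a
  | [:: a; b] => r d = enc a /\ r d.+1 = enc b
  | _ => True
  end.

(** [Z.quot] truncates toward zero, so the signs can be restored after dividing absolute values. *)
Lemma zdiv_abs a b :
  zdiv a b = (if (b =? 0)%Z then 0 else Z.sgn a * Z.sgn b * (Z.abs a / Z.abs b))%Z.
Proof.
rewrite /zdiv; case: Z.eqb_spec => // b0; exact: Z.quot_div.
Qed.

Lemma zmod_abs a b :
  zmod a b = (if (b =? 0)%Z then 0 else Z.sgn a * (Z.abs a mod Z.abs b))%Z.
Proof. by rewrite /zmod; case: Z.eqb_spec => // b0; rewrite Z.rem_mod //; lia. Qed.

Ltac rgo := repeat first
  [ apply: runs_skip | apply: runs_bit | apply: runs_half | apply: runs_seq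
  | apply: runs_if => ? ].

Lemma runs_op o vs v d r k :
  op_sem o vs = Some v -> args_at d vs r -> (Z.abs (r d) < 2 ^ Z.of_nat k)%Z ->
  runs (rop o d) r (16 * k + 40) (post d (enc v) r).
Proof.
have fin c T w : T <= 40 -> runs c r T (post d w r) ->
    runs c r (16 * k + 40) (post d w r).
  by move=> hT h; apply: runs_weaken h _ _ => //; lia.
case: o; case: vs => [|[a|a] [|[b|b] [|? ?]]] //= [<-] /= h hk.
- apply: (@fin _ (1 + 1) _) => //; rgo; split=> [|x hx]; ered => //=; lia.
- case: h => ha hb; apply: (@fin _ 1 _) => //; rgo; split=> [|x hx]; ered => //=; lia.
- case: h => ha hb; apply: (@fin _ 1 _) => //; rgo; split=> [|x hx]; ered => //=; lia.
- case: h => ha hb.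
  apply: (@runs_weaken _ _ (16 * k + 30 + (maxn (maxn 1 1).+1 (maxn 1 1).+1).+1) _ (post d (zdiv a b) r)) => //; last lia.
  apply: runs_seq; apply: (runs_weaken (runs_dm hk)) => // r1 [f1 e2 e5 e3].
  have e0 : r1 d = a by rewrite -ha f1 //; lia.
  have e1 : r1 d.+1 = b by rewrite -hb f1 //; lia.
  have e5' : (zdiv a b = Z.sgn a * Z.sgn b * r1 (d + 5)%N)%Z.
    rewrite zdiv_abs e5 ha hb; case: Z.eqb_spec => [->|b0]; first by rewrite Z.mul_0_r.
    by case: Z.eqb_spec => //; lia.
  (* Zero operands fall into the branches for negative ones; the result is still right because the
     quotient register is 0 then. *)
  have a0 : (a = 0 \/ b = 0 -> r1 (d + 5)%N = 0)%Z.
    by rewrite e5 ha hb; case: Z.eqb_spec => // ? [->|?]; [rewrite Z.div_0_l|lia].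
  do 2 (apply: runs_if => ?); apply: runs_bit; split=> [|x hx]; ered => /=;
    rewrite ?e5' ?e0 ?e1 ?e2; try (by apply: f1; lia); nia.
- case: h => ha hb.
  apply: (@runs_weaken _ _ (16 * k + 30 + (maxn 1 1).+1) _ (post d (zmod a b) r)) => //; last lia.
  apply: runs_seq; apply: (runs_weaken (runs_dm hk)) => // r1 [f1 e2 e5 e3].
  have e0 : r1 d = a by rewrite -ha f1 //; lia.
  have e3' : (zmod a b = Z.sgn a * r1 (d + 3)%N)%Z.
    rewrite zmod_abs e3 ha hb; case: Z.eqb_spec => [->|b0]; first by rewrite Z.mul_0_r.
    by case: Z.eqb_spec => //; lia.
  have a0 : (a = 0 -> r1 (d + 3)%N = 0)%Z.
    by move=> az; rewrite e3 ha hb az; case: Z.eqb_spec => // bz; rewrite Z.mod_0_l.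
  apply: runs_if => ?; apply: runs_bit; split=> [|x hx]; ered => /=;
    rewrite ?e3' ?e0 ?e2; try (by apply: f1; lia); nia.
- rewrite -h; apply: (runs_weaken (runs_size hk)) => //; lia.
all: try (lazymatch type of h with _ /\ _ => case: h => ha hb end).
all: match goal with
  | |- runs (RSeq _ (RIf _ _ (RSeq _ _))) _ _ _ =>
     apply: (@fin _ (1 + (maxn 1 (1 + 1 + (maxn 1 1).+1)).+1) _) => //
  | |- runs (RSeq _ _) _ _ _ => apply: (@fin _ (1 + (maxn 1 1).+1) _) => //
  | _ => apply: (@fin _ (maxn 1 1).+1) => //
  end.
all: repeat first [ apply: runs_skip | apply: runs_bit | apply: runs_seq
  | apply: runs_if; ered => /= ? ].
all: split=> [|x hx]; ered => //=; try lia.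
Qed.

(** A literal counts with its value because of the cost of [rconst]. The same measure bounds the
    bits gained by evaluation. *)
Fixpoint esize (e : expr) : nat :=
  match e with
  | ENum n => n.+1
  | EOp _ es => (sumn (map esize es)).+1
  | EParen e => (esize e).+1
  | _ => 1
  end.

Fixpoint cexp (e : expr) (d : nat) : rcmd :=
  match e with
  | EVar x => RBit BMov d x d
  | ENum n => rconst d n
  | ETrue => rone d
  | EFalse => rzero d
  | EOp o [:: a] => RSeq (cexp a d) (rop o d)
  | EOp o [:: a; b] => RSeq (cexp a d) (RSeq (cexp b d.+1) (rop o d))
  | EOp _ _ => rskip
  | EParen e => cexp e d
  end.

Definition vty (v : val) (t : ty) : bool :=
  match v with VInt _ => isInt t | VBool _ => ~~ isInt t end.

Notation fits z k := (Z.abs z < 2 ^ Z.of_nat k)%Z.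

Lemma fits_le z k k' : fits z k -> k <= k' -> fits z k'.
Proof.
move=> h1 h2; apply: Z.lt_le_trans h1 _; apply: Z.pow_le_mono_r; lia.
Qed.

Lemma fits_succ k : (2 ^ Z.of_nat k.+1 = 2 * 2 ^ Z.of_nat k)%Z.
Proof. by rewrite Nat2Z.inj_succ Z.pow_succ_r; lia. Qed.

Lemma pow2_gt0 k : (0 < 2 ^ Z.of_nat k)%Z.
Proof. by apply: Z.pow_pos_nonneg; lia. Qed.

Lemma pow2_gt k : (Z.of_nat k < 2 ^ Z.of_nat k)%Z.
Proof. by apply: Z.pow_gt_lin_r; lia. Qed.

Lemma fits_nat n k : n <= k -> fits (Z.of_nat n) k.
Proof. by move=> h; have := @pow2_gt k; lia. Qed.

Lemma zsize_le z k : fits z k -> (0 <= zsize z <= Z.of_nat k)%Z.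
Proof.
move=> h; split; first exact: zsize_ge0.
by apply/Z.log2_up_le_pow2; lia.
Qed.

Lemma zdiv_le a b : (Z.abs (zdiv a b) <= Z.abs a)%Z.
Proof.
rewrite zdiv_abs; case: Z.eqb_spec => b0; first by rewrite /=; lia.
have h1 : (0 <= Z.abs a / Z.abs b)%Z by apply: Z.div_pos; lia.
have h2 : (Z.abs a / Z.abs b <= Z.abs a)%Z by apply: Z.div_le_upper_bound; nia.
by nia.
Qed.

Lemma zmod_le a b : (Z.abs (zmod a b) <= Z.abs a)%Z.
Proof.
rewrite zmod_abs; case: Z.eqb_spec => b0; first by rewrite /=; lia.
have h1 : (0 <= Z.abs a mod Z.abs b < Z.abs b)%Z by apply: Z.mod_pos_bound; lia.
have h2 : (Z.abs a mod Z.abs b <= Z.abs a)%Z by apply: Z.mod_le; lia.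
by nia.
Qed.

(** Sums and differences at most double, quotients and remainders do not exceed the dividend, and
    [size] gives at most [k < 2 ^ k]. *)
Lemma op_sem_fits o vs ts v t k :
  op_sem o vs = Some v -> op_type o ts = Some t ->
  List.Forall2 vty vs ts -> List.Forall (fun v => fits (enc v) k) vs ->
  vty v t /\ fits (enc v) k.+1.
Proof.
move=> hv ht hvt hk; have pk := @pow2_gt0 k; have ps := fits_succ k.
have fz z : fits z k -> fits z k.+1 by rewrite ps; lia.
have fb b : fits (enc (VBool b)) k.+1 by rewrite ps /=; case: b => /=; lia.
case: hvt hk hv ht => [|a ta vs1 ts1 ha]; first by case: o.
case=> [|b tb vs2 ts2 hb].
  case/List.Forall_cons_iff=> ka _.
  case: o; case: a ha ka => a //= ta1 ka [<-]; case: ta ta1 => //= _ [<-] //=; split=> //;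
    try exact: fb; rewrite ?ps; try lia.
  by have := zsize_le ka; have := @pow2_gt k; lia.
case=> [|? ? ? ? ? ?]; last by case: o; case: a {ha}; case: b {hb}.
case/List.Forall_cons_iff=> ka /List.Forall_cons_iff [kb _].
case: o; case: a ha ka => a //= ta1 ka; case: b hb kb => b //= tb1 kb [<-];
  case: ta ta1 => //= _; case: tb tb1 => //= _ [<-] //=; split=> //; try exact: fb;
  rewrite ?ps; try lia.
all: apply: (Z.le_lt_trans _ (Z.abs a)); last lia.
all: by [exact: zdiv_le | exact: zmod_le].
Qed.

(** Consequently the length of an [iint] value is governed by the lengths of [iint] variables
    alone. *)
Lemma op_type_iint o ts : op_type o ts = Some TIint -> List.Forall (eq TIint) ts.
Proof.
case: o; case: ts => [|[] [|[] [|? ?]]] //= _; repeat constructor.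
Qed.

Section ExprInd.
Variable P : expr -> Prop.
Hypothesis HVar : forall x, P (EVar x).
Hypothesis HNum : forall n, P (ENum n).
Hypothesis HTrue : P ETrue.
Hypothesis HFalse : P EFalse.
Hypothesis HOp : forall o es, List.Forall P es -> P (EOp o es).
Hypothesis HParen : forall e, P e -> P (EParen e).

(** The generated principle has no induction hypothesis for the arguments in the list. *)
Fixpoint expr_ind_nested (e : expr) : P e :=
  match e with
  | EVar x => HVar x
  | ENum n => HNum n
  | ETrue => HTrue
  | EFalse => HFalse
  | EOp o es => HOp o
      ((fix go es : List.Forall P es :=
          match es with
          | [::] => List.Forall_nil P
          | e :: es => List.Forall_cons e (expr_ind_nested e) (go es)
          end) es)
  | EParen e => HParen (expr_ind_nested e)
  end.
End ExprInd.

(* [b] bounds the bit length of the variables of type iint, [B] that of all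
   variables. *)
Definition srel (G : tenv) (b B : nat) (S : store) (r : env) : Prop :=
  forall x t, G x = Some t -> exists v,
    [/\ S x = Some v, vty v t, r x = enc v, fits (enc v) B &
        t = TIint -> fits (enc v) b].

Definition ecost (e : expr) (B : nat) : nat := esize e * (16 * (B + esize e) + 60).

(** [V <= d] keeps temporaries apart from the registers of variables, so [srel] survives the
    evaluation of the first argument. *)
Lemma cexp_ok G b B S r l V d e t v :
  b <= B -> srel G b B S r -> (forall x t, G x = Some t -> x < V) -> V <= d ->
  typ_e G l e t -> eval S e v ->
  [/\ vty v t, fits (enc v) (B + esize e), t = TIint -> fits (enc v) (b + esize e) &
      runs (cexp e d) r (ecost e B) (post d (enc v) r)].
Proof.
move=> bB + hV.
elim/expr_ind_nested: e r d t v => [x|n|||o es IH|e IH] r d t v hr hd ht hv.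
- inversion ht; inversion hv; subst; have [w [e1 e2 e3 e4 e5]] := hr _ _ H0.
  move: H3; rewrite e1 => -[?]; subst w; split=> //.
  + by apply: fits_le e4 _; lia.
  + by move=> /e5 h; apply: fits_le h _; lia.
  + apply: runs_weaken (runs_bit (Q := post d (enc v) r) _) _ _ => //.
      by split=> [|y hy]; ered.
    by rewrite /ecost /=; lia.
- inversion ht; inversion hv; subst; split=> //=; try (by move=> *; apply: fits_nat; lia).
  by apply: runs_weaken (runs_const d n r) _ _ => //; rewrite /ecost /=; nia.
- inversion ht; inversion hv; subst; split=> //=.
    by rewrite addn1 fits_succ; have := @pow2_gt0 B; lia.
  apply: runs_weaken (runs_bit (Q := post d 1 r) _) _ _ => //.
    by split=> [|y hy]; ered.
  by rewrite /ecost /=; lia.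
- inversion ht; inversion hv; subst; split=> //=.
    by rewrite addn1 fits_succ; have := @pow2_gt0 B; lia.
  apply: runs_weaken (runs_bit (Q := post d 0 r) _) _ _ => //.
    by split=> [|y hy]; ered => //=; lia.
  by rewrite /ecost /=; lia.
- inversion ht as [| | | |o' es' ts t' h1 h2|]; subst.
  inversion hv as [| | | |o' es' vs v' h3 h4|]; subst.
  have hr' r' d' w : V <= d' -> post d' w r r' -> srel G b B S r'.
    move=> hd' [_ hp] x tx hx; have [u [e1 e2 e3 e4 e5]] := hr _ _ hx.
    by exists u; split=> //; rewrite hp // ; have := hV _ _ hx; lia.
  case: h1 h2 h3 IH ht hv => [|e1 t1 es1 ts1 he1]; first by case: o {h4}.
  case=> [|e2 t2 es2 ts2 he2]; last first.
    case=> [|? ? ? ? ? ?]; last by case: (o) => //; case: (t1) => //; case: (t2).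
    move=> h2 h3 /List.Forall_cons_iff [IH1 /List.Forall_cons_iff [IH2 _]] ht hv.
    inversion h3 as [|e1' v1 es1' vs1 hv1 h3']; subst.
    inversion h3' as [|e2' v2 es2' vs2 hv2 h3'']; subst.
    inversion h3''; subst; rewrite [esize _]/= addn0.
    have [a1 a2 a3 a4] := IH1 _ _ _ _ hr hd he1 hv1.
    have [b1 b2 b3 _] := IH2 _ _ _ _ hr hd he2 hv2.
    have hsem k k' : fits (enc v1) k -> fits (enc v2) k -> k.+1 <= k' ->
        vty v t /\ fits (enc v) k'.
      move=> k1 k2 kk; have [] := @op_sem_fits _ _ _ _ _ k h4 h2.
      - by repeat constructor.
      - by repeat constructor.
      - by move=> ? h; split=> //; apply: fits_le h _.
    have le1 : B + esize e1 <= B + (esize e1 + esize e2) by lia.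
    have le2 : B + esize e2 <= B + (esize e1 + esize e2) by lia.
    have [hvt hvB] := hsem _ (B + (esize e1 + esize e2).+1) (fits_le a2 le1) (fits_le b2 le2) ltac:(lia).
    split=> //.
      move=> et; rewrite et in h2; have := op_type_iint h2.
      case/List.Forall_cons_iff=> /esym /a3 k1 /List.Forall_cons_iff [/esym /b3 k2 _].
      by apply: (proj2 (hsem (b + (esize e1 + esize e2)) _ _ _ _));
        [apply: fits_le k1 _; lia | apply: fits_le k2 _; lia | lia].
    apply: (@runs_weaken _ _ (ecost e1 B + (ecost e2 B + (16 * (B + esize e1) + 40))) _
       (post d (enc v) r)) => //; last by rewrite /ecost /= addn0; nia.
    rewrite /=; apply: runs_seq; apply: runs_weaken a4 _ _ => // r1 p1.
    have hr1 := hr' _ _ _ hd p1.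
    have [|_ _ _ b4] := IH2 r1 d.+1 _ _ hr1 _ he2 hv2; first lia.
    apply: runs_seq; apply: runs_weaken b4 _ _ => // r2 [p2 q2].
    have e3 : r2 d = enc v1 by rewrite q2 // p1.1.
    apply: runs_weaken (runs_op (d := d) (r := r2) (k := B + esize e1) h4 _ _) _ _ => //.
      by rewrite e3.
    move=> r3 [p3 q3]; split=> // x hx; rewrite q3 // q2 ?p1.2 //; lia.
  move=> h2 h3 /List.Forall_cons_iff [IH1 _] ht hv.
  inversion h3 as [|e1' v1 es1' vs1 hv1 h3']; subst.
  inversion h3'; subst; rewrite [esize _]/= addn0.
  have [a1 a2 a3 a4] := IH1 _ _ _ _ hr hd he1 hv1.
  have hsem k k' : fits (enc v1) k -> k.+1 <= k' -> vty v t /\ fits (enc v) k'.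
    move=> k1 kk; have [] := @op_sem_fits _ _ _ _ _ k h4 h2.
    - by repeat constructor.
    - by repeat constructor.
    - by move=> ? h; split=> //; apply: fits_le h _.
  have [hvt hvB] := hsem _ (B + (esize e1).+1) a2 ltac:(lia).
  split=> //.
    move=> et; rewrite et in h2; have := op_type_iint h2.
    case/List.Forall_cons_iff=> /esym /a3 k1 _.
    by apply: (proj2 (hsem _ _ k1 _)); lia.
  apply: (@runs_weaken _ _ (ecost e1 B + (16 * (B + esize e1) + 40)) _
     (post d (enc v) r)) => //; last by rewrite /ecost /= addn0; nia.
  rewrite /=; apply: runs_seq; apply: runs_weaken a4 _ _ => // r1 [p1 q1].
  apply: runs_weaken (runs_op (d := d) (r := r1) (k := B + esize e1) h4 _ _) _ _ => //.
    by rewrite p1.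
  by move=> r3 [p3 q3]; split=> // x hx; rewrite q3 // q1.
- inversion ht; inversion hv; subst.
  have [a1 a2 a3 a4] := IH _ _ _ _ hr hd H0 H3; split=> //.
  + by apply: fits_le a2 _; rewrite /=; lia.
  + by move=> /a3 h; apply: fits_le h _; rewrite /=; lia.
  + by apply: runs_weaken a4 _ _ => //; rewrite /ecost /=; nia.
Qed.

(** * Compiling statements *)

Scheme typ_s_mut := Minimality for typ_s Sort Prop
  with typ_seq_mut := Minimality for typ_seq Sort Prop.
Combined Scheme typ_s_seq_ind from typ_s_mut, typ_seq_mut.

(** In a loop, [d] counts the remaining iterations down and [d+1] holds the next index; the body
    works from [d+2] on. *)
Fixpoint cstmt (s : stmt) (d : nat) : rcmd :=
  match s with
  | SDecl _ x => rzero x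
  | SAssign x e => RSeq (cexp e d) (RBit BMov x d d)
  | SBlock ss => foldr (fun s c => RSeq (cstmt s d) c) rskip ss
  | SIf e s1 s2 => RSeq (cexp e d) (RIf d (cstmt s1 d) (cstmt s2 d))
  | SFor x e s =>
      RSeq (cexp (bound e) d) (RSeq (rzero d.+1)
        (RWhile d (RSeq (RBit BMov x d.+1 d) (RSeq (cstmt s d.+2)
           (RSeq (rone d.+2) (RSeq (RBit BAdd d.+1 d.+1 d.+2)
              (RBit BSub d d d.+2)))))))
  end.

Definition cseq (ss : seq stmt) (d : nat) : rcmd := cstmt (SBlock ss) d.

(** Assigned variables are not counted: typing puts them in the environment already, whose variables
    are below [V] by hypothesis. *)
Fixpoint dmax (s : stmt) : nat :=
  match s with
  | SDecl _ x => x.+1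
  | SAssign _ _ => 0
  | SBlock ss => foldr (fun s n => maxn (dmax s) n) 0 ss
  | SIf _ s1 s2 => maxn (dmax s1) (dmax s2)
  | SFor x _ s => maxn x.+1 (dmax s)
  end.

Lemma typ_mono :
  (forall G l s G', typ_s G l s G' -> forall x t, G x = Some t -> G' x = Some t) /\
  (forall G l ss G', typ_seq G l ss G' -> forall x t, G x = Some t -> G' x = Some t).
Proof.
apply: typ_s_seq_ind => //.
  by move=> G l t x hx _ y ty hy; rewrite /upd; case: eqP => // e; rewrite -e hy in hx.
by move=> G l s ss G1 G2 _ h1 _ h2 x t /h1 /h2.
Qed.

Lemma typ_dom V :
  (forall G l s G', typ_s G l s G' -> dmax s <= V ->
     (forall x t, G x = Some t -> x < V) -> forall x t, G' x = Some t -> x < V) /\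
  (forall G l ss G', typ_seq G l ss G' -> dmax (SBlock ss) <= V ->
     (forall x t, G x = Some t -> x < V) -> forall x t, G' x = Some t -> x < V).
Proof.
apply: typ_s_seq_ind => //.
  by move=> G l t x _ _ /= hV hG y ty; rewrite /upd; case: eqP => [->//|_ /hG].
move=> G l s ss G1 G2 _ h1 _ h2 /=; rewrite geq_max => /andP [m1 m2] hG.
by apply: h2 => //; apply: h1.
Qed.

(** In a loop, assignments to an [iint] are rejected, while declarations and inner loop variables
    take names outside the environment. *)
Lemma iint_const :
  (forall G l s G', typ_s G l s G' -> l -> forall S S', exec S s S' ->
     forall x, G x = Some TIint -> S' x = S x) /\
  (forall G l ss G', typ_seq G l ss G' -> l -> forall S S', exec_seq S ss S' ->
     forall x, G x = Some TIint -> S' x = S x).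
Proof.
apply: typ_s_seq_ind.
- move=> G l t x hx _ _ S S' he y hy.
  by inversion he; subst; rewrite /upd; case: eqP => // e; rewrite -e hy in hx.
- move=> G l x e tx te hx hl _ _ ll S S' he y hy.
  inversion he; subst; rewrite /upd; case: eqP => // e'; case: hl; split=> //.
  by rewrite e' hx in hy; case: hy.
- by move=> G l ss G' _ IH ll S S' he; inversion he; subst; apply: IH.
- move=> G l e s1 s2 G1 G2 _ _ IH1 _ IH2 ll S S' he.
  by inversion he; subst; [apply: IH1 | apply: IH2].
- move=> G l x e s G' _ hx _ IH ll S S' he y hy; inversion he as [| | | | | |S0 x0 e0 s0 i S0' h1 h2]; subst.
  have [n hn] : exists n, n = Z.to_nat i by eexists.
  have : (Z.of_nat n = i - 0 \/ i <= 0)%Z by lia.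
  elim: n S (0%Z) {he h1 hn} h2 => [|n IHn] S j h2 hn; inversion h2; subst; try lia; try by [].
  have hy' : upd S x (VInt j) y = S y.
    by rewrite /upd; case: eqP => // e1; rewrite -e1 hy in hx.
  rewrite (IHn S1 (j + 1)%Z) //; last lia.
  by rewrite (IH _ _ _ H0) // /upd; case: eqP => // e1; rewrite -e1 hy in hx.
- by move=> G l _ S S' he; inversion he.
- move=> G l s ss G1 G2 ht1 IH1 _ IH2 ll S S' he x hx.
  inversion he; subst; rewrite (IH2 ll _ _ H4); last exact: (typ_mono.1 _ _ _ _ ht1).
  exact: IH1 H2 _ _.
Qed.

Lemma srel_le G b B b' B' S r :
  srel G b B S r -> b <= b' -> B <= B' -> srel G b' B' S r.
Proof.
move=> h hb hB x t /h [v [e1 e2 e3 e4 e5]]; exists v; split=> //.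
  exact: fits_le e4 hB.
by move=> /e5 h5; apply: fits_le h5 hb.
Qed.

Lemma srel_sub G G' b B S r :
  srel G' b B S r -> (forall x t, G x = Some t -> G' x = Some t) -> srel G b B S r.
Proof. by move=> h hG x t /hG /h. Qed.

Lemma srel_env G b B S r r' V :
  srel G b B S r -> (forall x t, G x = Some t -> x < V) ->
  (forall x, x < V -> r' x = r x) -> srel G b B S r'.
Proof.
move=> h hV hr x t hx; have [v [e1 e2 e3 e4 e5]] := h _ _ hx.
by exists v; split=> //; rewrite hr // (hV _ _ hx).
Qed.

(** The hypothesis on [G'] covers both a declaration, where [G'] extends [G], and an assignment,
    where the two are equal. *)
Lemma srel_upd G G' b B S r r' x t v V :
  srel G b B S r -> (forall x t, G x = Some t -> x < V) ->
  (forall y u, G' y = Some u -> if y == x then u = t else G y = Some u) ->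
  (forall y, y < V -> y <> x -> r' y = r y) -> r' x = enc v -> vty v t ->
  fits (enc v) B -> (t = TIint -> fits (enc v) b) ->
  srel G' b B (upd S x v) r'.
Proof.
move=> h hV hG hr hx hv hB hb y u /hG; rewrite /upd; case: eqP => [-> ->|ne hy].
  by exists v.
have [w [e1 e2 e3 e4 e5]] := h _ _ hy.
by exists w; split=> //; rewrite hr // (hV _ _ hy).
Qed.

(* Inside a loop ([l = true]) the bound [b] on the iint variables does not move
   and [p b] is the number of bits by which the others grow; outside, [b = B]
   and both bounds move to [B + p B]. *)
Definition stmt_ok (G : tenv) (l : bool) (c : nat -> rcmd) (dm : nat)
    (ex : store -> store -> Prop) (G' : tenv) : Prop :=
  exists p q, [/\ poly p, poly q & forall V d b B S r S',
    dm <= V -> V <= d -> b <= B -> (l = false -> b = B) ->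
    (forall x t, G x = Some t -> x < V) -> srel G b B S r -> ex S S' ->
    runs (c d) r (q B) (fun r' =>
      srel G' (if l then b else B + p b) (B + p b) S' r' /\
      forall x, V <= x < d -> r' x = r x)].

Lemma cstmt_ok :
  (forall G l s G', typ_s G l s G' ->
     stmt_ok G l (cstmt s) (dmax s) (fun S => exec S s) G') /\
  (forall G l ss G', typ_seq G l ss G' ->
     stmt_ok G l (cseq ss) (dmax (SBlock ss)) (fun S => exec_seq S ss) G').
Proof.
apply: typ_s_seq_ind.
- move=> G l t x hx hl; exists (fun=> 0), (fun=> 1); split; polyt.
  move=> V d b B S r S' hV hd bB bl hG hr he.
  rewrite /= in hV; apply: runs_bit; rewrite /= Z.sub_diag; split; last first.
    by move=> y hy; ered.
  have [v [-> hv ev]] : exists v, [/\ S' = upd S x v, vty v t & enc v = 0%Z].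
    by inversion he; subst; [exists (VInt 0) | exists (VBool false)].
  have hz k : fits (enc v) k by rewrite ev; exact: pow2_gt0.
  apply: (@srel_upd G _ _ _ _ r _ _ t _ V) => //.
  + by apply: srel_le hr _ _; [case: l {hl} bl|]; lia.
  + by move=> y u; rewrite /upd; case: eqP => // _ [].
  + by move=> y _ ne; ered.
  + by rewrite ev; ered.
- move=> G l x e tx te hx hl ht hc.
  exists (fun=> esize e), (fun B => ecost e B + 1); split; rewrite /ecost; polyt.
  move=> V d b B S r S' hV hd bB bl hG hr he; inversion he as [| |S0 x0 e0 v hS hv| | | |]; subst.
  have [vt vB vb hruns] := cexp_ok bB hr hG hd ht hv.
  have xV := hG _ _ hx.
  rewrite /=; apply: runs_seq; apply: runs_weaken hruns _ _ => // r1 [p1 q1].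
  apply: runs_bit; split; last by move=> y hy; ered; rewrite q1 //; lia.
  apply: (@srel_upd G _ _ _ _ r _ _ tx _ V) => //.
  + by apply: srel_le hr _ _; [case: l {hl ht} bl|]; lia.
  + by move=> y u; case: eqP => // -> ; rewrite hx => -[].
  + by move=> y hy ne; ered; rewrite q1 //; lia.
  + by ered.
  + by case: hc => [[h1 h2]|[h1 h2]]; case: v {hv hS he vB vb p1} vt => z /=; rewrite ?h1 ?h2.
  + by move=> tI; case: l bl hl {ht} => [_ []|bl _] //; rewrite -tI.
- move=> G l ss G' ht [p [q [pp pq h]]]; exists p, q; split=> // V d b B S r S' hV hd bB bl hG hr he.
  inversion he as [| | |S0 ss0 S0' he'| | |]; subst.
  apply: runs_weaken (h V d b B S r S' hV hd bB bl hG hr he') _ _ => // r' [h1 h2]; split=> //.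
  by apply: srel_sub h1 _; exact: (typ_mono.2 _ _ _ _ ht).
- move=> G l e s1 s2 G1 G2 hte ht1 [p1 [q1 [pp1 pq1 h1]]] ht2 [p2 [q2 [pp2 pq2 h2]]].
  (* Sums stand in for maxima over the branches, since [poly] has no maximum. *)
  exists (fun n => p1 n + p2 n), (fun B => ecost e B + (q1 B + q2 B + 1)).
  split; rewrite /ecost; polyt.
  move=> V d b B S r S' hV hd bB bl hG hr he.
  have [v [hv he']] : exists v, eval S e (VBool v) /\ exec S (if v then s1 else s2) S'.
    by inversion he; subst; [exists true | exists false].
  have [_ _ _ hruns] := cexp_ok bB hr hG hd hte hv.
  rewrite /=; apply: runs_seq; apply: runs_weaken hruns _ _ => // r1 [e1 f1].
  have hr1 : srel G b B S r1 by apply: srel_env hr hG _ => x hx; apply: f1; lia.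
  apply: (@runs_weaken _ _ (maxn (q1 B) (q2 B)).+1 _ (fun r' =>
      srel G (if l then b else B + (p1 b + p2 b)) (B + (p1 b + p2 b)) S' r' /\
      forall x, V <= x < d -> r' x = r x)) => //; last lia.
  apply: runs_if => hp.
    have vT : v by case: v e1 {hv he'} => //= e1; lia.
    rewrite vT in he'; apply: runs_weaken (h1 V d b B S r1 S' _ hd bB bl hG hr1 he') _ _ => //.
      by move: hV => /=; lia.
    move=> r' [h3 h4]; split; last by move=> x hx; rewrite h4 // f1 //; lia.
    apply: srel_sub (_ : srel G1 _ _ _ _) (typ_mono.1 _ _ _ _ ht1).
    by apply: srel_le h3 _ _; [case: l {hte ht1 h1 ht2 h2 bl}|]; lia.
  have vF : v = false by case: v e1 {hv he'} => //= e1; lia.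
  rewrite vF in he'; apply: runs_weaken (h2 V d b B S r1 S' _ hd bB bl hG hr1 he') _ _ => //.
    by move: hV => /=; lia.
  move=> r' [h3 h4]; split; last by move=> x hx; rewrite h4 // f1 //; lia.
  apply: srel_sub (_ : srel G2 _ _ _ _) (typ_mono.1 _ _ _ _ ht2).
  by apply: srel_le h3 _ _; [case: l {hte ht1 h1 ht2 h2 bl}|]; lia.
- move=> G l x e s G' hte hx hs [p1 [q1 [pp1 pq1 h1]]].
  (* Bounds the number of iterations as well as the length of the loop index. *)
  pose N b := b + esize e.
  (* Each iteration adds the same [p1 (N b)] bits because the [iint] bound stays at [N b]. The
     summand [esize e] keeps the bound on all variables above [N b]. *)
  exists (fun b => esize e + N b * p1 (N b)).
  exists (fun B => ecost (bound e) B + (1 + (N B * (q1 (B + (esize e + N B * p1 (N B))) + 5) + 1))).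
  have pN : poly N by rewrite /N; polyt.
  have pp : poly (fun b => esize e + N b * p1 (N b)).
    by polyt; apply: (poly_comp pp1).
  split=> //.
    rewrite /ecost; polyt; apply: (poly_comp pq1); polyt; exact: (poly_comp pp1).
  move=> V d b B S r S' hV hd bB bl hG hr he.
  inversion he as [| | | | | |S0 x0 e0 s0 i S0' hi hloop]; subst.
  have [_ _ _ hruns] := cexp_ok bB hr hG hd hte hi.
  have {hi} [n [ein nN]] : exists n, i = Z.of_nat n /\ n <= N b.
    inversion hi as [| | | |o0 es0 vs0 v0 hvs hop|]; subst.
    inversion hvs as [|e1 w es1 ws hw hws]; subst; inversion hws; subst.
    case: w hw hop {hvs} => z hz // [<-].
    inversion hte as [| | | |o1 es1 ts1 t1 hts hot|]; subst.
    inversion hts as [|e2 u es2 us hu hus]; subst; inversion hus; subst.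
    case: u hu hot {hts} => // hu _.
    have [_ _ /(_ erefl) hb _] := cexp_ok bB hr hG hd hu hz.
    by exists (Z.to_nat (zsize z)); have := zsize_le hb; rewrite /N /=; lia.
  subst i; rewrite /= in hV; have hxV : x < V by lia.
  rewrite [cstmt _ _]/= -/(cexp (bound e) d).
  apply: runs_seq; apply: runs_weaken hruns _ _ => // r1 [e1 f1].
  apply: runs_seq; apply: runs_bit; rewrite [bop_sem _ _ _]/= Z.sub_diag.
  set B' := B + (esize e + N b * p1 (N b)).
  have nB : N b <= N B by rewrite /N; lia.
  have B'B : B' <= B + (esize e + N B * p1 (N B)).
    by rewrite /B' !leq_add2l; apply: leq_mul => //; exact: poly_homo.
  pose I k (r' : env) := exists j Sj, [/\ j + k = n,
    srel G b (B + esize e + j * p1 (N b)) Sj r',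
    exec_loop Sj x s (Z.of_nat j) (Z.of_nat n) S',
    r' d = Z.of_nat k /\ r' d.+1 = Z.of_nat j &
    forall y, V <= y < d -> r' y = r y].
  have hB' j : j <= n -> B + esize e + j * p1 (N b) <= B'.
    move=> jn; rewrite /B' addnA leq_add2l; apply: leq_mul => //; lia.
  apply: (@runs_weaken _ _ (n * (q1 B' + 4).+1).+1 _ (fun r' =>
     srel G b B' S' r' /\ forall y, V <= y < d -> r' y = r y)); last first.
  + move=> r' [h2 h3]; split=> //; apply: srel_le h2 _ _; rewrite /B'; last lia.
    by case: l {hte} bl => [|->]; lia.
  + rewrite addn1 ltnS; apply: leq_mul; first lia.
    by rewrite -addnS leq_add2r; apply: poly_homo.
  have I0 : I n (eset r1 d.+1 0%Z).
    exists 0, S; split=> //; [|by split; ered|by move=> y hy; ered; rewrite f1 //; lia].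
    apply: (@srel_env G b _ S r _ V) => //.
      by apply: srel_le hr _ _; lia.
    by move=> y hy; ered; apply: f1; lia.
  apply: (@runs_while _ _ (q1 B' + 4) I) I0.
  + move=> k r' [j [Sj [jn hrj hl [ed ed1] hf]]] hp.
    case: k jn ed => [|k] jn ed; first lia.
    exists k => //.
    apply: (@runs_weaken _ _ (1 + (q1 B' + (1 + (1 + 1)))) _ (I k)) => //; last lia.
    inversion hl as [|? ? ? ? ? S2 S3 hj hexec hloop']; subst; first lia.
    apply: runs_seq; apply: runs_bit; rewrite [bop_sem _ _ _]/= ed1.
    set r2 := eset r' x _; apply: runs_seq.
    have hG2 y u : upd G x TIint y = Some u -> y < V.
      by rewrite /upd; case: eqP => [->|_ /hG].
    have hr2 : srel (upd G x TIint) (N b) (B + esize e + j * p1 (N b))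
        (upd Sj x (VInt (Z.of_nat j))) r2.
      apply: (@srel_upd G _ _ _ _ r' _ _ TIint _ V) => //.
      * by apply: srel_le hrj _ _; rewrite /N; lia.
      * by move=> y u; rewrite /upd; case: eqP => // _ [].
      * by move=> y hy ne; rewrite /r2; ered.
      * by rewrite /r2; ered.
      * by apply: fits_nat; move: nN; rewrite /N; lia.
      * by move=> _; apply: fits_nat; lia.
    have hB2 : N b <= B + esize e + j * p1 (N b) by rewrite /N; lia.
    have := h1 V d.+2 (N b) _ _ r2 S2 _ _ hB2 (fun h => False_ind _ (Bool.diff_true_false h)) hG2 hr2 hexec.
    case=> [||n2 [r3 [hx3 l3 [hr3 f3]]]]; [lia|lia|].
    apply: runs_weaken (_ : runs _ _ (q1 B') (eq r3)) _ _ => //.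
      exists n2, r3; split=> //; apply: leq_trans l3 _; apply: poly_homo => //.
      by apply: hB'; lia.
    move=> _ <-; do 2 (apply: runs_seq; apply: runs_bit); apply: runs_bit; rewrite /bop_sem.
    (* The body only promises the bound [N b] for [iint] variables; as they have not changed, [b] is
       recovered from the store before it. *)
    have hS2 : srel G b (B + esize e + j.+1 * p1 (N b)) S2 r3.
      move=> y u hy; have hy2 : upd G x TIint y = Some u.
        by rewrite /upd; case: eqP => // exy; rewrite exy hx in hy.
      have [w [w1 w2 w3 w4 w5]] := hr3 _ _ (typ_mono.1 _ _ _ _ hs _ _ hy2).
      exists w; split=> //; first by apply: fits_le w4 _; rewrite mulSn; lia.
      move=> uI; rewrite uI in hy hy2.
      have := iint_const.1 _ _ _ _ hs isT _ _ hexec _ hy2.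
      rewrite w1 /upd; case: eqP => [exy|_ ew]; first by rewrite exy hx in hy.
      have [w' [w1' _ _ _ w5']] := hrj _ _ hy.
      by rewrite w1' in ew; case: ew => ->; apply: w5'.
    have e3 : r3 d.+1 = Z.of_nat j /\ r3 d = Z.of_nat k.+1.
      by rewrite !f3 /r2; [split; ered|lia..].
    exists j.+1, S2; split=> //; first lia.
    * by apply: (srel_env hS2 hG) => y hy; ered.
    * by have -> : Z.of_nat j.+1 = (Z.of_nat j + 1)%Z by lia.
    * by case: e3 => e3 e3'; split; ered; rewrite ?e3 ?e3'; lia.
    * by move=> y hy; ered; rewrite f3 /r2; [ered; exact: hf|lia].
  + move=> k r' [j [Sj [jn hrj hl [ed ed1] hf]]] hp; split=> //.
    have e0 : j = n by lia.
    inversion hl; subst; [|lia].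
    by apply: srel_le hrj _ _ => //; apply: hB'; lia.
- move=> G l; exists (fun=> 0), (fun=> 1); split; polyt.
  move=> V d b B S r S' hV hd bB bl hG hr he; inversion he; subst.
  apply: runs_skip; split=> //.
  by apply: srel_le hr _ _; [case: l bl|]; lia.
- move=> G l s ss G1 G2 ht1 [p1 [q1 [pp1 pq1 h1]]] ht2 [p2 [q2 [pp2 pq2 h2]]].
  (* The second statement starts with the [iint] bound [n + p1 n] outside loops and with [n] inside;
     monotonicity lets one formula serve both. *)
  exists (fun n => p1 n + p2 (n + p1 n)), (fun B => q1 B + q2 (B + p1 B)).
  split.
  + by apply: poly_add => //; apply: (poly_comp pp2); polyt.
  + by apply: poly_add => //; apply: (poly_comp pq2); polyt.
  move=> V d b B S r S' hV hd bB bl hG hr he; inversion he as [|S0 s0 ss0 S1 S2 e1 e2]; subst.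
  have [d1 d2] : dmax s <= V /\ dmax (SBlock ss) <= V.
    by move: hV => /=; rewrite geq_max => /andP [].
  have hG1 := (typ_dom V).1 _ _ _ _ ht1 d1 hG.
  rewrite /cseq /=; apply: runs_seq.
  apply: runs_weaken (h1 V d b B S r S1 d1 hd bB bl hG hr e1) _ _ => // r1 [hr1 f1].
  have pb : p1 b <= p1 B by exact: poly_homo.
  pose b' := if l then b else B + p1 b.
  have b1 : b' <= B + p1 b by rewrite /b'; case: l {h1 h2 ht1 ht2 hr1 b' bl}; lia.
  have b2 : b' <= b + p1 b by rewrite /b'; case: l {h1 h2 ht1 ht2 hr1 b' b1} bl => [_|->] //; lia.
  have pb' : p2 b' <= p2 (b + p1 b) by exact: poly_homo.
  have {}h2 := h2 V d b' (B + p1 b) S1 r1 S' d2 hd b1 _ hG1 hr1 e2.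
  apply: runs_weaken (h2 _) _ _.
  + by rewrite /b'; case: (l).
  + by apply: poly_homo => //; lia.
  move=> r2 [h3 f2]; split; last by move=> x hx; rewrite f2 // f1.
  apply: srel_le h3 _ _; last lia.
  by move: pb' b2; rewrite /b'; case: (l); lia.
Qed.

(** * Input and output of register programs *)

(** A lowest bit is computed as [n - n/2 - n/2]; the two bits of the first symbol go to [V+3] and
    [V+4]. *)
Definition rread V :=
  RSeq (RHalf (V + 5) V) (RSeq (RBit BSub (V + 3) V (V + 5))
  (RSeq (RBit BSub (V + 3) (V + 3) (V + 5)) (RSeq (RBit BMov V (V + 5) V)
  (RSeq (RHalf (V + 5) V.+1) (RSeq (RBit BSub (V + 4) V.+1 (V + 5))
  (RSeq (RBit BSub (V + 4) (V + 4) (V + 5)) (RSeq (RBit BMov V.+1 (V + 5) V)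
  (RHalf V.+2 V.+2)))))))).

(* Registers [V], [V+1], [V+2] hold the unread word, [V+6] the magnitude read so
   far, [V+7] the sign and [V+8] the flag that keeps the loop running. *)
Definition rnum V x :=
  RSeq (rzero (V + 6)) (RSeq (rzero (V + 7)) (RSeq (rone (V + 8))
  (RSeq (RWhile (V + 8)
     (RIf V.+2
        (RSeq (rread V)
           (RIf (V + 4) (RIf (V + 3) (rzero (V + 8)) (rone (V + 7)))
              (RSeq (RBit BAdd (V + 6) (V + 6) (V + 6))
                 (RBit BAdd (V + 6) (V + 6) (V + 3)))))
        (rzero (V + 8))))
  (RSeq (rzero (V + 9))
     (RIf (V + 7) (RBit BSub x (V + 9) (V + 6)) (RBit BMov x (V + 6) V)))))).

Fixpoint scan_num (w : seq sym) (neg : bool) (v : Z) : bool * Z * seq sym :=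
  match w with
  | [::] => (neg, v, [::])
  | S0 :: w => scan_num w neg (2 * v)
  | S1 :: w => scan_num w neg (2 * v + 1)
  | SMinus :: w => scan_num w true v
  | SSep :: w => (neg, v, w)
  end.

(** The most significant bit comes first, so scanning is Horner's rule. *)
Lemma scan_bits p w neg : scan_num (bits_pos p ++ w) neg 0 = scan_num w neg (Zpos p).
Proof.
by elim: p w => [p IH|p IH|] w //=; rewrite cat_rcons IH.
Qed.

Lemma scan_enc z w : scan_num (enc_Z z ++ w) false 0 = scan_num w (z <? 0)%Z (Z.abs z).
Proof. by case: z => [|p|p] //=; exact: scan_bits. Qed.

Lemma scan_input z zs :
  scan_num (enc_input (z :: zs)) false 0 = ((z <? 0)%Z, Z.abs z, enc_input zs).
Proof.
case: zs => [|z' zs]; last by rewrite [enc_input _]/= scan_enc.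
by rewrite [enc_input _]/= -[enc_Z z]cats0 scan_enc.
Qed.

Lemma wval_half g s w : ((Z.b2z (g s) + 2 * wval g w) / 2 = wval g w)%Z.
Proof.
symmetry; apply: (Z.div_unique_pos _ _ _ (Z.b2z (g s))); last lia.
by case: (g s) => /=; lia.
Qed.

Lemma runs_read V s w r :
  env_holds V (s :: w) r ->
  runs (rread V) r 9 (fun r' => [/\ env_holds V w r',
    r' (V + 3) = Z.b2z (sym_bits s).1, r' (V + 4) = Z.b2z (sym_bits s).2 &
    forall x, x < V \/ V + 5 < x -> r' x = r x]).
Proof.
case=> e0 e1 e2.
rewrite -[9]/(1 + (1 + (1 + (1 + (1 + (1 + (1 + (1 + 1)))))))).
have h0 : (r V / 2 = wlow w)%Z by rewrite e0; exact: wval_half.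
have h1 : (r V.+1 / 2 = whigh w)%Z by rewrite e1; exact: wval_half.
have h2 : (r V.+2 / 2 = wlen w)%Z by rewrite e2; exact: wval_half.
rewrite /wlow /whigh /= in e0 e1.
repeat first [apply: runs_seq | apply: runs_bit | apply: runs_half].
split; [split|..|move=> x hx]; ered => //=.
- by rewrite h0 e0 -/(wlow w); lia.
- by rewrite h1 e1 -/(whigh w); lia.
Qed.

Lemma wlen_gt0 s w : (0 < wlen (s :: w))%Z.
Proof. by have := @wval_ge0 (fun=> true) w; rewrite /wlen /=; lia. Qed.

Lemma runs_num V x w r :
  x < V -> env_holds V w r ->
  let: (neg, v, w') := scan_num w false 0 in
  runs (rnum V x) r (20 * (size w + 2)) (fun r' => [/\ env_holds V w' r',
    r' x = (if neg then - v else v)%Z & forall y, y < V -> y <> x -> r' y = r y]).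
Proof.
move=> xV; case E: (scan_num w false 0) => [[neg v] w'] hw.
(* The variant exceeds the unread length by one: reaching the end of the word costs an iteration of
   its own, which clears the flag. *)
pose I k (r' : env) := [/\ forall y, y < V -> r' y = r y &
  (exists w1 (neg1 : bool) v1, [/\ env_holds V w1 r', r' (V + 6) = v1,
    r' (V + 7) = Z.b2z neg1 &
    (r' (V + 8) = 1%Z /\ scan_num w1 neg1 v1 = (neg, v, w') /\ k = (size w1).+1) \/
    (r' (V + 8) = 0%Z /\ (neg1, v1, w1) = (neg, v, w'))])].
apply: (@runs_weaken _ _ (1 + (1 + (1 + (((size w).+1 * 17).+1 + (1 + (maxn 1 1).+1))))) _
   (fun r' => [/\ env_holds V w' r',
    r' x = (if neg then - v else v)%Z & forall y, y < V -> y <> x -> r' y = r y])) => //; last lia.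
do 3 (apply: runs_seq; apply: runs_bit); set r0 := eset _ (V + 8) _.
have I0 : I (size w).+1 r0.
  split=> [y hy|]; first by rewrite /r0; ered.
  exists w, false, 0%Z; case: hw => e0 e1 e2; rewrite /r0; split; [split|..|left; split=> //];
    ered => //=; lia.
apply: runs_seq; apply: (@runs_while _ _ 16 I) I0 => k r1 [hf [w1 [neg1 [v1 [hw1 e6 e7 h8]]]]] hp; last first.
  case: h8 => [[h8 _]|[h8 [? ? ?]]]; first lia.
  subst neg1 v1 w1; apply: runs_seq; apply: runs_bit; rewrite [bop_sem _ _ _]/= Z.sub_diag.
  by case: hw1 => e0 e1 e2; apply: runs_if; ered => hn; apply: runs_bit; (split; [split|..|move=> y hy hyx]);
    ered => //=; try exact: hf; rewrite ?e7 ?e6 in hn *; case: (neg) hn => //=; lia.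
case: h8 => [[h8 [hs ->]]|[h8 _]]; last lia.
exists (size w1) => //.
case: w1 hw1 hs => [|s w1] hw1 hs.
  apply: (@runs_weaken _ _ (maxn 0 1).+1 _ (I 0)) => //.
  apply: runs_if => hp2; first by case: hw1 => _ _ e2; rewrite e2 in hp2.
  apply: runs_bit; rewrite [bop_sem _ _ _]/= Z.sub_diag.
  split=> [y hy|]; first by ered; exact: hf.
  exists [::], neg1, v1; case: hw1 => e0 e1 e2; split; [split|..|right; split]; ered => //.
apply: (@runs_weaken _ _ (maxn (9 + (maxn (maxn 1 1).+1 (1 + 1)).+1) 0).+1 _ (I (size w1).+1)) => //.
apply: runs_if => hp2; last by case: hw1 => _ _ e2; have := @wlen_gt0 s w1; lia.
apply: runs_seq; apply: runs_weaken (runs_read hw1) _ _ => // r2 [hw2 b0 b1 hf2].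
have e6' : r2 (V + 6) = v1 by rewrite hf2 //; lia.
have e7' : r2 (V + 7) = Z.b2z neg1 by rewrite hf2 //; lia.
have e8' : r2 (V + 8) = 1%Z by rewrite hf2 //; lia.
have hf' y : y < V -> r2 y = r y by move=> hy; rewrite hf2 ?hf //; lia.
case: s hs hp2 {hw1 e6 e7 h8 hp} b0 b1 => /= hs _ b0 b1.
1,2: apply: runs_if => hb; first lia.
1,2: apply: runs_seq; do 2 apply: runs_bit; case: hw2 => e0 e1 e2.
1,2: split=> [y hy|]; [by ered; exact: hf'|].
1,2: eexists w1, neg1, _; split; [split|..|left; split; [|split; [exact: hs|]]]; ered => //=; lia.
all: apply: runs_if => hb; last lia.
all: apply: runs_if => hb2; try lia; apply: runs_bit; case: hw2 => e0 e1 e2.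
all: split=> [y hy|]; [by ered; exact: hf'|].
  by eexists w1, true, _; split; [split|..|left; split; [|split; [exact: hs|]]]; ered => //=.
by eexists w1, neg1, v1; split; [split|..|right; split]; ered => //=; lia.
Qed.

Definition rparams V ps := foldr (fun x c => RSeq (rnum V x) c) rskip ps.

Lemma size_enc_input z zs :
  size (enc_Z z) + size (enc_input zs) <= size (enc_input (z :: zs)).
Proof.
case: zs => [|z' zs]; first by rewrite addn0.
by rewrite [enc_input (z :: _)]/= size_cat /=; lia.
Qed.

Lemma runs_params V ps zs r :
  size ps = size zs -> uniq ps -> all (fun x => x < V) ps ->
  env_holds V (enc_input zs) r ->
  runs (rparams V ps) r (size ps * (20 * (size (enc_input zs) + 2)) + 1) (fun r' =>
    forall x, x < V -> r' x = if x \in ps then nth 0%Z zs (index x ps) else r x).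
Proof.
elim: ps zs r => [|x ps IH] [|z zs] r // => [_ _ _ _|[sz] /andP [xps ups] /andP [xV aV] hw].
  by apply: runs_skip.
have := runs_num xV hw; rewrite scan_input => hnum.
have hs := size_enc_input z zs.
apply: (@runs_weaken _ _ (20 * (size (enc_input (z :: zs)) + 2) +
  (size ps * (20 * (size (enc_input zs) + 2)) + 1)) _ (fun r' =>
    forall y, y < V -> r' y = if y \in x :: ps then nth 0%Z (z :: zs) (index y (x :: ps)) else r y)) => //; last first.
  rewrite [size (x :: ps)]/= (mulSn (size ps)).
  have : size ps * (20 * (size (enc_input zs) + 2)) <= size ps * (20 * (size (enc_input (z :: zs)) + 2)).
    by rewrite leq_mul2l; apply/orP; right; lia.
  lia.
apply: runs_seq; apply: runs_weaken hnum _ _ => // r1 [h1 h2 h3].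
apply: runs_weaken (IH zs r1 sz ups aV h1) _ _ => // r2 h4 y hy.
rewrite h4 // in_cons; case: (y =P x) => [->|ne].
  by rewrite (negPf xps) h2 /= eqxx /=; case: Z.ltb_spec; lia.
rewrite h3 //=; have -> // : (x == y) = false.
by apply/eqP => /esym.
Qed.

(** The first symbol is the least significant, so one is put in front by doubling and adding its
    bits; [V+7] holds the 1 for the length. *)
Definition rpush V b0 b1 :=
  RSeq (RBit BAdd V V V) (RSeq (RBit BAdd V V b0)
  (RSeq (RBit BAdd V.+1 V.+1 V.+1) (RSeq (RBit BAdd V.+1 V.+1 b1)
  (RSeq (RBit BAdd V.+2 V.+2 V.+2) (RBit BAdd V.+2 V.+2 (V + 7)))))).

Lemma runs_push V b0 b1 s w r :
  V.+2 < b0 -> V.+2 < b1 -> r b0 = Z.b2z (sym_bits s).1 ->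
  r b1 = Z.b2z (sym_bits s).2 -> r (V + 7) = 1%Z -> env_holds V w r ->
  runs (rpush V b0 b1) r 6 (fun r' => env_holds V (s :: w) r' /\
    forall x, V.+2 < x -> r' x = r x).
Proof.
move=> h0 h1 e0 e1 e7 [w0 w1 w2]; rewrite -[6]/(1 + (1 + (1 + (1 + (1 + 1))))).
repeat first [apply: runs_seq | apply: runs_bit].
split; [split|move=> x hx]; ered => //=.
- by rewrite w0 e0 /wlow /=; lia.
- by rewrite w1 e1 /whigh /=; lia.
- by rewrite w2 e7 /wlen /=; lia.
Qed.

(** Bits come out least significant first and each is put in front, which yields the required order.
    Zero needs a digit of its own, and the sign is pushed last. *)
Definition rout V :=
  RSeq (RBit BMov (V + 3) V V) (RSeq (rzero V) (RSeq (rzero V.+1) (RSeq (rzero V.+2)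
  (RSeq (rzero (V + 5)) (RSeq (rone (V + 7))
  (RSeq (RIf (V + 3) (RBit BMov (V + 4) (V + 3) V) (RBit BSub (V + 4) (V + 5) (V + 3)))
  (RSeq (RIf (V + 4)
     (RWhile (V + 4)
        (RSeq (RHalf (V + 6) (V + 4)) (RSeq (RBit BSub (V + 8) (V + 4) (V + 6))
        (RSeq (RBit BSub (V + 8) (V + 8) (V + 6)) (RSeq (RBit BMov (V + 4) (V + 6) V)
          (rpush V (V + 8) (V + 5)))))))
     (rpush V (V + 5) (V + 5)))
  (RSeq (RBit BSub (V + 4) (V + 5) (V + 3))
     (RIf (V + 4) (rpush V (V + 5) (V + 7)) rskip))))))))).

Definition zbits (z : Z) : seq sym := if z is Zpos p then bits_pos p else [::].

Lemma zbits_half z : (0 < z)%Z ->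
  exists b : bool, (z - z / 2 - z / 2)%Z = Z.b2z b /\
    zbits z = rcons (zbits (z / 2)) (if b then S1 else S0).
Proof.
case: z => // -[p|p|] _.
- exists true; have -> : (Zpos p~1 / 2 = Zpos p)%Z by rewrite -Z.div2_div.
  by split=> //=; lia.
- exists false; have -> : (Zpos p~0 / 2 = Zpos p)%Z by rewrite -Z.div2_div.
  by split=> //=; lia.
- by exists true.
Qed.

Lemma runs_out V r k :
  fits (r V) k -> runs (rout V) r (11 * k + 40) (env_holds V (enc_Z (r V))).
Proof.
move=> hk; set y := r V in hk *.
apply: (@runs_weaken _ _ (1 + (1 + (1 + (1 + (1 + (1 + (2 + ((maxn (k * 11).+1 6).+1 + (1 + (maxn 6 1).+1))))))))) _
  (env_holds V (enc_Z y))) => //; last lia.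
do 6 (apply: runs_seq; apply: runs_bit).
rewrite /bop_sem !Z.sub_diag.
set r1 := eset _ (V + 7) _.
pose F (r' : env) := [/\ r' (V + 3) = y, r' (V + 5) = 0%Z & r' (V + 7) = 1%Z].
have F1 : F r1 by rewrite /F /r1; split; ered.
have w1 : env_holds V [::] r1 by rewrite /r1; split; ered.
clearbody r1.
apply: runs_seq; apply: (@runs_weaken _ _ (maxn 1 1).+1 _ (fun r' => [/\ F r',
    env_holds V [::] r' & r' (V + 4) = Z.abs y])) => //.
  case: F1 w1 => f3 f5 f7 [g0 g1 g2].
  by apply: runs_if => hy; apply: runs_bit; (split; [split|split|]); ered => //=; lia.
move=> r2 [F2 w2 a2].
have hpush w s b0 b1 r3 : V.+2 < b0 -> V.+2 < b1 -> F r3 ->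
    r3 b0 = Z.b2z (sym_bits s).1 -> r3 b1 = Z.b2z (sym_bits s).2 ->
    env_holds V w r3 ->
    runs (rpush V b0 b1) r3 6 (fun r' => [/\ F r', env_holds V (s :: w) r' &
      r' (V + 4) = r3 (V + 4)]).
  move=> h0 h1 [f3 f5 f7] e0 e1 hw.
  apply: runs_weaken (runs_push h0 h1 e0 e1 f7 hw) _ _ => // r' [hw' hf].
  by split=> //; [split|]; rewrite hf //; lia.
pose u := if (y =? 0)%Z then [:: S0] else zbits (Z.abs y).
apply: runs_seq; apply: (@runs_weaken _ _ (maxn (k * 11).+1 6).+1 _ (fun r' =>
   F r' /\ env_holds V u r')) => //.
  apply: runs_if => hy; rewrite a2 in hy; last first.
    apply: runs_weaken (hpush [::] S0 (V + 5) (V + 5) r2 _ _ F2 _ _ w2) _ _ => //; try lia.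
    - by case: F2.
    - by case: F2.
    - move=> r' [F' w' _]; split=> //; rewrite /u.
      by case: Z.eqb_spec => //; lia.
  (* The bits still to come followed by the word built so far always make up the whole numeral. *)
  pose I j (r' : env) := [/\ F r', (0 <= r' (V + 4)%N < 2 ^ Z.of_nat j)%Z &
    exists v, env_holds V v r' /\ zbits (r' (V + 4)) ++ v = zbits (Z.abs y)].
  apply: (@runs_while _ _ 10 I).
  - move=> j r3 [F3 hj [v [hv hz]]] hp.
    case: j hj => [|j] hj; first by rewrite Z.pow_0_r in hj; lia.
    exists j => //; apply: (@runs_weaken _ _ (1 + (1 + (1 + (1 + 6)))) _ (I j)) => //.
    apply: runs_seq; apply: runs_half; do 3 (apply: runs_seq; apply: runs_bit).
    rewrite /bop_sem; have [b [hb1 hb2]] := zbits_half hp.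
    set r4 := eset _ (V + 4) _.
    have e4 : r4 (V + 4) = (r3 (V + 4)%N / 2)%Z by rewrite /r4; ered.
    have F4 : F r4 by case: F3 => f3 f5 f7; rewrite /F /r4; split; ered.
    apply: runs_weaken (hpush v (if b then S1 else S0) (V + 8) (V + 5) r4 _ _ F4 _ _ _) _ _ => //; try lia.
    + by rewrite /r4; ered; rewrite hb1; case: (b).
    + by case: F4 => _ -> _; case: (b).
    + by case: hv => g0 g1 g2; rewrite /r4; split; ered.
    + move=> r5 [F5 w5 e5]; split=> //; rewrite e5 e4.
        rewrite fits_succ in hj; split; first by apply: Z.div_pos; lia.
        by apply: Z.div_lt_upper_bound; lia.
      by eexists; split; [exact: w5|]; rewrite -hz hb2 cat_rcons.
  - move=> j r3 [F3 hj [v [hv hz]]] hp; split=> //.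
    rewrite /u; case: Z.eqb_spec => [y0|_]; first by lia.
    by move: hz; rewrite (_ : r3 (V + 4) = 0%Z) /=; [move=> <-|lia].
  - split=> //; rewrite a2; [lia|].
    by exists [::]; rewrite cats0.
move=> r3 [F3 w3]; apply: runs_seq; apply: runs_bit; rewrite /bop_sem.
set r4 := eset _ (V + 4) _.
have F4 : F r4 by case: F3 => f3 f5 f7; rewrite /F /r4; split; ered.
have w4 : env_holds V u r4 by case: w3 => g0 g1 g2; rewrite /r4; split; ered.
have e4 : r4 (V + 4) = (- y)%Z by case: F3 => f3 f5 f7; rewrite /r4; ered; lia.
apply: runs_if => hy; rewrite e4 in hy; last first.
  apply: runs_skip; move: w4; rewrite /u.
  by case: (y) hy => //= p; lia.
apply: runs_weaken (hpush u SMinus (V + 5) (V + 7) r4 _ _ F4 _ _ w4) _ _ => //; try lia.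
- by case: F4.
- by case: F4.
- by move=> r' [_ h _]; move: h; rewrite /u; case: (y) hy => //= p; lia.
Qed.

Lemma fits_bits p : fits (Zpos p) (size (bits_pos p)).
Proof.
by elim: p => [p IH|p IH|] //=; rewrite size_rcons fits_succ; lia.
Qed.

Lemma fits_enc z : fits z (size (enc_Z z)).
Proof.
case: z => [|p|p] //=; first exact: fits_bits.
by rewrite fits_succ; have := @fits_bits p; lia.
Qed.

Lemma fits_input zs i : i < size zs -> fits (nth 0%Z zs i) (size (enc_input zs)).
Proof.
elim: zs i => // z zs IH [|i] hi; have := size_enc_input z zs => hs.
  by apply: fits_le (@fits_enc z) _; lia.
by apply: fits_le (IH i hi) _; lia.
Qed.

(** [FP] states its bound with [Nat.pow], while [^] denotes [expn] here. *)
Lemma expn_pow n k : Nat.pow n k = n ^ k.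
Proof. by elim: k => [|k IH] //=; rewrite IH expnS. Qed.

Lemma FPC_FP m (f : m.-tuple Z -> Z) : FPC f -> FP f.
Proof.
case=> p [[up [G' [t [hbody [hret tI]]]]] [szp hp]].
(* All program variables lie below [V]; the input word, the temporaries and the output live from [V]
   on. *)
pose V := maxn (dmax (SBlock (body p))) (\max_(x <- params p) x.+1).
have pV : all (fun x => x < V) (params p).
  apply/allP => x hx; rewrite /V leq_max; apply/orP; right.
  exact: (@leq_bigmax_seq _ _ xpredT (fun x : nat => x.+1) x hx).
have [a [q [pa pq hstmt]]] := cstmt_ok.2 _ _ _ _ hbody.
pose c := RSeq (rparams V (params p)) (RSeq (cseq (body p) V) (RSeq (cexp (ret p) V) (rout V))).
(* After the body all variables fit in [n + a n] bits, and evaluating the result adds at most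
   [esize (ret p)]. *)
pose T n := (size (params p) * (20 * (n + 2)) + 1) + (q n + (ecost (ret p) (n + a n) +
  (11 * (n + a n + esize (ret p)) + 40))).
have pT : poly T.
  by rewrite /T /ecost; polyt.
(* The time bound of [tm_runs] with [T n] instructions. *)
pose U n := 2 * n + 2 + (T n * (2 * (n + 1 + T n) + 2) + (2 * (n + 1 + T n) + 2)).
have pU : poly U by rewrite /U; polyt.
have [C [k hU]] := poly_le_expn pU.
exists (tm V c), C, k => xs; set w := enc_input xs; set n := size w.
suff [s [r' [hx hs hr']]] : runs c (env_of_word V w) (T n) (env_holds V (enc_Z (f xs))).
  have [t' ht' hrun] := tm_runs hx hr'; exists t'; split=> //.
  rewrite expn_pow; apply: leq_trans (hU n); apply: leq_trans ht' _.
  rewrite -/n /U leq_add2l.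
  have h1 : (2 * (n + 1 + s)).+2 <= 2 * (n + 1 + T n) + 2 by lia.
  by apply: leq_add => //; apply: leq_mul.
have szs : size (params p) = size xs by rewrite size_tuple.
have [S' [hex hev]] := hp xs.
have hw0 : env_holds V w (env_of_word V w).
  by rewrite /env_of_word; split; ered.
apply: runs_seq; apply: runs_weaken (runs_params szs up pV hw0) _ _ => // r1 h1.
have hG x u : tenv0 (params p) x = Some u -> x < V.
  by rewrite /tenv0; case: ifP => // /(allP pV).
have hr1 : srel (tenv0 (params p)) n n (init_store (params p) xs) r1.
  move=> x u hx; have xV := hG _ _ hx; move: hx; rewrite /tenv0 /init_store.
  case: ifP => // xp [<-]; eexists; split; first reflexivity.
  - by [].
  - by rewrite h1 // xp.
  - by apply: fits_input; rewrite -szs index_mem.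
  - by [].
have dV : dmax (SBlock (body p)) <= V by rewrite leq_maxl.
have := hstmt V V n n _ r1 S' dV (leqnn _) (leqnn _) (fun=> erefl) hG hr1 hex.
move=> hrun; apply: runs_seq; apply: runs_weaken hrun _ _ => // r2 [hr2 _].
have hG' := (typ_dom V).2 _ _ _ _ hbody dV hG.
have [_ hf _ hrun] := cexp_ok (leqnn _) hr2 hG' (leqnn V) hret hev.
apply: runs_seq; apply: runs_weaken hrun _ _ => // r3 [e3 _].
rewrite -e3 in hf; apply: runs_weaken (runs_out hf) _ _ => // r4.
by rewrite e3.
Qed.

(** * Denotational semantics of well-typed statements *)

(** The default [VInt 0] only makes the function total; typed expressions do not reach it. *)
Fixpoint vev (r : nat -> val) (e : expr) : val :=
  match e with
  | EVar x => r x
  | ENum n => VInt (Z.of_nat n)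
  | ETrue => VBool true
  | EFalse => VBool false
  | EOp o es => odflt (VInt 0) (op_sem o (map (vev r) es))
  | EParen e => vev r e
  end.

Fixpoint for_loop (A : Type) (F : Z -> A -> A) (j : Z) (n : nat) (r : A) : A :=
  if n is n'.+1 then for_loop F (j + 1) n' (F j r) else r.

Fixpoint sx (s : stmt) (r : nat -> val) : nat -> val :=
  match s with
  | SDecl t x => eset r x (if isInt t then VInt 0 else VBool false)
  | SAssign x e => eset r x (vev r e)
  | SBlock ss => foldl (fun r s => sx s r) r ss
  | SIf e s1 s2 => if vev r e is VBool true then sx s1 r else sx s2 r
  | SFor x e s =>
      for_loop (fun j r => sx s (eset r x (VInt j))) 0
        (if vev r e is VInt z then Z.to_nat (zsize z) else 0) r
  end.

Definition sxs (ss : seq stmt) (r : nat -> val) := sx (SBlock ss) r.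

(** Restricted to typed variables, because a store keeps the variables of closed blocks while the
    environment forgets them. *)
Definition sat (G : tenv) (S : store) (r : nat -> val) : Prop :=
  forall x t, G x = Some t -> S x = Some (r x) /\ vty (r x) t.

Lemma op_total o ts t vs :
  op_type o ts = Some t -> List.Forall2 vty vs ts ->
  exists2 v, op_sem o vs = Some v & vty v t.
Proof.
move=> + h; case: h => [|a ta vs1 ts1 ha]; first by case: o.
case=> [|b tb vs2 ts2 hb].
  by case: o; case: ta ha => //; case: a => // a _ [<-]; eexists; reflexivity.
case=> [|? ? ? ? ? ?]; last by case: o => //; case: ta ha => //; case: tb hb.
case: o => //; case: ta ha => //; case: tb hb => //; case: a => // a; case: b => // b;
  by move=> _ _ [<-]; eexists; reflexivity.
Qed.

Lemma vev_ok G l S r e t :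
  sat G S r -> typ_e G l e t -> eval S e (vev r e) /\ vty (vev r e) t.
Proof.
move=> hs; elim/expr_ind_nested: e t => [x|n|||o es IH|e IH] t ht.
- inversion ht as [x' t' hx| | | | |]; subst.
  by have [h1 h2] := hs _ _ hx; split=> //; apply: EvVar.
- by inversion ht; subst; split=> //; apply: EvNum.
- by inversion ht; subst; split=> //; apply: EvTrue.
- by inversion ht; subst; split=> //; apply: EvFalse.
- inversion ht as [| | | |o' es' ts t' hts hot|]; subst.
  have [h1 h2] : List.Forall2 (eval S) es (map (vev r) es) /\
      List.Forall2 vty (map (vev r) es) ts.
    elim: hts IH {hot ht} => [|e u es' us hu _ IHl]; first by split; constructor.
    move=> /List.Forall_cons_iff [he /IHl [h1 h2]]; have [h3 h4] := he _ hu.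
    by split; constructor.
  have [v hv hvt] := op_total hot h2.
  by rewrite /= hv; split=> //; apply: EvOp h1 hv.
- inversion ht as [| | | | |e' t' h]; subst.
  by have [h1 h2] := IH _ h; split=> //; apply: EvParen.
Qed.

Lemma sat_sub G G' S r :
  sat G' S r -> (forall x t, G x = Some t -> G' x = Some t) -> sat G S r.
Proof. by move=> h hG x t /hG /h. Qed.

Lemma sat_upd G S r x t v : vty v t -> sat G S r -> sat (upd G x t) (upd S x v) (eset r x v).
Proof.
by move=> hv h y u; rewrite /upd /eset; case: eqP => [_ [<-]|_ /h].
Qed.

(** Typed statements terminate because a loop bound is evaluated once, before the loop. *)
Lemma sx_ok :
  (forall G l s G', typ_s G l s G' -> forall S r, sat G S r ->
     exists2 S', exec S s S' & sat G' S' (sx s r)) /\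
  (forall G l ss G', typ_seq G l ss G' -> forall S r, sat G S r ->
     exists2 S', exec_seq S ss S' & sat G' S' (sxs ss r)).
Proof.
apply: typ_s_seq_ind.
- move=> G l t x hx hl S r hs.
  exists (upd S x (if isInt t then VInt 0 else VBool false)).
    by case: (t); constructor.
  by apply: sat_upd => //; case: (t).
- move=> G l x e tx te hx hl ht hc S r hs.
  have [h1 h2] := vev_ok hs ht; exists (upd S x (vev r e)).
    by constructor=> //; have [-> _] := hs _ _ hx.
  move=> y u hy; rewrite /upd /= /eset; case: eqP => [e1|_]; last exact: hs.
  split=> //; move: hy; rewrite e1 hx => -[<-].
  by case: hc h2 => [[a1 a2]|[-> ->] //]; case: (vev r e) => //= z; rewrite a1 ?a2.
- move=> G l ss G' ht IH S r /IH [S' h1 h2]; exists S'; first exact: ExBlock.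
  by apply: sat_sub h2 _; exact: (typ_mono.2 _ _ _ _ ht).
- move=> G l e s1 s2 G1 G2 hte ht1 IH1 ht2 IH2 S r hs.
  have [h1 h2] := vev_ok hs hte; rewrite /=.
  case: (vev r e) h1 h2 => // -[] h1 _.
    have [S' h3 h4] := IH1 _ _ hs; exists S'; first exact: ExIfT h1 h3.
    by apply: sat_sub h4 _; exact: (typ_mono.1 _ _ _ _ ht1).
  have [S' h3 h4] := IH2 _ _ hs; exists S'; first exact: ExIfF h1 h3.
  by apply: sat_sub h4 _; exact: (typ_mono.1 _ _ _ _ ht2).
- move=> G l x e s G' hte hx ht IH S r hs.
  inversion hte as [| | | |o1 es1 ts1 t1 hts hot|]; subst.
  inversion hts as [|e2 u es2 us hu hus]; subst; inversion hus; subst.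
  have [h1 h2] := vev_ok hs hu.
  case: u hu hot h2 {hts} => // _ _; rewrite [sx _ _]/=.
  case: (vev r e) h1 => // z h1 _.
  have hev : eval S (bound e) (VInt (zsize z)).
    by apply: (EvOp (vs := [:: VInt z])) => //; constructor.
  suff [S' h3 h4] : exists2 S', exec_loop S x s 0 (zsize z) S' & sat G S'
     (for_loop (fun j r => sx s (eset r x (VInt j))) 0 (Z.to_nat (zsize z)) r).
    by exists S' => //; apply: ExFor hev h3.
  have : (zsize z - 0 = Z.of_nat (Z.to_nat (zsize z)))%Z by have := @zsize_ge0 z; lia.
  elim: (Z.to_nat _) (0%Z) S r hs {h1 hev} => [|n IHn] j S r hs hn.
    by exists S => //; apply: LoopDone; lia.
  have [|S1 e1 s1] := IH (upd S x (VInt j)) (eset r x (VInt j)); first exact: sat_upd.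
  have hs1 : sat G S1 (sx s (eset r x (VInt j))).
    apply: sat_sub s1 _ => y u hy; apply: (typ_mono.1 _ _ _ _ ht).
    by rewrite /upd; case: eqP => // e3; rewrite -e3 hy in hx.
  have [|S' e2 s2] := IHn (j + 1)%Z _ _ hs1; first lia.
  by exists S' => //; apply: LoopStep e1 e2; lia.
- by move=> G l S r hs; exists S => //; constructor.
- move=> G l s ss G1 G2 ht1 IH1 ht2 IH2 S r /IH1 [S1 e1 /IH2 [S2 e2 h]].
  by exists S2 => //; apply: ExCons e1 e2.
Qed.

(** * A program simulating a Turing machine *)

Lemma sxs_cat ss1 ss2 r : sxs (ss1 ++ ss2) r = sxs ss2 (sxs ss1 r).
Proof. exact: foldl_cat. Qed.

Lemma sxs_cons s ss r : sxs (s :: ss) r = sxs ss (sx s r).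
Proof. by []. Qed.

Fixpoint emul (n : nat) (e : expr) : expr :=
  if n is n'.+1 then EOp OAdd [:: e; emul n' e] else ENum 0.

Lemma vev_emul r n e z : vev r e = VInt z -> vev r (emul n e) = VInt (Z.of_nat n * z).
Proof.
move=> he; elim: n => [|n IH]; first by [].
by rewrite /= he IH /=; congr VInt; lia.
Qed.

#[local] Opaque emul.

Lemma zsize_eq0 z : (0 <= z)%Z -> zsize z = 0%Z -> z = 0%Z.
Proof.
move=> z0; rewrite /zsize => h.
case: (Z.eq_dec z 0) => // ne; have : (0 < Z.log2_up (Z.abs z + 1))%Z; last lia.
by apply: Z.log2_up_pos; lia.
Qed.

Lemma bit_quot z : (0 <= z)%Z -> zdiv z 2 = (z / 2)%Z.
Proof. by move=> h; rewrite /zdiv /= Z.quot_div_nonneg. Qed.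

Lemma bit_rem z : (0 <= z)%Z -> zmod z 2 = (z - z / 2 - z / 2)%Z.
Proof. by move=> h; rewrite /zmod /= Z.rem_mod_nonneg // Z.mod_eq //; lia. Qed.

Definition frame_eq (xs : seq nat) (r r' : nat -> val) : Prop :=
  forall y, y \notin xs -> r' y = r y.

(* Right half of the tape with the head cell, left half, state, symbol read,
   magnitude of the input being read, sign and magnitude of the output, end of
   the output reached, and two iint variables that serve as loop bounds. *)
Definition Rv := 0.
Definition Lv := 1.
Definition Qv := 2.
Definition Av := 3.
Definition Vv := 4.
Definition Nv := 5.
Definition Ov := 6.
Definition Sv := 7.
Definition Yv := 8.
Definition Tv := 9.

Definition eq_num (x n : nat) := EOp OEq [:: EVar x; ENum n].
Definition nop := SBlock [::].

(** * Tape halves as numbers, and writing the input on the tape *)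

Section ProgramInput.
Variable M : TM.

Let G := tsym M.
Let Bq := #|G|.+1.

(** The blank is 0 so that the infinite blank rest of the tape has value 0. The other symbols get
    positive digits, hence the base [#|G|.+1]. *)
Definition digit (g : G) : nat := if g == blank M then 0 else (enum_rank g).+1.

Lemma digit_lt g : digit g < Bq.
Proof. by rewrite /digit; case: eqP => // _; rewrite ltnS; exact: (ltn_ord (enum_rank g)). Qed.

Lemma digit_inj : injective digit.
Proof.
move=> g g'; rewrite /digit; case: eqP => [->|_]; case: eqP => [->|_] // [e].
by apply: enum_rank_inj; apply: ord_inj.
Qed.

Lemma digit_blank : digit (blank M) = 0.
Proof. by rewrite /digit eqxx. Qed.

Lemma Bq_gt1 : 1 < Bq.
Proof. by rewrite ltnS; apply/card_gt0P; exists (blank M). Qed.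

(* A tape half is a number in base [Bq], the cell next to the head being the
   least significant digit; blanks are zeros. *)
Fixpoint dval (l : seq G) : Z :=
  if l is g :: l' then (Z.of_nat (digit g) + Z.of_nat Bq * dval l')%Z else 0%Z.

Lemma dval_ge0 l : (0 <= dval l)%Z.
Proof. by elim: l => //= g l IH; nia. Qed.

Lemma dval_quot l : zdiv (dval l) (Z.of_nat Bq) = dval (behead l).
Proof.
have hB := Bq_gt1; rewrite /zdiv; case: Z.eqb_spec => [|_]; first lia.
rewrite Z.quot_div_nonneg; [|exact: dval_ge0|lia].
case: l => [|g l] /=; first by rewrite Z.div_0_l; lia.
symmetry; apply: (Z.div_unique_pos _ _ _ (Z.of_nat (digit g))); last lia.
by have := digit_lt g; lia.
Qed.

Lemma dval_rem l : zmod (dval l) (Z.of_nat Bq) = Z.of_nat (digit (head (blank M) l)).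
Proof.
have hB := Bq_gt1; rewrite /zmod; case: Z.eqb_spec => [|_]; first lia.
rewrite Z.rem_mod_nonneg; [|exact: dval_ge0|lia].
case: l => [|g l] /=; first by rewrite Z.mod_0_l ?digit_blank; lia.
symmetry; apply: (Z.mod_unique_pos _ _ (dval l)); last lia.
by have := digit_lt g; lia.
Qed.

(** Nonblank cells have positive digits in a base of at least 2. Hence the size of a half reaches
    all its nonblank cells and can bound a loop over them. *)
Lemma dval_ge l i : nth (blank M) l i <> blank M -> (2 ^ Z.of_nat i <= dval l)%Z.
Proof.
have hB := Bq_gt1.
elim: l i => [|g l IH] [|i] //=; first by rewrite /digit; case: eqP => // _ _; have := @dval_ge0 l; nia.
by move=> /IH h; rewrite fits_succ; nia.
Qed.

Definition push (x n : nat) :=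
  SAssign x (EOp OAdd [:: emul Bq (EVar x); ENum n]).
Definition pushs (s : sym) := push Rv (digit (embed M s)).

Lemma sx_push x z g r l :
  r x = VInt z -> z = dval l -> sx (push x (digit g)) r = eset r x (VInt (dval (g :: l))).
Proof.
move=> hx hz; rewrite /push /= (@vev_emul r Bq (EVar x) z hx) /= hz.
by congr eset; congr VInt; lia.
Qed.

#[local] Opaque push.

Variable J : nat.

(** The numeral is written from its right end: each bit is pushed in front, then the sign. [Tv]
    turns the [int] input into an [iint] loop bound. *)
Definition read_num (x : var) : seq stmt :=
  [:: SAssign Tv (EVar x);
      SIf (EOp OLt [:: EVar x; ENum 0]) (SAssign Vv (EOp ONeg [:: EVar x]))
        (SAssign Vv (EVar x));
      SIf (eq_num Vv 0) (pushs S0) nop;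
      SFor J (EVar Tv)
        (SBlock [:: SIf (EOp OEq [:: EOp OMod [:: EVar Vv; ENum 2]; ENum 1])
                      (pushs S1) (pushs S0);
                    SAssign Vv (EOp ODiv [:: EVar Vv; ENum 2])]);
      SIf (EOp OLt [:: EVar x; ENum 0]) (pushs SMinus) nop].

(** The tape grows at its left end, so the last input is written first. *)
Fixpoint read_input (xs : seq var) : seq stmt :=
  match xs with
  | [::] => [::]
  | [:: x] => read_num x
  | x :: xs => read_input xs ++ pushs SSep :: read_num x
  end.

Definition word (w : seq sym) : seq G := map (@embed M) w.

Lemma sx_pushs s r w : r Rv = VInt (dval (word w)) ->
  sx (pushs s) r = eset r Rv (VInt (dval (word (s :: w)))).
Proof. by move=> h; apply: sx_push h erefl. Qed.

#[local] Opaque pushs.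

Hypothesis J_gt : 9 < J.

Lemma read_bits_ok n j v w r :
  (0 <= v)%Z -> zsize v = Z.of_nat n -> r Vv = VInt v -> r Rv = VInt (dval (word w)) ->
  let r' := for_loop (fun j r => sx
        (SBlock [:: SIf (EOp OEq [:: EOp OMod [:: EVar Vv; ENum 2]; ENum 1])
                      (pushs S1) (pushs S0);
                    SAssign Vv (EOp ODiv [:: EVar Vv; ENum 2])])
     (eset r J (VInt j))) j n r in
  r' Rv = VInt (dval (word (zbits v ++ w))) /\ frame_eq [:: Rv; Vv; J] r r'.
Proof.
elim: n j v w r => [|n IH] j v w r v0 hv hV hR /=.
  by rewrite (zsize_eq0 v0 hv).
have vp : (0 < v)%Z.
  by case: (Z.eq_dec v 0) => [e|]; [rewrite e (_ : zsize 0 = 0%Z) // in hv; lia|lia].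
have [b [hb1 hb2]] := zbits_half vp.
set r0 := eset r J _.
have h0V : r0 Vv = VInt v by rewrite /r0 /Vv; ered.
have h0R : r0 Rv = VInt (dval (word w)) by rewrite /r0 /Rv; ered.
rewrite h0V /= -[Z.of_nat 2]/2%Z -[Z.of_nat 1]/1%Z bit_rem // hb1.
set r1 := (if _ then _ else _).
have {}h1 : r1 = eset r0 Rv (VInt (dval (word ((if b then S1 else S0) :: w)))).
  by rewrite /r1; case: (b) => /=; rewrite (sx_pushs _ h0R).
have h1V : r1 Vv = VInt v by rewrite h1 /Vv /Rv; ered.
rewrite h1V /= bit_quot //; set r2 := eset _ _ _.
have v2 : (0 <= v / 2)%Z by apply: Z.div_pos; lia.
have [||||h2 h3] := IH (j + 1)%Z (v / 2)%Z ((if b then S1 else S0) :: w) r2 => //.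
- by rewrite zsize_half in hv; lia.
- by rewrite /r2 h1 /Rv /Vv; ered.
split; first by rewrite h2 hb2 cat_rcons.
move=> y hy; rewrite h3 // /r2 h1 /r0.
move: hy; rewrite !inE /eset => /norP [/negPf -> /norP [/negPf -> /negPf ->]].
by [].
Qed.

Lemma read_num_ok x z w r :
  9 < x -> x != J -> r x = VInt z -> r Rv = VInt (dval (word w)) ->
  let r' := sxs (read_num x) r in
  r' Rv = VInt (dval (word (enc_Z z ++ w))) /\ frame_eq [:: Rv; Vv; Tv; J] r r'.
Proof.
move=> x9 xJ hx hR r'.
pose r1 := eset (eset r Tv (VInt z)) Vv (VInt (Z.abs z)).
pose w2 := if (z =? 0)%Z then S0 :: w else w.
pose r2 := if (z =? 0)%Z then eset r1 Rv (VInt (dval (word w2))) else r1.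
have hR1 : r1 Rv = VInt (dval (word w)) by rewrite /r1 /Rv /Vv /Tv; ered.
have e1 : sx (nth nop (read_num x) 1) (sx (nth nop (read_num x) 0) r) = r1.
  rewrite /= hx; have -> : eset r Tv (VInt z) x = VInt z by rewrite /Tv; ered.
  by rewrite /= -[Z.of_nat 0]/0%Z /r1; case: Z.ltb_spec => h; congr (eset _ _ (VInt _)); lia.
have e2 : sx (nth nop (read_num x) 2) r1 = r2.
  rewrite /= {1}/r1 {1}/eset /= -[Z.of_nat 0]/0%Z /r2 /w2.
  have -> : (Z.abs z =? 0)%Z = (z =? 0)%Z by lia.
  by case: Z.eqb_spec => // _; rewrite (sx_pushs _ hR1).
have h2V : r2 Vv = VInt (Z.abs z) by rewrite /r2; case: ifP => _; rewrite /r1 /Rv /Vv; ered.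
have h2R : r2 Rv = VInt (dval (word w2)) by rewrite /r2 /w2; case: (z =? 0)%Z; [rewrite eset_eq | exact: hR1].
have h2T : r2 Tv = VInt z by rewrite /r2; case: ifP => _; rewrite /r1 /Rv /Vv /Tv; ered.
have hn : zsize (Z.abs z) = Z.of_nat (Z.to_nat (zsize z)).
  by have := @zsize_ge0 z; rewrite /zsize Z.abs_idemp; lia.
have [|h3 f3] := @read_bits_ok _ 0 (Z.abs z) w2 r2 _ hn h2V h2R; first lia.
set r3 := for_loop _ _ _ _ in h3 f3.
have e3 : sx (nth nop (read_num x) 3) r2 = r3 by rewrite /= h2T.
have hr' : r' = sx (nth nop (read_num x) 4) r3.
  by rewrite /r' -e3 -e2 -e1.
have h3x : r3 x = VInt z.
  rewrite f3 ?inE; last by rewrite /Rv /Vv (negPf xJ); lia.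
  by rewrite /r2; case: ifP => _; rewrite /r1 /Rv /Vv /Tv; ered.
rewrite hr' /= h3x /= -[Z.of_nat 0]/0%Z.
have hf y : y \notin [:: Rv; Vv; Tv; J] -> r3 y = r y.
  rewrite !inE => /norP [y1 /norP [y2 /norP [y3 y4]]].
  rewrite f3; last by rewrite !inE negb_or y1 negb_or y2.
  rewrite /r2 /r1; case: ifP => _; rewrite /eset ?(negPf y1) (negPf y2) (negPf y3) //.
have hw : word (enc_Z z ++ w) =
   if (z <? 0)%Z then embed M SMinus :: word (zbits (Z.abs z) ++ w2)
   else word (zbits (Z.abs z) ++ w2).
  by rewrite /w2; case: (z).
rewrite hw; case: Z.ltb_spec => hz; last by [].
rewrite (sx_pushs _ h3) eset_eq; split=> // y hy.
by rewrite -hf // /eset; move: hy; rewrite inE => /norP [/negPf ->].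
Qed.

Lemma read_input_ok xs zs r :
  size xs = size zs -> all (fun x => (9 < x) && (x != J)) xs ->
  (forall i, i < size xs -> r (nth 0 xs i) = VInt (nth 0%Z zs i)) ->
  r Rv = VInt 0 ->
  let r' := sxs (read_input xs) r in
  r' Rv = VInt (dval (word (enc_input zs))) /\ frame_eq [:: Rv; Vv; Tv; J] r r'.
Proof.
elim: xs zs r => [|x xs IH] [|z zs] r // [sz] /andP [/andP [x9 xJ] hxs] hr hR.
have hrx : r x = VInt z by exact: (hr 0).
case: xs zs sz hxs hr IH => [|x' xs] [|z' zs] // sz hxs hr IH.
  have [h1 h2] := @read_num_ok x z [::] r x9 xJ hrx hR.
  by rewrite cats0 in h1.
have [|h1 h2] := IH (z' :: zs) r sz hxs _ hR; first by move=> i hi; exact: (hr i.+1).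
set r1 := sxs _ _ in h1 h2.
rewrite [read_input _]/= -/(read_input (x' :: xs)) sxs_cat -/r1.
rewrite [enc_input _]/= -/(enc_input (z' :: zs)).
rewrite sxs_cons (sx_pushs _ h1); set r2 := eset _ _ _.
have h2x : r2 x = VInt z.
  rewrite /r2 /Rv; ered; rewrite h2 // !inE (negPf xJ) /Rv /Vv /Tv; lia.
have [h3 h4] := @read_num_ok x z (SSep :: enc_input (z' :: zs)) r2 x9 xJ h2x (eset_eq _ _ _).
split=> // y hy; rewrite h4 // /r2 /eset -h2 //.
by move: hy; rewrite inE => /norP [/negPf ->].
Qed.

End ProgramInput.

#[local] Opaque emul push pushs.

Lemma for_loopS A (F : Z -> A -> A) j n r :
  for_loop F j n.+1 r = for_loop F (j + 1) n (F j r).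
Proof. by []. Qed.

(** The pair holds a sign flag and a magnitude built by Horner's rule. *)
Definition dec_sym (a : Z * Z) (s : sym) : Z * Z :=
  match s with
  | S0 => (a.1, a.2 + a.2)%Z
  | S1 => (a.1, a.2 + a.2 + 1)%Z
  | _ => (1%Z, a.2)
  end.

(** [SMinus] is included: these are the symbols that [enc_Z] uses. *)
Definition is_digit (s : sym) : bool := if s is SSep then false else true.

Lemma dec_bits p a u :
  foldl dec_sym (a, 0%Z) (bits_pos p ++ u) = foldl dec_sym (a, Zpos p) u.
Proof.
elim: p u => [p IH|p IH|] u //=; rewrite cat_rcons IH /=; congr (foldl _ (_, _) _); lia.
Qed.

Lemma dec_enc y : let: (n, v) := foldl dec_sym (0%Z, 0%Z) (enc_Z y) in
  y = (if n =? 1 then - v else v)%Z.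
Proof.
by case: y => [|p|p] //=; rewrite -[bits_pos p]cats0 dec_bits.
Qed.

Lemma all_digit y : all is_digit (enc_Z y).
Proof.
have h p : all is_digit (bits_pos p) by elim: p => //= p IH; rewrite all_rcons.
by case: y => //= p; rewrite h.
Qed.

Fixpoint nest (k x : nat) (s : stmt) : stmt :=
  if k is k'.+1 then SFor x (EVar Yv) (nest k' x.+1 s) else s.

(** [P i] stands for the situation after [i] executions of [s]; it has to survive writes to the loop
    variables, which start at [J]. *)
Lemma nest_ok (P : nat -> (nat -> val) -> Prop) y J s k x i r :
  (forall i r, P i r -> r Yv = VInt y) ->
  (forall i r x j, J <= x -> P i r -> P i (eset r x (VInt j))) ->
  (forall i r, P i r -> P i.+1 (sx s r)) ->
  J <= x -> P i r -> P (i + Z.to_nat (zsize y) ^ k) (sx (nest k x s) r).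
Proof.
move=> hy he hs; elim: k x i r => [|k IH] x i r hx hP.
  by rewrite expn0 addn1; apply: hs.
rewrite /= (hy _ _ hP) expnS; set N := _ ^ k.
elim: (Z.to_nat _) (0%Z) i r hP => [|n IHn] j i r hP /=; first by rewrite addn0.
rewrite mulSn addnA; apply: IHn; apply: IH; [exact: leqW | exact: he].
Qed.

(** * Simulating single steps of the machine *)

Section Steps.
Variable M : TM.

Let G := tsym M.
Let Bq := #|G|.+1.

Definition qcode (q : state M) : nat := enum_rank q.

(** Halting states idle, so the loops may run longer than the machine. *)
Definition delta_halt (q : state M) (g : G) : state M * G * move :=
  if halting q then (q, g, MStay) else delta q g.

Definition pop (x : nat) : seq stmt :=
  [:: SAssign Av (EOp OMod [:: EVar x; ENum Bq]);
      SAssign x (EOp ODiv [:: EVar x; ENum Bq])].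

Definition trans (a : state M * G * move) : stmt :=
  let: (q, g, mv) := a in
  SBlock (SAssign Qv (ENum (qcode q)) ::
    match mv with
    | MRight => [:: push M Lv (digit g)]
    | MStay => [:: push M Rv (digit g)]
    | MLeft => push M Rv (digit g) :: pop Lv ++
        [:: SAssign Rv (EOp OAdd [:: emul Bq (EVar Rv); EVar Av])]
    end).

Definition dispatch (l : seq (state M * G)) : stmt :=
  foldr (fun a s => SIf (EOp OAnd [:: eq_num Qv (qcode a.1); eq_num Av (digit a.2)])
                        (trans (delta_halt a.1 a.2)) s) nop l.

Definition sim_step : stmt := SBlock (pop Rv ++ [:: dispatch (enum {: state M * G})]).

Lemma sx_pop x r l : x <> Av -> r x = VInt (dval l) ->
  sxs (pop x) r = eset (eset r Av (VInt (Z.of_nat (digit (head (blank M) l)))))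
    x (VInt (dval (behead l))).
Proof.
move=> hx hr; rewrite /sxs /= hr /= dval_rem; congr eset.
by rewrite {1}/eset; case: eqP => // _; rewrite hr /= dval_quot.
Qed.

Lemma sx_dispatch l q g r : (q, g) \in l ->
  r Qv = VInt (Z.of_nat (qcode q)) -> r Av = VInt (Z.of_nat (digit g)) ->
  sx (dispatch l) r = sx (trans (delta_halt q g)) r.
Proof.
move=> + hq hg; elim: l => // -[q' g'] l IH; rewrite in_cons /= hq hg /=.
case: Z.eqb_spec => [e1|n1]; case: Z.eqb_spec => [e2|n2] /=; last 3 first.
- by case/orP => [/eqP [_ e]|/IH //]; rewrite e in n2.
- by case/orP => [/eqP [e _]|/IH //]; rewrite e in n1.
- by case/orP => [/eqP [e _]|/IH //]; rewrite e in n1.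
move=> _; have -> : q' = q by apply/esym/enum_rank_inj/ord_inj/Nat2Z.inj.
by have -> : g' = g by apply/esym/digit_inj/Nat2Z.inj.
Qed.

Lemma dval_cons (g : G) l :
  dval (g :: l) = (Z.of_nat (digit g) + Z.of_nat Bq * dval l)%Z.
Proof. by []. Qed.

(** No variable holds the head position, as the halves are relative to it. The lists are existential
    because trailing blanks do not change the numbers. *)
Definition tm_rep (y : Z) (c : config M) (r : nat -> val) : Prop :=
  exists L R, [/\ ctape c = ztape (blank M) (chead c) L R,
    r Qv = VInt (Z.of_nat (qcode (cstate c))),
    r Lv = VInt (dval L), r Rv = VInt (dval R) & r Yv = VInt y].

Lemma step_delta (c : config M) :
  step c = let: (q, g, mv) := delta_halt (cstate c) (ctape c (chead c)) in
    Config q (twrite (ctape c) (chead c) g) (chead c + move_off mv)%Z.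
Proof.
rewrite /step /delta_halt; case: ifP => // _; case: c => q t h /=.
congr Config; last by rewrite Z.add_0_r.
by apply: functional_extensionality => z; rewrite /twrite; case: Z.eqb_spec => // ->.
Qed.

Lemma sim_step_ok y c r : tm_rep y c r -> tm_rep y (step c) (sx sim_step r).
Proof.
case=> L [R [ht hq hL hR hy]].
rewrite /sim_step -/(sxs _ r) sxs_cat (sx_pop _ hR) //.
set g := head (blank M) R; set r1 := eset _ Rv _.
have h1q : r1 Qv = VInt (Z.of_nat (qcode (cstate c))) by rewrite /r1 /Qv /Av /Rv; ered.
have h1L : r1 Lv = VInt (dval L) by rewrite /r1 /Lv /Av /Rv; ered.
have h1R : r1 Rv = VInt (dval (behead R)) by rewrite /r1 eset_eq.
have h1A : r1 Av = VInt (Z.of_nat (digit g)) by rewrite /r1 /Av /Rv; ered.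
have h1y : r1 Yv = VInt y by rewrite /r1 /Yv /Av /Rv; ered.
rewrite sxs_cons [sxs _ _]/= (sx_dispatch (mem_enum _ _) h1q h1A) //.
have htg : ctape c = ztape (blank M) (chead c) L (g :: behead R).
  by rewrite ht /g; case: (R) => //; rewrite ztape_nilr.
have -> : step c = let: (q, g, mv) := delta_halt (cstate c) g in
    Config q (twrite (ctape c) (chead c) g) (chead c + move_off mv)%Z.
  by rewrite step_delta {1}htg ztape_read.
rewrite htg; case: (delta_halt _ _) => [[q' g'] mv].
pose r2 := eset r1 Qv (VInt (Z.of_nat (qcode q'))).
have h2L : r2 Lv = VInt (dval L) by rewrite /r2 /Lv /Qv; ered.
have h2R : r2 Rv = VInt (dval (behead R)) by rewrite /r2 /Rv /Qv; ered.
have h2q : r2 Qv = VInt (Z.of_nat (qcode q')) by rewrite /r2 eset_eq.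
have h2y : r2 Yv = VInt y by rewrite /r2 /Yv /Qv; ered.
case: mv.
(* The written digit is pushed on the right half, then the digit popped from the left half into [Av]
   is pushed on top of it. *)
- have -> : sx (trans (q', g', MLeft)) r1 = sxs (pop Lv ++
        [:: SAssign Rv (EOp OAdd [:: emul Bq (EVar Rv); EVar Av])])
      (sx (push M Rv (digit g')) r2) by [].
  rewrite sxs_cat (sx_push _ h2R erefl); set r3 := eset r2 Rv _.
  have h3L : r3 Lv = VInt (dval L) by rewrite /r3 /Lv /Rv; ered.
  rewrite (sx_pop _ h3L) //; set r4 := eset _ Lv _.
  have h4R : r4 Rv = VInt (dval (g' :: behead R)) by rewrite /r4 /r3 /Lv /Rv /Av; ered.
  exists (behead L), (head (blank M) L :: g' :: behead R); split.
  + rewrite /twrite /=; case: (L) => [|a L'] /=; last by rewrite -/(twrite _ _ _) ztape_left.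
    by rewrite -/(twrite _ _ _) ztape_nill ztape_left.
  + by rewrite /r4 /r3 /= /Rv /Lv /Qv /Av; ered.
  + by rewrite /r4 /r3 /= /Rv /Lv /Qv /Av; ered.
  + rewrite /sxs /= (@vev_emul r4 Bq (EVar Rv) _ h4R) eset_eq.
    have h : (Z.of_nat Bq * dval (g' :: behead R) + Z.of_nat (digit (head (blank M) L)) =
        dval (head (blank M) L :: g' :: behead R))%Z by rewrite [RHS]dval_cons; lia.
    by congr VInt.
  + by rewrite /r4 /r3 /= /Rv /Lv /Yv /Av; ered.
- have -> : sx (trans (q', g', MRight)) r1 = sx (push M Lv (digit g')) r2 by [].
  rewrite (sx_push _ h2L erefl); exists (g' :: L), (behead R); split=> //=.
  by rewrite ztape_right.
- have -> : sx (trans (q', g', MStay)) r1 = sx (push M Rv (digit g')) r2 by [].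
  rewrite (sx_push _ h2R erefl); exists L, (g' :: behead R); split=> //=.
  by rewrite Z.add_0_r ztape_stay.
Qed.

(** * Decoding the output *)

Definition decode_sym : stmt :=
  SIf (eq_num Sv 0)
    (SIf (eq_num Av (digit (embed M S0)))
       (SAssign Ov (EOp OAdd [:: EVar Ov; EVar Ov]))
    (SIf (eq_num Av (digit (embed M S1)))
       (SAssign Ov (EOp OAdd [:: EOp OAdd [:: EVar Ov; EVar Ov]; ENum 1]))
    (SIf (eq_num Av (digit (embed M SMinus)))
       (SAssign Nv (ENum 1)) (SAssign Sv (ENum 1)))))
    nop.

Definition decode_body : stmt := SBlock (pop Rv ++ [:: decode_sym]).

Lemma sx_decode_body r l : r Rv = VInt (dval l) ->
  sx decode_body r = sx decode_sym
    (eset (eset r Av (VInt (Z.of_nat (digit (head (blank M) l)))))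
      Rv (VInt (dval (behead l)))).
Proof. by move=> h; rewrite /decode_body -/(sxs _ r) sxs_cat (sx_pop _ h). Qed.

Lemma eqb_digit g g' : (Z.of_nat (digit g) =? Z.of_nat (digit g'))%Z = (g == g' :> G).
Proof.
by case: Z.eqb_spec => [/Nat2Z.inj /digit_inj ->|ne]; rewrite ?eqxx //; case: eqP => // e; rewrite e in ne.
Qed.

Lemma eqb_embed s s' : (embed M s == embed M s' :> G) =
  match s, s' with S0, S0 | S1, S1 | SMinus, SMinus | SSep, SSep => true | _, _ => false end.
Proof.
case: eqP => [/(@embed_inj M) ->|]; first by case: s'.
by case: s; case: s'.
Qed.

(** The decoding loop may run past the output, where arbitrary symbols can stand; the flag [Sv]
    protects the result. *)
Lemma decode_stopped J n j r : 9 < J -> r Sv = VInt 1 -> (exists l : seq G, r Rv = VInt (dval l)) ->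
  let r' := for_loop (fun j r => sx decode_body (eset r J (VInt j))) j n r in
  r' Ov = r Ov /\ r' Nv = r Nv.
Proof.
move=> hJ; elim: n j r => [|n IH] j r hS [l hR] //; rewrite for_loopS; set r0 := eset r J _.
have h0R : r0 Rv = VInt (dval l) by rewrite /r0 /Rv; ered.
rewrite (sx_decode_body h0R); set r1 := eset _ Rv _; rewrite /=.
have -> /= : r1 7 = VInt 1 by rewrite /r1 /r0 /Sv /Rv /Av; ered.
have [||-> ->] := IH (j + 1)%Z r1.
- by rewrite /r1 /r0 /Sv /Rv /Av; ered.
- by exists (behead l); rewrite /r1 eset_eq.
by rewrite /r1 /r0 /Ov /Nv /Rv /Av; split; ered.
Qed.

Lemma decode_ok J u l n j r a : 9 < J -> all is_digit u -> size u <= n ->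
  (forall i, i < size u -> nth (blank M) l i = embed M (nth S0 u i)) ->
  nth (blank M) l (size u) = blank M ->
  r Sv = VInt 0 -> r Rv = VInt (dval l) -> r Nv = VInt a.1 -> r Ov = VInt a.2 ->
  let r' := for_loop (fun j r => sx decode_body (eset r J (VInt j))) j n r in
  r' Nv = VInt (foldl dec_sym a u).1 /\ r' Ov = VInt (foldl dec_sym a u).2.
Proof.
move=> hJ; elim: n j u l r a => [|n IH] j u l r a hu hn hl hb hS hR hN hO.
  by case: u hu hn hl hb => //.
rewrite for_loopS; set r0 := eset r J _.
have h0R : r0 Rv = VInt (dval l) by rewrite /r0 /Rv; ered.
rewrite (sx_decode_body h0R); set r1 := eset _ Rv _.
set g := head (blank M) l in r1 *.
have h1S : r1 Sv = VInt 0 by rewrite /r1 /r0 /Sv /Rv /Av; ered.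
have h1A : r1 Av = VInt (Z.of_nat (digit g)) by rewrite /r1 /r0 /Rv /Av; ered.
have h1N : r1 Nv = VInt a.1 by rewrite /r1 /r0 /Nv /Rv /Av; ered.
have h1O : r1 Ov = VInt a.2 by rewrite /r1 /r0 /Ov /Rv /Av; ered.
have h1R : r1 Rv = VInt (dval (behead l)) by rewrite /r1 eset_eq.
clearbody r1; rewrite /= h1S h1A /= !eqb_digit.
case: u hu hn hl hb => [|s u] hu hn hl hb.
  have -> : g = blank M by rewrite /g -nth0.
  have hne s : (blank M == embed M s :> G) = false.
    by apply/eqP => /esym; exact: embed_blank.
  rewrite !hne; set r2 := eset r1 Sv _.
  have [||-> ->] := @decode_stopped J n (j + 1)%Z r2 hJ.
  - by rewrite /r2 eset_eq.
  - by exists (behead l); rewrite /r2 /Sv /Rv; ered.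
  by rewrite /r2 /Nv /Ov /Sv; split; ered.
have -> : g = embed M s by rewrite /g -nth0 (hl 0).
have hl' i : i < size u -> nth (blank M) (behead l) i = embed M (nth S0 u i).
  by move=> hi; rewrite nth_behead; exact: (hl i.+1).
have hb' : nth (blank M) (behead l) (size u) = blank M by rewrite nth_behead.
rewrite !eqb_embed; case: s hu hn {hl hb} => //= hu hn; rewrite ?h1O /=;
  apply: (IH _ u (behead l)) => //=; rewrite /Sv /Rv /Nv /Ov; ered => //.
Qed.

End Steps.

(** * Typing of the simulating program *)

Definition tint (G : tenv) (l : bool) (e : expr) : Prop :=
  exists2 t, typ_e G l e t & isInt t.

(** Adding loop variables preserves this, so statements typed under it can be placed at any loop
    depth. *)
Definition work_env (G : tenv) : Prop :=
  [/\ forall x, x < 8 -> G x = Some TInt, G Yv = Some TIint & G Tv = Some TIint].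

Lemma tint_var G l x t : G x = Some t -> isInt t -> tint G l (EVar x).
Proof. by move=> h ht; exists t => //; apply: TyVar. Qed.

Lemma tint_num G l n : tint G l (ENum n).
Proof. by exists TIint => //; apply: TyNum. Qed.

Lemma tint_neg G l a : tint G l a -> tint G l (EOp ONeg [:: a]).
Proof.
case=> t h ht; exists t => //; apply: (@TyOp _ _ _ _ [:: t]); first by repeat constructor.
by rewrite /= ht.
Qed.

Lemma tint_op o G l a b :
  match o with OAdd | OSub | ODiv | OMod => True | _ => False end ->
  tint G l a -> tint G l b -> tint G l (EOp o [:: a; b]).
Proof.
move=> ho [t h ht] [u k hu]; exists (tsup t u); last by case: (t) ht; case: (u) hu.
apply: (@TyOp _ _ _ _ [:: t; u]); first by repeat constructor.
by case: o ho => // _; rewrite /= ht hu.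
Qed.

Lemma typ_cmp o G l a b :
  match o with OGe | OLe | OGt | OLt | OEq | ONe => True | _ => False end ->
  tint G l a -> tint G l b -> typ_e G l (EOp o [:: a; b]) TBool.
Proof.
move=> ho [t h ht] [u k hu].
apply: (@TyOp _ _ _ _ [:: t; u]); first by repeat constructor.
by case: o ho => // _; rewrite /= ht hu.
Qed.

Lemma typ_and G l a b :
  typ_e G l a TBool -> typ_e G l b TBool -> typ_e G l (EOp OAnd [:: a; b]) TBool.
Proof. by move=> h k; apply: (@TyOp _ _ _ _ [:: TBool; TBool]) => //; repeat constructor. Qed.

Lemma tint_emul G l n e : tint G l e -> tint G l (emul n e).
Proof.
move=> h; elim: n => [|n IH]; first exact: tint_num.
exact: (@tint_op OAdd).
Qed.

(** Holds for either loop indicator since the variables below 8 are [int]. *)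
Lemma typ_assign G l x e : work_env G -> x < 8 -> tint G l e -> typ_s G l (SAssign x e) G.
Proof.
move=> [h _ _] hx [t ht it]; apply: (TyAssign (tx := TInt)) ht _.
- exact: h.
- by case.
- by left.
Qed.

Lemma typ_seq_forall G l ss :
  List.Forall (fun s => typ_s G l s G) ss -> typ_seq G l ss G.
Proof. by elim=> [|s ss' h _ IH]; [constructor | apply: TyCons h IH]. Qed.

Lemma Forall_cat A (P : A -> Prop) (s1 s2 : seq A) :
  List.Forall P s1 -> List.Forall P s2 -> List.Forall P (s1 ++ s2).
Proof. by move=> h1 h2; elim: h1 => //= x s hx _; constructor. Qed.

Lemma typ_block G l ss :
  List.Forall (fun s => typ_s G l s G) ss -> typ_s G l (SBlock ss) G.
Proof. by move=> h; apply: TyBlock (typ_seq_forall h). Qed.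

Lemma typ_nop G l : typ_s G l nop G.
Proof. by apply: typ_block; constructor. Qed.

Lemma typ_if G l e s1 s2 :
  typ_e G l e TBool -> typ_s G l s1 G -> typ_s G l s2 G -> typ_s G l (SIf e s1 s2) G.
Proof. exact: TyIf. Qed.

Lemma typ_for G l x y s : G y = Some TIint -> G x = None ->
  typ_s (upd G x TIint) true s (upd G x TIint) -> typ_s G l (SFor x (EVar y) s) G.
Proof.
move=> hy hx hs; apply: TyFor hx hs.
apply: (@TyOp _ _ _ _ [:: TIint]) => //.
by constructor; [apply: TyVar | constructor].
Qed.

Lemma work_env_upd G x : work_env G -> 9 < x -> work_env (upd G x TIint).
Proof.
move=> [h1 h2 h3] hx; have hy y : y < 10 -> upd G x TIint y = G y.
  by rewrite /upd; case: eqP => // ->; lia.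
by split=> [y h||]; rewrite hy //; [exact: h1 | lia].
Qed.

Lemma tint_work G l x : work_env G -> x < 10 -> tint G l (EVar x).
Proof.
move=> [h1 h2 h3] hx; have [x8|x8] := ltnP x 8; first by apply: tint_var (h1 _ x8) _.
have : x = 8 \/ x = 9 by lia.
by case=> ->; [apply: tint_var h2 _ | apply: tint_var h3 _].
Qed.

Lemma typ_eq_num G l x n : work_env G -> x < 10 -> typ_e G l (eq_num x n) TBool.
Proof. by move=> h hx; apply: typ_cmp => //; [apply: tint_work | apply: tint_num]. Qed.

Lemma typ_nest G l k x s : work_env G -> 9 < x -> (forall y, x <= y -> G y = None) ->
  (forall G l, work_env G -> typ_s G l s G) -> typ_s G l (nest k x s) G.
Proof.
move=> + + + hs; elim: k G l x => [|k IH] G l x hG hx hn /=; first exact: hs.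
apply: typ_for; [by case: hG | exact: hn |].
apply: IH; [exact: work_env_upd | exact: leqW |].
by move=> y hy; rewrite /upd; case: eqP => [e|_]; [lia | apply: hn; lia].
Qed.

Definition decls : seq stmt :=
  [:: SDecl TInt Rv; SDecl TInt Lv; SDecl TInt Qv; SDecl TInt Av; SDecl TInt Vv;
      SDecl TInt Nv; SDecl TInt Ov; SDecl TInt Sv; SDecl TIint Yv; SDecl TIint Tv].

Definition env_decls (G : tenv) : tenv :=
  upd (upd (upd (upd (upd (upd (upd (upd (upd (upd G Rv TInt) Lv TInt) Qv TInt)
    Av TInt) Vv TInt) Nv TInt) Ov TInt) Sv TInt) Yv TIint) Tv TIint.

Lemma typ_decls G : (forall x, x < 10 -> G x = None) -> typ_seq G false decls (env_decls G).
Proof.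
move=> h; do 10 (apply: TyCons; first by apply: TyDecl; [rewrite /upd /= h | case]).
exact: TyNil.
Qed.

Lemma work_env_decls G : work_env (env_decls G).
Proof. by split=> //; do 8 (case=> //). Qed.

Lemma env_decls_ge G x : 9 < x -> env_decls G x = G x.
Proof.
move=> hx; rewrite /env_decls /upd /Rv /Lv /Qv /Av /Vv /Nv /Ov /Sv /Yv /Tv.
by do 10 (case: eqP => [e|_]; first by rewrite e in hx).
Qed.

Lemma typ_cat G G1 G2 l s1 s2 :
  typ_seq G l s1 G1 -> typ_seq G1 l s2 G2 -> typ_seq G l (s1 ++ s2) G2.
Proof.
elim: s1 G => [|s s1 IH] G h1 h2; first by inversion h1; subst.
inversion h1 as [|? ? ? ? G3 ? h3 h4]; subst.
by apply: TyCons h3 _; apply: IH h4 h2.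
Qed.

Section Typing.
Variable M : TM.

Lemma typ_push G l x n : work_env G -> x < 8 -> typ_s G l (push M x n) G.
Proof.
Transparent push.
move=> h hx; apply: typ_assign => //; apply: (@tint_op OAdd) => //; last exact: tint_num.
by apply: tint_emul; apply: tint_work => //; lia.
Opaque push.
Qed.

Lemma typ_pop G l x : work_env G -> x < 8 ->
  List.Forall (fun s => typ_s G l s G) (pop M x).
Proof.
move=> h hx; repeat constructor; apply: typ_assign => //.
  by apply: (@tint_op OMod) => //; [apply: tint_work => //; lia | apply: tint_num].
by apply: (@tint_op ODiv) => //; [apply: tint_work => //; lia | apply: tint_num].
Qed.

Lemma typ_pushs G l s : work_env G -> typ_s G l (pushs M s) G.
Proof. by move=> h; apply: typ_push. Qed.

Lemma typ_sim_step G l : work_env G -> typ_s G l (sim_step M) G.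
Proof.
move=> h; apply: typ_block; apply: Forall_cat; first exact: typ_pop.
constructor; last by constructor.
elim: (enum _) => [|[q g] s IH] /=; first exact: typ_nop.
apply: typ_if => //; first by apply: typ_and; apply: typ_eq_num.
case: (delta_halt q g) => [[q' g'] mv]; apply: typ_block.
constructor; first by apply: typ_assign => //; exact: tint_num.
case: mv; repeat constructor; try exact: typ_push; try (apply: typ_assign => //).
- by apply: (@tint_op OMod) => //; [apply: tint_work | apply: tint_num].
- by apply: (@tint_op ODiv) => //; [apply: tint_work | apply: tint_num].
- by apply: (@tint_op OAdd) => //; [apply: tint_emul; apply: tint_work | apply: tint_work].
Qed.

Lemma typ_decode G l : work_env G -> typ_s G l (decode_body M) G.
Proof.
move=> h; apply: typ_block; apply: Forall_cat; first exact: typ_pop.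
repeat constructor; rewrite /decode_sym.
repeat first [apply: typ_if | exact: typ_nop | exact: typ_eq_num | apply: typ_assign => // |
  exact: tint_num | apply: (@tint_op OAdd) => // | exact: tint_work].
Qed.

Lemma typ_read_num G J x : work_env G -> 9 < J -> G J = None -> G x = Some TInt ->
  List.Forall (fun s => typ_s G false s G) (read_num M J x).
Proof.
move=> h hJ hn hx; have tx l : tint G l (EVar x) by apply: tint_var hx _.
repeat apply: List.Forall_cons; last exact: List.Forall_nil.
- apply: (TyAssign (tx := TIint) (te := TInt)); [by case: h | by case | exact: TyVar | by left].
- apply: typ_if; first by apply: typ_cmp => //; exact: tint_num.
    by apply: typ_assign => //; apply: tint_neg.
  by apply: typ_assign.
- by apply: typ_if; [exact: typ_eq_num | exact: typ_pushs | exact: typ_nop].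
- apply: typ_for => //; first by case: h.
  have h' := work_env_upd h hJ.
  apply: typ_block; repeat apply: List.Forall_cons; last exact: List.Forall_nil.
    apply: typ_if; [|exact: typ_pushs|exact: typ_pushs].
    apply: typ_cmp => //; last exact: tint_num.
    by apply: (@tint_op OMod) => //; [exact: tint_work | exact: tint_num].
  by apply: typ_assign => //; apply: (@tint_op ODiv) => //; [exact: tint_work | exact: tint_num].
- apply: typ_if; [|exact: typ_pushs|exact: typ_nop].
  by apply: typ_cmp => //; exact: tint_num.
Qed.

Lemma typ_read_input G J xs : work_env G -> 9 < J -> G J = None ->
  (forall x, x \in xs -> G x = Some TInt) ->
  List.Forall (fun s => typ_s G false s G) (read_input M J xs).
Proof.
move=> h hJ hn; elim: xs => [|x xs IH] hx; first exact: List.Forall_nil.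
have hr := typ_read_num h hJ hn (hx x (mem_head _ _)).
case: xs IH hx => [|x' xs] IH hx //.
rewrite [read_input _ _ _]/= -/(read_input M J (x' :: xs)).
apply: Forall_cat.
  by apply: IH => y hy; apply: hx; rewrite in_cons hy orbT.
by apply: List.Forall_cons hr; exact: typ_pushs.
Qed.

(** Inputs are the variables from 10 on, loop variables start at [10 + m]. [Yv] is fixed before the
    simulation starts to change [Rv]; [Tv] later takes the final [Rv] to bound the decoding loop. *)
Definition sim_body (m c k : nat) : seq stmt :=
  let J := 10 + m in
  decls ++ (read_input M J (iota 10 m) ++
  [:: SAssign Yv (EOp OAdd [:: EOp OAdd [:: EVar Rv; EVar Rv]; ENum (2 ^ c)]);
      SAssign Qv (ENum (qcode (start M)));
      nest k.+1 J (sim_step M);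
      SAssign Nv (ENum 0); SAssign Ov (ENum 0); SAssign Sv (ENum 0);
      SAssign Tv (EVar Rv);
      SFor J (EVar Tv) (decode_body M);
      SIf (eq_num Nv 1) (SAssign Ov (EOp ONeg [:: EVar Ov])) nop]).

Definition sim_prog m c k := Prog (iota 10 m) (sim_body m c k) (EVar Ov).

Lemma typ_sim_body m c k :
  typ_seq (tenv0 (iota 10 m)) false (sim_body m c k) (env_decls (tenv0 (iota 10 m))).
Proof.
set G0 := tenv0 _; have hG0 x : x < 10 -> G0 x = None.
  by move=> hx; rewrite /G0 /tenv0 mem_iota leqNgt hx.
have hn x : 10 + m <= x -> env_decls G0 x = None.
  move=> hx; rewrite env_decls_ge /G0 /tenv0 ?mem_iota; last lia.
  by rewrite [x < _]ltnNge hx andbF.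
have h := work_env_decls G0; apply: typ_cat (typ_decls hG0) _.
apply: typ_seq_forall; apply: Forall_cat.
  apply: typ_read_input => //; first exact: hn.
  by move=> x hx; rewrite env_decls_ge /G0 /tenv0 ?hx //; move: hx; rewrite mem_iota; lia.
repeat apply: List.Forall_cons; last exact: List.Forall_nil.
- apply: (TyAssign (tx := TIint) (te := TInt)); [by case: h | by case | | by left].
  have t2 : typ_e (env_decls G0) false (EOp OAdd [:: EVar Rv; EVar Rv]) TInt.
    apply: (@TyOp _ _ _ _ [:: TInt; TInt]) => //.
    by repeat constructor; case: h => h _ _; apply: h.
  apply: (@TyOp _ _ _ _ [:: TInt; TIint]) => //.
  by constructor => //; constructor; [exact: TyNum | constructor].
- by apply: typ_assign => //; exact: tint_num.
- by apply: typ_nest => // *; exact: typ_sim_step.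
- by apply: typ_assign => //; exact: tint_num.
- by apply: typ_assign => //; exact: tint_num.
- by apply: typ_assign => //; exact: tint_num.
- apply: (TyAssign (tx := TIint) (te := TInt)); [by case: h | by case | | by left].
  by apply: TyVar; case: h => h _ _; apply: h.
- apply: typ_for; [by case: h | exact: hn | apply: typ_decode].
  exact: work_env_upd.
- apply: typ_if; [exact: typ_eq_num | | exact: typ_nop].
  by apply: typ_assign => //; apply: tint_neg; exact: tint_work.
Qed.

End Typing.

(** * Correctness of the simulation *)

Lemma zsize_gt z i : (2 ^ Z.of_nat i <= z)%Z -> (Z.of_nat i < zsize z)%Z.
Proof.
move=> h; have hp := @pow2_gt0 i; rewrite /zsize.
by apply/Z.log2_up_lt_pow2; lia.
Qed.

Lemma init_config_word (M : TM) w :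
  ctape (init_config M w) = ztape (blank M) 0 [::] (word M w).
Proof.
apply: functional_extensionality => z; rewrite /ztape /=.
case: (Z.ltb_spec z 0) => hz.
  by rewrite nth_nil; case: Z.leb_spec => // ?; lia.
case: Z.leb_spec => /= h0; last lia; rewrite Z.sub_0_r.
case: Z.ltb_spec => h; last by rewrite nth_default // size_map; lia.
by rewrite (nth_map S0) //; lia.
Qed.

Lemma iter_halting (M : TM) (c : config M) t n :
  halting (cstate (ssrnat.iter t (@step M) c)) -> t <= n ->
  ssrnat.iter n (@step M) c = ssrnat.iter t (@step M) c.
Proof.
move=> h /subnK <-; rewrite iterD; elim: (n - t) => //= d ->.
by rewrite /step h.
Qed.

Lemma sxs_decls r x :
  sxs decls r x = if x < 10 then VInt 0 else r x.
Proof.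
rewrite /sxs /= /eset /Rv /Lv /Qv /Av /Vv /Nv /Ov /Sv /Yv /Tv.
by do 10 (case: eqP => [-> //|?]); case: ltnP => //; lia.
Qed.

(** The last symbol of a nonempty [w] is not blank, so its number is at least [2 ^ (size w - 1)],
    and doubling gains the missing bit. The summand [2 ^ c] covers the empty word. *)
Lemma sim_steps_bound (M : TM) w c y :
  y = (dval (word M w) + dval (word M w) + 2 ^ Z.of_nat c)%Z ->
  (size w).+1 <= Z.to_nat (zsize y) /\ c <= Z.to_nat (zsize y).
Proof.
move=> ->; set d := dval _; have d0 : (0 <= d)%Z by exact: dval_ge0.
have hc := @pow2_gt0 c; split; last first.
  by have := @zsize_gt (d + d + 2 ^ Z.of_nat c) c; lia.
suff : (2 ^ Z.of_nat (size w) <= d + d + 2 ^ Z.of_nat c)%Z by move/zsize_gt; lia.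
case/lastP: w @d d0 => [|w s] d d0; first by rewrite Z.pow_0_r; lia.
have := @dval_ge M (word M (rcons w s)) (size w).
rewrite -/d /word map_rcons nth_rcons size_map ltnn eqxx => /(_ (@embed_blank M s)).
by rewrite size_rcons fits_succ; lia.
Qed.

Lemma sim_body_ok (M : TM) m c k (xs : m.-tuple Z) r t y :
  (forall i, i < m -> r (10 + i) = VInt (nth 0%Z xs i)) ->
  t <= c * (size (enc_input xs)).+1 ^ k -> runs_within M xs t y ->
  sxs (sim_body M m c k) r Ov = VInt y.
Proof.
move=> hr ht [hh hold]; set w := enc_input xs in ht hh hold.
rewrite /sim_body sxs_cat; set r1 := sxs decls r.
have r1lt x : x < 10 -> r1 x = VInt 0 by move=> hx; rewrite /r1 sxs_decls hx.
have r1ge i : i < m -> r1 (10 + i) = VInt (nth 0%Z xs i).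
  by move=> hi; rewrite /r1 sxs_decls /= hr.
have J9 : 9 < 10 + m by lia.
have hsz : size (iota 10 m) = size xs by rewrite size_iota size_tuple.
have hxs : all (fun x => (9 < x) && (x != 10 + m)) (iota 10 m).
  by apply/allP => x; rewrite mem_iota; lia.
have hread i : i < size (iota 10 m) -> r1 (nth 0 (iota 10 m) i) = VInt (nth 0%Z xs i).
  by rewrite size_iota => hi; rewrite nth_iota // r1ge.
have [h2 f2] := @read_input_ok M _ J9 _ _ _ hsz hxs hread (r1lt Rv isT).
rewrite sxs_cat; set r2 := sxs _ r1 in h2 f2 *.
have r2L : r2 Lv = VInt 0 by rewrite f2 ?r1lt.
set Y := (dval (word M w) + dval (word M w) + 2 ^ Z.of_nat c)%Z.
have [hN1 hN2] := @sim_steps_bound M w c Y erefl.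
rewrite sxs_cons (_ : sx _ r2 = eset r2 Yv (VInt Y)); last first.
  by rewrite /= h2 /= -expn_pow Nat2Z.inj_pow.
rewrite sxs_cons [sx (SAssign Qv _) _]/=; set r3 := eset _ Qv _.
set c0 := init_config M w.
have rep0 : tm_rep Y c0 r3.
  exists [::], (word M w); split=> //; first exact: init_config_word.
rewrite sxs_cons; set r4 := sx _ r3.
set n := 0 + Z.to_nat (zsize Y) ^ k.+1.
have rep4 : tm_rep Y (ssrnat.iter n (@step M) c0) r4.
  apply: (@nest_ok (fun i r => tm_rep Y (ssrnat.iter i (@step M) c0) r) _ (10 + m)) => //.
  - by move=> i r' [L [R []]].
  - move=> i r' x j hx [L [R [g1 g2 g3 g4 g5]]]; exists L, R.
    by split=> //; rewrite -?g2 -?g3 -?g4 -?g5 /Qv /Lv /Rv /Yv; ered.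
  - by move=> i r'; rewrite iterS; apply: sim_step_ok.
(* One of the [k.+1] factors absorbs [c], each of the others one factor [(size w).+1]. *)
have tn : t <= n.
  rewrite /n add0n expnS; apply: leq_trans ht _; apply: leq_mul => //.
  case: (k) => // k'; by rewrite leq_exp2r.
rewrite (iter_halting hh tn) in rep4.
set cf := ssrnat.iter t _ _ in hh hold rep4; case: hold => hold1 hold2.
case: rep4 => L [R [g1 g2 g3 g4 g5]].
rewrite !sxs_cons [sx (SAssign Nv _) _]/= [sx (SAssign Ov _) _]/= [sx (SAssign Sv _) _]/=.
set r5 := eset _ Sv _.
have h5R : r5 Rv = VInt (dval R) by rewrite -g4.
rewrite [sx (SAssign Tv _) _]/= h5R; set r6 := eset _ Tv _.
have hnth i : ctape cf (chead cf + Z.of_nat i)%Z = nth (blank M) R i.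
  rewrite g1 /ztape; case: Z.ltb_spec => [|_]; first lia.
  by congr nth; lia.
rewrite hnth in hold2.
have hold i : i < size (enc_Z y) -> nth (blank M) R i = embed M (nth S0 (enc_Z y) i).
  by move=> hi; rewrite -hnth hold1.
(* The last output symbol is not blank, so the decoding loop is long enough to reach it. *)
have hsize : size (enc_Z y) <= Z.to_nat (zsize (dval R)).
  case E: (size (enc_Z y)) => [|l] //.
  have : (2 ^ Z.of_nat l <= dval R)%Z.
    by apply: dval_ge; rewrite hold ?E //; exact: embed_blank.
  by move/zsize_gt; lia.
have [h7N h7O] := @decode_ok M (10 + m) (enc_Z y) R _ 0 r6 (0, 0)%Z J9 (all_digit y)
  hsize hold hold2 erefl h5R erefl erefl.
rewrite (_ : sx (SFor _ _ _) r6 = for_loop (fun j r => sx (decode_body M) (eset r (10 + m) (VInt j))) 0 (Z.to_nat (zsize (dval R))) r6) //.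
set r7 := for_loop _ _ _ _ in h7N h7O *.
have := dec_enc y; move: h7N h7O; case: (foldl _ _ _) => a b /= h7N h7O hy.
rewrite /sxs /= h7N /= -[Z.of_nat 1]/1%Z; case: Z.eqb_spec hy => _ -> /=.
  by rewrite h7O.
exact: h7O.
Qed.

Lemma FP_FPC m (f : m.-tuple Z -> Z) : FP f -> FPC f.
Proof.
case=> M [c [k h]]; exists (sim_prog M m c k); split.
  split; first exact: iota_uniq.
  exists (env_decls (tenv0 (iota 10 m))), TInt; split; first exact: typ_sim_body.
  by split=> //; apply: TyVar.
split; first exact: size_iota.
move=> xs; have [t [ht hrun]] := h xs; rewrite expn_pow in ht.
(* The shift by 10 matches the parameter names [iota 10 m]. *)
pose r x := VInt (nth 0%Z xs (x - 10)).
have hsat : sat (tenv0 (iota 10 m)) (init_store (iota 10 m) xs) r.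
  move=> x u; rewrite /tenv0 /init_store; case: ifP => // hx [<-]; split=> //.
  congr (Some (VInt (nth _ _ _))); move: hx; rewrite mem_iota => hx.
  by rewrite -[in LHS](subnKC (proj1 (andP hx))) -[X in index X _](nth_iota 0 10 (n := m)) ?index_uniq ?size_iota ?iota_uniq //; lia.
have [S' h1 h2] := sx_ok.2 _ _ _ _ (@typ_sim_body M m c k) _ _ hsat.
exists S'; split=> //.
have [h3 _] := h2 Ov TInt erefl.
apply: EvVar; rewrite h3; congr Some; apply: sim_body_ok ht hrun.
by move=> i hi; rewrite /r addKn.
Qed.

Theorem theorem2 (m : nat) (f : m.-tuple Z -> Z) : FPC f <-> FP f.
Proof. by split; [exact: FPC_FP | exact: FP_FPC]. Qed.
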